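(* Let $M$ be an $n$-dimensional smooth manifold, $\nabla$ an affine connection on $M$ (not assumed torsion-free), and $\pi\colon TM\to M$ the tangent bundle. (1) Let $(I,J,K)$ be the almost para-quaternionic structure on the total space $TM$ induced by $\nabla$ (as defined in the context). Then the following conditions are equivalent: (1-a) $\nabla$ is flat, i.e. its curvature tensor and its torsion tensor both vanish. (1-b) $I$, $J$ and $K$ are individually integrable. (1-c) The almost para-quaternionic structure $(I,J,K)$ is integrable. (2) Let moreover $g$ be a Riemannian metric on $M$, and let $(I,J,K,h,k,\omega)$ be the almost Born structure on $TM$ induced by $(\nabla,g)$ (as defined in the context). Then the following conditions are equivalent: (2-a) $(\nabla,g)$ is a Hessian structure on $M$. (2-b) $(I,J,K,h,k,\omega)$ is integrable, i.e. $I$, $J$, $K$ are individually integrable and $d\omega=0$. (2-c) $(I,J,K,h,k,\omega)$ is strongly integrable, i.e. the almost para-quaternionic structure $(I,J,K)$ is integrable and $d\omega=0$.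
   Context: All objects are smooth, and the summation convention is used. **Hessian structure.** An affine connection is flat if its curvature and torsion tensors vanish. A pair $(\nabla,g)$ of an affine connection and a Riemannian metric on $M$ is a Hessian structure if $\nabla$ is flat and the $(0,3)$-tensor field $\nabla g$ is symmetric in its three variables. **Structures on a $2n$-dimensional manifold $N$.** $(1,1)$-tensor fields are identified with endomorphisms of $TN$. - An almost complex structure is a $(1,1)$-tensor field $I$ with $I^2=-\mathrm{id}$. - An almost para-complex structure is a $(1,1)$-tensor field $K$ with $K^2=\mathrm{id}$ whose $(+1)$- and $(-1)$-eigenspaces at each point both have dimension $n$. - An almost para-quaternionic structure is a triple $(I,J,K)$ of $(1,1)$-tensor fields with $-I^2=J^2=K^2=\mathrm{id}$ and $IJK=-\mathrm{id}$. Then $I$ is an almost complex structure and $J,K$ are almost para-complex structures. - An almost Born structure is a tuple $(I,J,K,h,k,\omega)$ where $(I,J,K)$ is an almost para-quaternionic structure, $h$ is a Riemannian metric, $k$ is a pseudo-Riemannian metric of signature $(n,n)$ and $\omega$ is a non-degenerate 2-form, such that $I=h^{-1}\circ\omega$, $J=k^{-1}\circ h$, $K=\omega^{-1}\circ k$. Here $h,k,\omega$ are regarded as isomorphisms $TN\to T^*N$ via $X\mapsto h(X,\cdot)$, and similarly for $k$ and $\omega$. **Integrability.** For a $(1,1)$-tensor field $A$, the Nijenhuis tensor is $N_A(X,Y)=A^2[X,Y]-A([AX,Y]+[X,AY])+[AX,AY]$ for vector fields $X,Y$. - An almost complex structure $I$ is integrable if $N_I=0$; equivalently (Newlander–Nirenberg),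 around each point there is a chart in whose coordinate frame $I=\begin{pmatrix}0&-1_n\\1_n&0\end{pmatrix}$. - An almost para-complex structure $K$ is integrable if $N_K=0$; equivalently, the two distributions given by the $\pm1$-eigenspaces of $K$ are both integrable; equivalently, around each point there is a chart in whose coordinate frame $K=\begin{pmatrix}1_n&0\\0&-1_n\end{pmatrix}$. - An almost para-quaternionic structure $(I,J,K)$ is integrable if around each point there is a single chart in whose coordinate frame simultaneously $$I=\begin{pmatrix}0&-1_n\\1_n&0\end{pmatrix},\quad J=\begin{pmatrix}0&1_n\\1_n&0\end{pmatrix},\quad K=\begin{pmatrix}1_n&0\\0&-1_n\end{pmatrix}.$$ **Induced structures on $TM$.** Let $(U;\theta^1,\dots,\theta^n)$ be a chart of $M$, and let $\Gamma_{ij}^k$ be the connection coefficients of $\nabla$ in this chart, $\nabla_{\partial_i}\partial_j=\Gamma_{ij}^k\partial_k$. Let $(TU;x^1,\dots,x^n,y^1,\dots,y^n)$ be the chart of $TM$ with $x^i=\theta^i\circ\pi$ and $y^i=d\theta^i$ (as a function on $TU$). Define the local frame of $T(TM)$ over $TU$ $$H_i=\frac{\partial}{\partial x^i}-(\Gamma_{ij}^k\circ\pi)\,y^j\frac{\partial}{\partial y^k},\qquad V_i=\frac{\partial}{\partial y^i},$$ with dual coframe $H^{*i}=dx^i$, $V^{*i}=(\Gamma^i_{jk}\circ\pi)\,y^k\,dx^j+dy^i$. Define $$I=V_i\otimes H^{*i}-H_i\otimes V^{*i},\quad J=V_i\otimes H^{*i}+H_i\otimes V^{*i},\quad K=H_i\otimes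 H^{*i}-V_i\otimes V^{*i}.$$ These are independent of the chart, hence define global $(1,1)$-tensor fields on $TM$, and $(I,J,K)$ is an almost para-quaternionic structure on $TM$: the one induced by $\nabla$. Given a Riemannian metric $g$ on $M$ with components $g_{ij}$ in the chart, define $$h=(g_{ij}\circ\pi)(H^{*i}\otimes H^{*j}+V^{*i}\otimes V^{*j}),$$ $$k=(g_{ij}\circ\pi)(H^{*i}\otimes V^{*j}+V^{*j}\otimes H^{*i}),$$ $$\omega=(g_{ij}\circ\pi)(H^{*i}\otimes V^{*j}-V^{*j}\otimes H^{*i}).$$ These are also independent of the chart, and $(I,J,K,h,k,\omega)$ is an almost Born structure on $TM$: the one induced by $(\nabla,g)$. *)

(* Defs.v *)
From HB Require Import structures.
From mathcomp Require Import all_boot all_order all_algebra.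
From mathcomp Require Import all_classical all_reals all_analysis.

Set Implicit Arguments.
Unset Strict Implicit.
Unset Printing Implicit Defensive.

Import Order.TTheory GRing.Theory Num.Theory.
Import numFieldNormedType.Exports.

Local Open Scope classical_set_scope.
Local Open Scope ring_scope.

Section smooth_on.
Context {R : realType}.
Implicit Types V W : normedModType R.

Definition smooth_on V W (U : set V) (f : V -> W) : Prop :=
  forall (s : seq V) (x : V), U x ->
    differentiable (foldr (fun v g => 'D_v g) f s) x.

Lemma near_eq_diff V W (f g : V -> W) (x : V) : {near x, f =1 g} ->
  differentiable f x -> differentiable g x /\ 'd g x = 'd f x :> (V -> W).
Proof.
move=> fg df; have fgx : f x = g x by exact: nbhs_singleton fg.
have gE : g \o shift x = cst (g x) + 'd f x +o_ 0 id.
  apply/eqaddoP => e e0; have /diff_locally/eqaddoP/(_ e e0) := df.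
  have : \forall y \near 0, f (y + x) = g (y + x).
    by move: fg; rewrite (near_shift 0)/=; apply: filterS => y; rewrite /= subr0.
  apply: filterS2 => y /= fgy.
  suff -> : (f \o shift x - (cst (f x) + 'd f x)) y =
            (g \o shift x - (cst (g x) + 'd f x)) y by [].
  by rewrite -[LHS]/(f (y + x) - (f x + _)) -[RHS]/(g (y + x) - (g x + _)) fgy fgx.
have dg := diff_unique (diff_continuous df) gE.
by split => //; apply/diff_locallyP; rewrite dg; split => //; exact: diff_continuous.
Qed.

Lemma open_near V (U : set V) (P : V -> Prop) x :
  open U -> U x -> (forall y, U y -> P y) -> \forall y \near x, P y.
Proof. by move=> oU Ux UP; apply: filterS (open_nbhs_nbhs (conj oU Ux)) => y /UP. Qed.

Lemma near_id_diff V (f : V -> V) (x w : V) :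
  {near x, f =1 id} -> 'd f x w = w.
Proof.
move=> fid; have idx : is_diff x (@id V) id by exact: is_diff_id.
have fid' : {near x, @id V =1 f} by apply: filterS fid => y /= ->.
by rewrite (near_eq_diff fid' (@ex_diff _ _ _ _ _ _ _ idx)).2 (@diff_val _ _ _ _ _ _ _ idx).
Qed.

Lemma smooth_on_coind V W (U : set V) (P : (V -> W) -> Prop) :
  (forall f, P f -> (forall x, U x -> differentiable f x) /\
                    forall v, P ('D_v f)) ->
  forall f, P f -> smooth_on U f.
Proof.
move=> PP f Pf s.
suff : P (foldr (fun v g => 'D_v g) f s) by case/PP.
by elim: s => //= v s /PP[_]; apply.
Qed.

Lemma smooth_on_diff V W (U : set V) (f : V -> W) x :
  smooth_on U f -> U x -> differentiable f x.
Proof. by move=> sf Ux; exact: (sf [::]). Qed.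

Lemma smooth_on_derive V W (U : set V) (f : V -> W) v :
  smooth_on U f -> smooth_on U ('D_v f).
Proof. by move=> sf s x Ux; have := sf (rcons s v) x Ux; rewrite foldr_rcons. Qed.

Section on_open.
Context {V W : normedModType R} (U : set V) (oU : open U).
Implicit Types f g : V -> W.

Lemma derive_eq_on f g v x :
  (forall y, U y -> f y = g y) -> U x -> 'D_v f x = 'D_v g x.
Proof. by move=> fg Ux; apply: near_eq_derive; exact: open_near fg. Qed.

Lemma diff_eq_on f g x :
  (forall y, U y -> f y = g y) -> U x -> differentiable f x -> differentiable g x.
Proof. by move=> fg Ux /near_eq_diff-/(_ g)[]//; exact: open_near fg. Qed.

Lemma smooth_on_eq f g :
  (forall y, U y -> f y = g y) -> smooth_on U f -> smooth_on U g.
Proof.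
move=> fg sf.
pose P (h : V -> W) := exists2 f, smooth_on U f & forall y, U y -> f y = h y.
apply: (@smooth_on_coind _ _ _ P); last by exists f.
move=> h [k sk kh]; split=> [x Ux|v].
  exact: diff_eq_on kh Ux (smooth_on_diff sk Ux).
exists ('D_v k); first exact: smooth_on_derive.
by move=> y Uy; exact: derive_eq_on.
Qed.

Lemma smooth_on_comp_lin (V' : normedModType R) (A : set V')
    (L : {linear V -> V'}) (f : V' -> W) :
  continuous L -> (forall x, U x -> A (L x)) ->
  smooth_on A f -> smooth_on U (f \o L).
Proof.
move=> cL UA sf.
pose P (h : V -> W) := exists2 f, smooth_on A f & forall y, U y -> f (L y) = h y.
have dL x : differentiable L x by exact: linear_differentiable.
apply: (@smooth_on_coind _ _ _ P); last by exists f.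
move=> h [k sk kh].
have dk' x : U x -> differentiable k (L x) by move=> /UA; exact: smooth_on_diff.
have dk x : U x -> differentiable (k \o L) x.
  by move=> Ux; apply: differentiable_comp; [exact: dL|exact: dk'].
split=> [x Ux|v]; first exact: diff_eq_on kh Ux (dk _ Ux).
exists ('D_(L v) k); first exact: smooth_on_derive.
move=> y Uy; rewrite -(derive_eq_on v kh Uy).
rewrite !deriveE; [|exact: dk Uy|exact: dk' Uy].
by rewrite -/(k \o L) (diff_comp (dL y) (dk' y Uy)) /= diff_lin.
Qed.

End on_open.

Section scalar.
Context {V : normedModType R} (U : set V) (oU : open U).

Inductive smooth_alg : (V -> R^o) -> Prop :=
| smooth_alg_base f : smooth_on U f -> smooth_alg f
| smooth_algD f g : smooth_alg f -> smooth_alg g -> smooth_alg (f \+ g)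
| smooth_algM f g : smooth_alg f -> smooth_alg g ->
                    smooth_alg (fun x => f x * g x)
| smooth_alg_eq f g : smooth_alg f -> (forall x, U x -> f x = g x) ->
                      smooth_alg g.

Lemma smooth_on_alg : forall f, smooth_alg f -> smooth_on U f.
Proof.
apply: smooth_on_coind => h; elim=> {h} [f sf|f g Pf [df Df] Pg [dg Dg]|f g Pf [df Df] Pg [dg Dg]|f g Pf [df Df] fg].
- split=> [x /(smooth_on_diff sf)//|v].
  by apply: smooth_alg_base; exact: smooth_on_derive.
- split=> [x Ux|v]; first by apply: differentiableD; [exact: df|exact: dg].
  apply: (smooth_alg_eq (smooth_algD (Df v) (Dg v))) => x Ux.
  by rewrite deriveD//; apply: diff_derivable; first [exact: df|exact: dg].
- split=> [x Ux|v]; first by apply: differentiableM; [exact: df|exact: dg].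
  apply: (smooth_alg_eq (smooth_algD (smooth_algM Pf (Dg v)) (smooth_algM Pg (Df v)))).
  move=> x Ux.
  by rewrite deriveM//; apply: diff_derivable; first [exact: df|exact: dg].
- split=> [x Ux|v]; first exact: diff_eq_on fg Ux (df _ Ux).
  by apply: (smooth_alg_eq (Df v)); move=> x; exact: (derive_eq_on oU v fg).
Qed.

Lemma smooth_onM (f g : V -> R^o) : smooth_on U f -> smooth_on U g ->
  smooth_on U (fun x => f x * g x : R^o).
Proof. by move=> sf sg; apply/smooth_on_alg/smooth_algM; exact: smooth_alg_base. Qed.

Lemma smooth_on_cst (W : normedModType R) (w : W) : smooth_on U (fun=> w).
Proof.
pose P (h : V -> W) := exists w, h = cst w.
apply: (@smooth_on_coind _ _ _ P); last by exists w.
move=> h [k ->]; split=> [x Ux|v]; first exact: differentiable_cst.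
by exists 0; apply/funext => x; exact: derive_cst.
Qed.

Lemma smooth_on_id : smooth_on U (@id V).
Proof.
pose P (h : V -> V) := h = id \/ exists w, h = cst w.
apply: (@smooth_on_coind _ _ _ P); last by left.
move=> h [->|[w ->]]; split=> [x Ux|v].
- exact: ex_diff.
- by right; exists v; apply/funext => x; exact: derive_id.
- exact: differentiable_cst.
- by right; exists 0; apply/funext => x; exact: derive_cst.
Qed.

Lemma smooth_on_sum n (f : 'I_n -> V -> R^o) :
  (forall i, smooth_on U (f i)) -> smooth_on U (fun x => \sum_i f i x).
Proof.
move=> sf; apply: smooth_on_alg.
elim: n f sf => [f _|n ih f sf].
  apply: smooth_alg_eq (smooth_alg_base (smooth_on_cst (0 : R^o))) _ => x _.
  by rewrite big_ord0.
apply: smooth_alg_eq (smooth_algD (smooth_alg_base (sf ord0)) (ih _ (fun i => sf (lift ord0 i)))) _.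
by move=> x _; rewrite big_ord_recl.
Qed.

Lemma diff_rV n (f : V -> 'rV[R]_n) x :
  (forall j, differentiable (fun y => f y 0 j : R^o) x) -> differentiable f x.
Proof.
move=> df.
rewrite (_ : f = \sum_(j < n) (fun y => f y 0 j *: delta_mx 0 j)).
  by apply: differentiable_sum => j; exact: differentiableZl.
by apply/funext => y; rewrite [LHS]row_sum_delta fct_sumE.
Qed.

Lemma derive_rV n (f : V -> 'rV[R]_n) x v j : differentiable f x ->
  'D_v f x 0 j = 'D_v (fun y => f y 0 j : R^o) x.
Proof.
move=> df; have @c : {linear 'rV[R]_n -> R^o}.
  by exists (fun N : 'rV[R]_n => N 0 j); do 2![eexists]; do ?[constructor];
     rewrite ?mxE// => ? *; rewrite ?mxE//; move=> ?; rewrite !mxE.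
have cc : continuous c by exact: coord_continuous.
have dc y : differentiable c y by exact: linear_differentiable.
have fE : (fun y => f y 0 j : R^o) = c \o f by [].
rewrite (deriveE v df) fE (deriveE v (differentiable_comp df (dc (f x)))).
by rewrite (diff_comp df (dc (f x))) /= (diff_lin (f x) cc).
Qed.

Lemma smooth_on_rVP n (f : V -> 'rV[R]_n) :
  smooth_on U f <-> forall j, smooth_on U (fun x => f x 0 j : R^o).
Proof.
split=> [sf j|sf].
  pose P (h : V -> R^o) := exists2 f : V -> 'rV[R]_n,
    smooth_on U f & forall y, U y -> f y 0 j = h y.
  apply: (@smooth_on_coind _ _ _ P); last by exists f.
  move=> h [k sk kh].
  split=> [x Ux|v].
    apply: (diff_eq_on oU kh Ux).
    exact: (@differentiable_comp _ _ _ _ k (fun N : 'rV[R]_n => N 0 j : R^o) x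
      (smooth_on_diff sk Ux) (differentiable_coord (k x) 0 j)).
  exists ('D_v k); first exact: smooth_on_derive.
  move=> y Uy; rewrite -(derive_eq_on oU v kh Uy) derive_rV//.
  exact: smooth_on_diff sk Uy.
pose P (h : V -> 'rV[R]_n) := forall j, smooth_on U (fun x => h x 0 j : R^o).
apply: (@smooth_on_coind _ _ _ P) => // h Ph.
have dh x : U x -> differentiable h x.
  by move=> Ux; apply: diff_rV => j; exact: smooth_on_diff (Ph j) Ux.
split => // v j.
apply: (smooth_on_eq oU _ (smooth_on_derive v (Ph j))) => y Uy.
by rewrite derive_rV//; exact: dh.
Qed.

End scalar.
End smooth_on.

Record chart (R : realType) (n : nat) (M : Type) := Chart {
  cdom : set M;
  cmap :> M -> 'rV[R]_n;
  cinv : 'rV[R]_n -> M;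
  cimg_open : open (cmap @` cdom);
  cmapK : forall p, cdom p -> cinv (cmap p) = p }.

Section chart.
Context {R : realType} {n : nat} {M : Type}.
Implicit Types c : chart R n M.

Definition overlap c c' : set 'rV[R]_n := c @` (cdom c `&` cdom c').

Definition transition c c' : 'rV[R]_n -> 'rV[R]_n := c' \o cinv c.

Definition smooth_compat c c' : Prop :=
  open (overlap c c') /\ smooth_on (overlap c c') (transition c c').

Lemma chart_imageI c (A : set M) x :
  (c @` (A `&` cdom c)) x <-> (c @` cdom c) x /\ A (cinv c x).
Proof.
split=> [[p [Ap cp] <-]|[[p cp <-]]]; first by rewrite cmapK//; split=> //; exists p.
by rewrite cmapK// => Ap; exists p.
Qed.

Lemma overlapP c c' p : cdom c p -> overlap c c' (c p) <-> cdom c' p.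
Proof.
move=> cp; split=> [[q [cq c'q] /(congr1 (cinv c))]|c'p]; last by exists p.
by rewrite !cmapK// => <-.
Qed.

End chart.

Record smooth_structure (R : realType) (n : nat) := SmoothStructure {
  point :> Type;
  atlas : set (chart R n point);
  atlas_cover : forall p, exists2 c, atlas c & cdom c p;
  atlas_compat : forall c c', atlas c -> atlas c' -> smooth_compat c c' }.

Arguments atlas {R n} _ _.

Section smooth_structure.
Context {R : realType} {n : nat} (M : smooth_structure R n).

Definition manifold_open (W : set M) : Prop :=
  forall c, atlas M c -> open (c @` (W `&` cdom c)).

Lemma manifold_openT : manifold_open setT.
Proof. by move=> c _; rewrite setTI; exact: cimg_open. Qed.

Lemma manifold_openI : setI_closed manifold_open.
Proof.
move=> A B oA oB c ac; rewrite (_ : _ @` _ =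
  (c @` (A `&` cdom c)) `&` (c @` (B `&` cdom c))).
  by apply: openI; [exact: oA|exact: oB].
apply/seteqP; split=> x.
  by move=> /chart_imageI[cx [Ax Bx]]; split; apply/chart_imageI.
by move=> [/chart_imageI[cx Ax] /chart_imageI[_ Bx]]; apply/chart_imageI.
Qed.

Lemma manifold_open_bigU (I : Type) (f : I -> set M) :
  (forall i, manifold_open (f i)) -> manifold_open (\bigcup_i f i).
Proof.
move=> of_ c ac; rewrite setI_bigcupl image_bigcup.
by apply: bigcup_open => i _; exact: of_.
Qed.

HB.instance Definition _ := gen_eqMixin (point M).
HB.instance Definition _ := gen_choiceMixin (point M).
HB.instance Definition _ := isOpenTopological.Build (point M)
  manifold_openT manifold_openI manifold_open_bigU.

Definition is_chart (c : chart R n M) : Prop :=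
  forall a, atlas M a -> smooth_compat c a /\ smooth_compat a c.

Lemma atlas_chart c : atlas M c -> is_chart c.
Proof. by move=> ac a aa; split; exact: atlas_compat. Qed.

Definition chart_at (p : M) : chart R n M := projT1 (cid2 (atlas_cover p)).

Lemma chart_at_atlas p : atlas M (chart_at p).
Proof. by rewrite /chart_at; case: cid2. Qed.

Lemma chart_at_dom p : cdom (chart_at p) p.
Proof. by rewrite /chart_at; case: cid2. Qed.

End smooth_structure.
Section tangent.
Context {R : realType} {n : nat} {M : smooth_structure R n}.
Implicit Types (p : M) (c : chart R n M).

Lemma chart_transition_diff c c' p : is_chart c -> is_chart c' ->
  cdom c p -> cdom c' p -> differentiable (transition c c') (c p).
Proof.
move=> hc hc' cp c'p; set a := chart_at p.
have ap : cdom a p := chart_at_dom p.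
have [oca sca] := (hc a (chart_at_atlas p)).1.
have [oac sac] := (hc' a (chart_at_atlas p)).2.
have dca : differentiable (transition c a) (c p).
  by apply: smooth_on_diff sca _; exact/overlapP.
have caE : transition c a (c p) = a p by rewrite /transition/= cmapK.
have dac : differentiable (transition a c') (transition c a (c p)).
  by rewrite caE; apply: smooth_on_diff sac _; exact/overlapP.
apply: (diff_eq_on oca _ _ (differentiable_comp dca dac)); last exact/overlapP.
by move=> _ [q [cq aq] <-]; rewrite /transition/= (cmapK cq) (cmapK aq).
Qed.

Lemma transition_chain c c1 c2 p (v : 'rV[R]_n) :
  is_chart c -> is_chart c1 -> is_chart c2 ->
  cdom c p -> cdom c1 p -> cdom c2 p ->
  'd (transition c c2) (c p) v =
  'd (transition c1 c2) (c1 p) ('d (transition c c1) (c p) v).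
Proof.
move=> hc hc1 hc2 cp c1p c2p; set a := chart_at p.
have ha : is_chart a := atlas_chart (chart_at_atlas p).
have ap : cdom a p := chart_at_dom p.
have aat := chart_at_atlas p : atlas M a.
have main b b' : is_chart b -> is_chart b' -> cdom b p -> cdom b' p ->
    'd (transition b b') (b p) =
    'd (transition a b') (a p) \o 'd (transition b a) (b p) :> (_ -> _).
  move=> hb hb' bp b'p; have [oba _] := (hb a aat).1.
  have dba : differentiable (transition b a) (b p) by exact: chart_transition_diff.
  have baE : transition b a (b p) = a p by rewrite /transition/= cmapK.
  have dab : differentiable (transition a b') (transition b a (b p)).
    by rewrite baE; exact: chart_transition_diff.
  rewrite -baE -(diff_comp dba dab).
  have dbb' : differentiable (transition b b') (b p) by exact: chart_transition_diff.
  apply/esym; apply: (near_eq_diff _ dbb').2.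
  apply: (open_near oba) => [|_ [q [bq aq] <-]]; first exact/overlapP.
  by rewrite /transition/= (cmapK bq) (cmapK aq).
have inv b : is_chart b -> cdom b p -> forall w,
    'd (transition b a) (b p) ('d (transition a b) (a p) w) = w.
  move=> hb bp w; have [oab _] := (hb a aat).2.
  have dab : differentiable (transition a b) (a p) by exact: chart_transition_diff.
  have abE : transition a b (a p) = b p by rewrite /transition/= cmapK.
  have dba : differentiable (transition b a) (transition a b (a p)).
    by rewrite abE; exact: chart_transition_diff.
  have := congr1 (@^~ w) (diff_comp dab dba); rewrite [in RHS]/comp abE => <-.
  apply: near_id_diff; apply: (open_near oab) => [|_ [q [aq bq] <-]].
    exact/overlapP.
  by rewrite /transition/= (cmapK aq) (cmapK bq).
have E b b' (hb : is_chart b) (hb' : is_chart b') (bp : cdom b p) (b'p : cdom b' p) w : 'd (transition b b') (b p) w =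
    'd (transition a b') (a p) ('d (transition b a) (b p) w).
  by have /(congr1 (@^~ w)) := main b b' hb hb' bp b'p.
apply: etrans (E c c2 hc hc2 cp c2p v) _; apply: esym.
apply: etrans (E c1 c2 hc1 hc2 c1p c2p _) _.
apply: (congr1 ('d (transition a c2) (a p))).
apply: etrans (inv c1 hc1 c1p _).
by apply: (congr1 ('d (transition c1 a) (c1 p))); exact: E.
Qed.

Lemma transition_refl c p (v : 'rV[R]_n) : is_chart c -> cdom c p ->
  'd (transition c c) (c p) v = v.
Proof.
move=> hc cp; apply: near_id_diff.
have oc : open (c @` cdom c) := @cimg_open _ _ _ c.
apply: (open_near oc) => [|_ [q cq <-]]; first by exists p.
by rewrite /transition/= (cmapK cq).
Qed.

(* A tangent vector at p is given by its components v c in all the charts c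
   about p, subject to the contravariant transformation law; the value at the
   other charts is fixed to 0 so that equality of vectors is equality of
   components. *)
Definition tangent_family p : {pred chart R n M -> 'rV[R]_n} := fun v =>
  `[< (forall c, is_chart c -> cdom c p -> forall c', is_chart c' -> cdom c' p ->
         v c' = 'd (transition c c') (c p) (v c)) /\
      (forall c, ~ (is_chart c /\ cdom c p) -> v c = 0) >].

Record tangent p := Tangent {
  tcomp :> chart R n M -> 'rV[R]_n;
  tcompP : tcomp \in tangent_family p }.

HB.instance Definition _ p := [isSub of tangent p for @tcomp p].
HB.instance Definition _ p := [Choice of tangent p by <:].

Lemma tangent_family_submod p : submod_closed (tangent_family p).
Proof.
split=> [|a u v /asboolP[u1 u0] /asboolP[v1 v0]]; apply/asboolP.
  by split=> // *; rewrite linear0.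
split=> [c hc cp c' hc' c'p|c hc].
  by rewrite linearP -(u1 c hc cp c')// -(v1 c hc cp c').
by rewrite -[LHS]/(a *: u c + v c) u0// v0// scaler0 addr0.
Qed.

HB.instance Definition _ p :=
  GRing.isSubmodClosed.Build _ _ (tangent_family p) (tangent_family_submod p).
HB.instance Definition _ p := [SubChoice_isSubLmodule of tangent p by <:].

Definition tvec_family c p (v : 'rV[R]_n) : chart R n M -> 'rV[R]_n := fun c' =>
  if `[< [/\ is_chart c, cdom c p, is_chart c' & cdom c' p] >]
  then 'd (transition c c') (c p) v else 0.

Lemma tvec_subproof c p v : tvec_family c p v \in tangent_family p.
Proof.
apply/asboolP; split=> [c1 h1 p1 c2 h2 p2|c' h]; rewrite /tvec_family.
  case: asboolP => [[hc cp _ _]|h]; case: asboolP => [h'|h'].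
  - exact: transition_chain.
  - by case: h'.
  - by case: h; case: h'.
  - by rewrite linear0.
by case: asboolP => // -[_ _ h1 h2]; case: h.
Qed.

(* The tangent vector at p whose components in the chart c are v. *)
Definition tvec c p v : tangent p := Tangent (tvec_subproof c p v).

Lemma tvec_comp c p v : is_chart c -> cdom c p -> tvec c p v c = v.
Proof.
move=> hc cp; rewrite /= /tvec_family asboolT; last by split.
exact: transition_refl.
Qed.

Lemma tvec_comp_eq c c' p v : is_chart c -> cdom c p -> is_chart c' -> cdom c' p ->
  tvec c p v c' = 'd (transition c c') (c p) v.
Proof. by move=> hc cp hc' c'p; rewrite /= /tvec_family asboolT. Qed.

Lemma tangent_eq p (u v : tangent p) c : is_chart c -> cdom c p ->
  u c = v c -> u = v.
Proof.
move=> hc cp uv; apply: val_inj => /=; apply/funext => c'.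
have /asboolP[u1 u0] := tcompP u; have /asboolP[v1 v0] := tcompP v.
have [[hc' c'p]|h] := pselect (is_chart c' /\ cdom c' p).
  by rewrite (u1 c hc cp) // (v1 c hc cp) // uv.
by rewrite u0 // v0.
Qed.

Lemma tvecK c p (u : tangent p) : is_chart c -> cdom c p -> tvec c p (u c) = u.
Proof. by move=> hc cp; apply: (tangent_eq hc cp); rewrite tvec_comp. Qed.

End tangent.
Section total_space.
Context {R : realType} {n : nat} (M : smooth_structure R n).
Implicit Types c : chart R n M.

Definition total_space : Type := {p : M & tangent p}.

Definition tchart_dom c : set total_space :=
  [set xi | is_chart c /\ cdom c (projT1 xi)].

Definition tchart_map c (xi : total_space) : 'rV[R]_(n + n) :=
  row_mx (c (projT1 xi)) (projT2 xi c).

Definition tchart_inv c (z : 'rV[R]_(n + n)) : total_space :=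
  let p := cinv c (lsubmx z) in existT _ p (tvec c p (rsubmx z)).

Lemma tchart_mapK c xi : tchart_dom c xi -> tchart_inv c (tchart_map c xi) = xi.
Proof.
case: xi => p u [hc cp]; rewrite /tchart_inv /tchart_map /= row_mxKl row_mxKr.
by rewrite cmapK// tvecK.
Qed.

Lemma tchart_imageE c (A : set M) : is_chart c ->
  tchart_map c @` [set xi | cdom c (projT1 xi) /\ A (projT1 xi)] =
  [set z | (c @` (cdom c `&` A)) (lsubmx z)].
Proof.
move=> hc; apply/seteqP; split=> [_ [[p u] [/= cp Ap] <-]|z [p [cp Ap] cpE]].
  by rewrite /tchart_map/= row_mxKl; exists p.
exists (existT _ p (tvec c p (rsubmx z))) => //.
by rewrite -[LHS]/(row_mx (c p) (tvec c p (rsubmx z) c)) tvec_comp// cpE hsubmxK.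
Qed.

Lemma open_lsubmx (A : set 'rV[R]_n) : open A ->
  open [set z : 'rV[R]_(n + n) | A (lsubmx z)].
Proof. by move=> oA; apply: open_comp oA => z _; exact: continuous_lsubmx. Qed.

Lemma tchart_open c : open (tchart_map c @` tchart_dom c).
Proof.
have [hc|hc] := pselect (is_chart c); last first.
  rewrite (_ : _ @` _ = set0); first exact: open0.
  by apply/seteqP; split=> // z [xi []].
rewrite (_ : tchart_dom c = [set xi | cdom c (projT1 xi) /\ setT (projT1 xi)]).
  by rewrite tchart_imageE// setIT; apply: open_lsubmx; exact: cimg_open.
by apply/seteqP; split=> xi [].
Qed.

Definition tchart c : chart R (n + n) total_space :=
  Chart (@tchart_open c) (@tchart_mapK c).

Lemma tchart_overlapE c c' : is_chart c -> is_chart c' ->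
  overlap (tchart c) (tchart c') = [set z | overlap c c' (lsubmx z)].
Proof.
move=> hc hc'; rewrite /overlap -tchart_imageE//; congr (_ @` _).
by apply/seteqP; split=> [xi [[_ cx] [_ c'x]]|xi [cx c'x]].
Qed.

Lemma tchart_transitionE c c' z : is_chart c -> is_chart c' ->
  overlap c c' (lsubmx z) -> transition (tchart c) (tchart c') z =
  row_mx (transition c c' (lsubmx z))
         ('d (transition c c') (lsubmx z) (rsubmx z)).
Proof.
move=> hc hc' [p [cp c'p] cpE]; set q := cinv c (lsubmx z).
rewrite -[LHS]/(row_mx (c' q) (tvec c q (rsubmx z) c')).
have qp : q = p by rewrite /q -cpE cmapK.
rewrite qp; congr row_mx; first by rewrite /transition/= -/q qp.
by rewrite -cpE; exact: tvec_comp_eq.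
Qed.

Lemma tchart_compat c c' : atlas M c -> atlas M c' ->
  smooth_compat (tchart c) (tchart c').
Proof.
move=> ac ac'; have hc := atlas_chart ac; have hc' := atlas_chart ac'.
have [ocU scU] := atlas_compat ac ac'.
rewrite /smooth_compat tchart_overlapE//; split; first exact: open_lsubmx.
set U' := [set z | _]; have oU' : open U' by exact: open_lsubmx.
pose tau := transition c c'.
pose G z := row_mx (tau (lsubmx z))
  (\row_j \sum_i (z 0 (rshift n i) * 'D_(delta_mx 0 i) tau (lsubmx z) 0 j)).
apply: (@smooth_on_eq _ _ _ U' oU' G).
  move=> z Uz; rewrite tchart_transitionE//; congr row_mx; apply/rowP => j.
  have dtau : differentiable tau (lsubmx z) by exact: smooth_on_diff scU Uz.
  rewrite mxE [in RHS](row_sum_delta (rsubmx z)) linear_sum summxE.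
  by apply: eq_bigr => i _; rewrite linearZ !mxE deriveE.
have clsub : continuous (lsubmx : 'rV[R]_(n + n) -> 'rV[R]_n).
  exact: continuous_lsubmx.
apply/(smooth_on_rVP oU') => j.
have [k ->|k ->] := fintype.split_ordP j.
  have := @smooth_on_comp_lin R _ _ U' oU' _ _ lsubmx tau clsub (fun x => id) scU.
  move=> /(smooth_on_rVP oU')/(_ k); apply: smooth_on_eq => // z _.
  by rewrite row_mxEl.
have sD i := @smooth_on_comp_lin R _ _ U' oU' _ _ lsubmx _ clsub (fun x => id)
  (smooth_on_derive (delta_mx 0 i) scU).
apply: (smooth_on_eq oU' (f := fun z : 'rV[R]_(n + n) => \sum_i
    (z 0 (rshift n i) * 'D_(delta_mx 0 i) tau (lsubmx z) 0 k) : R^o)).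
  by move=> z _; rewrite row_mxEr mxE.
apply: smooth_on_sum => // i; apply: smooth_onM => //.
  by have /(smooth_on_rVP oU')/(_ (rshift n i)) := @smooth_on_id R _ U'.
by have /(smooth_on_rVP oU')/(_ k) := sD i.
Qed.

Lemma tchart_cover xi : exists2 tc, (tchart @` atlas M) tc & cdom tc xi.
Proof.
have [c ac cx] := atlas_cover (projT1 xi).
by exists (tchart c); [exists c|split=> //; exact: atlas_chart].
Qed.

Lemma tatlas_compat tc tc' : (tchart @` atlas M) tc -> (tchart @` atlas M) tc' ->
  smooth_compat tc tc'.
Proof. by move=> [c ac <-] [c' ac' <-]; exact: tchart_compat. Qed.

Definition tangent_bundle : smooth_structure R (n + n) :=
  SmoothStructure tchart_cover tatlas_compat.

Definition tproj (xi : tangent_bundle) : M := projT1 (xi : total_space).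

Definition tvect (xi : tangent_bundle) : tangent (tproj xi) :=
  projT2 (xi : total_space).

End total_space.
Section fields.
Context {R : realType} {n : nat} (N : smooth_structure R n).

(* Sections of the tangent bundle; smoothness on an open set W is the separate
   predicate smooth_vfield, and "for all vector fields" is always read as "for
   all vector fields smooth on some open set W, at the points of W". *)
Definition vfield := forall p : N, tangent p.

Definition smooth_fun (W : set N) (f : N -> R) : Prop :=
  forall c, is_chart c ->
    smooth_on (c @` (W `&` cdom c)) (f \o cinv c : 'rV[R]_n -> R^o).

Definition vcomp (X : vfield) (c : chart R n N) : 'rV[R]_n -> 'rV[R]_n :=
  fun x => X (cinv c x) c.

Definition smooth_vfield (W : set N) (X : vfield) : Prop :=
  forall c, is_chart c -> smooth_on (c @` (W `&` cdom c)) (vcomp X c).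

(* The derivative v(f) = df_p(v), computed in a chart about p; for f smooth
   near p it does not depend on the chart. *)
Definition dfun (f : N -> R) (p : N) (v : tangent p) : R :=
  'd (f \o cinv (chart_at p) : 'rV[R]_n -> R^o) (chart_at p p) (v (chart_at p)).

(* [X, Y]^k = X^i d_i Y^k - Y^i d_i X^k, computed in a chart about p; for X and
   Y smooth near p it does not depend on the chart. *)
Definition bracket (X Y : vfield) : vfield := fun p =>
  let c := chart_at p in
  tvec c p ('d (vcomp Y c) (c p) (X p c) - 'd (vcomp X c) (c p) (Y p c)).

Definition coord_vf (c : chart R n N) (i : 'I_n) : vfield := fun p =>
  tvec c p (delta_mx 0 i).

Definition endo_field := forall p : N, tangent p -> tangent p.

Definition bilin_field := forall p : N, tangent p -> tangent p -> R.

Definition nijenhuis (A : endo_field) (X Y : vfield) : vfield := fun p =>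
  A p (A p (bracket X Y p))
  - A p (bracket (fun q => A q (X q)) Y p + bracket X (fun q => A q (Y q)) p)
  + bracket (fun q => A q (X q)) (fun q => A q (Y q)) p.

Definition integrable_endo (A : endo_field) : Prop :=
  forall (W : set N) (X Y : vfield), open W ->
    smooth_vfield W X -> smooth_vfield W Y ->
    forall p, W p -> nijenhuis A X Y p = 0.

(* The j-th column consists of the components of the image of the j-th
   coordinate vector. *)
Definition frame_mx (A : endo_field) (c : chart R n N) (p : N) : 'M[R]_n :=
  \matrix_(i, j) A p (coord_vf c j p) c 0 i.

Definition ext_deriv (w : bilin_field) (X Y Z : vfield) (p : N) : R :=
  dfun (fun q => w q (Y q) (Z q)) (X p)
  - dfun (fun q => w q (X q) (Z q)) (Y p)
  + dfun (fun q => w q (X q) (Y q)) (Z p)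
  - w p (bracket X Y p) (Z p) + w p (bracket X Z p) (Y p)
  - w p (bracket Y Z p) (X p).

Definition closed_form (w : bilin_field) : Prop :=
  forall (W : set N) (X Y Z : vfield), open W ->
    smooth_vfield W X -> smooth_vfield W Y -> smooth_vfield W Z ->
    forall p, W p -> ext_deriv w X Y Z p = 0.

End fields.

Record para_quaternionic_data (R : realType) (n : nat)
    (N : smooth_structure R n) := ParaQuaternionicData {
  pqI : endo_field N;
  pqJ : endo_field N;
  pqK : endo_field N }.

Record born_data (R : realType) (n : nat) (N : smooth_structure R n) := BornData {
  born_pq :> para_quaternionic_data N;
  born_h : bilin_field N;
  born_k : bilin_field N;
  born_omega : bilin_field N }.

Section integrability.
Context {R : realType}.

Definition pq_individually_integrable n (N : smooth_structure R n)
    (S : para_quaternionic_data N) : Prop :=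
  [/\ integrable_endo (pqI S), integrable_endo (pqJ S) & integrable_endo (pqK S)].

Definition pq_integrable n (N : smooth_structure R (n + n))
    (S : para_quaternionic_data N) : Prop :=
  forall p : N, exists c : chart R (n + n) N, [/\ is_chart c, cdom c p &
    forall q, cdom c q ->
      [/\ frame_mx (pqI S) c q = block_mx 0 (- 1%:M) 1%:M 0,
          frame_mx (pqJ S) c q = block_mx 0 1%:M 1%:M 0 &
          frame_mx (pqK S) c q = block_mx 1%:M 0 0 (- 1%:M)]].

Definition born_integrable n (N : smooth_structure R n) (S : born_data N) : Prop :=
  pq_individually_integrable S /\ closed_form (born_omega S).

Definition born_strongly_integrable n (N : smooth_structure R (n + n))
    (S : born_data N) : Prop :=
  pq_integrable S /\ closed_form (born_omega S).

End integrability.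

(* A Koszul connection, given as an operator on local vector fields: on every
   open set W it maps vector fields smooth on W to a vector field smooth on W,
   compatibly with restriction. *)
Record connection (R : realType) (n : nat) (M : smooth_structure R n) := Connection {
  cov :> vfield M -> vfield M -> vfield M;
  cov_smooth : forall (W : set M) X Y, open W ->
    smooth_vfield W X -> smooth_vfield W Y -> smooth_vfield W (cov X Y);
  cov_local : forall (W : set M) X X' Y Y', open W ->
    smooth_vfield W X -> smooth_vfield W Y ->
    (forall p, W p -> X p = X' p) -> (forall p, W p -> Y p = Y' p) ->
    forall p, W p -> cov X Y p = cov X' Y' p;
  cov_addl : forall (W : set M) X X' Y, open W ->
    smooth_vfield W X -> smooth_vfield W X' -> smooth_vfield W Y ->
    forall p, W p -> cov (fun q => X q + X' q) Y p = cov X Y p + cov X' Y p;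
  cov_scalel : forall (W : set M) f X Y, open W ->
    smooth_fun W f -> smooth_vfield W X -> smooth_vfield W Y ->
    forall p, W p -> cov (fun q => f q *: X q) Y p = f p *: cov X Y p;
  cov_addr : forall (W : set M) X Y Y', open W ->
    smooth_vfield W X -> smooth_vfield W Y -> smooth_vfield W Y' ->
    forall p, W p -> cov X (fun q => Y q + Y' q) p = cov X Y p + cov X Y' p;
  cov_leibniz : forall (W : set M) f X Y, open W ->
    smooth_fun W f -> smooth_vfield W X -> smooth_vfield W Y ->
    forall p, W p ->
      cov X (fun q => f q *: Y q) p = f p *: cov X Y p + dfun f (X p) *: Y p }.

Record riemannian_metric (R : realType) (n : nat) (M : smooth_structure R n) :=
  RiemannianMetric {
  metric :> forall p : M, tangent p -> tangent p -> R;
  metric_linear : forall (p : M) (a : R) (u v w : tangent p),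
    metric (a *: u + v) w = a * metric u w + metric v w;
  metric_sym : forall (p : M) (u v : tangent p), metric u v = metric v u;
  metric_pos : forall (p : M) (u : tangent p), u != 0 -> 0 < metric u u;
  metric_smooth : forall (W : set M) X Y, open W ->
    smooth_vfield W X -> smooth_vfield W Y ->
    smooth_fun W (fun p => metric (X p) (Y p)) }.

Section connection.
Context {R : realType} {n : nat} {M : smooth_structure R n}.
Variable nabla : connection M.

Definition curvature (X Y Z : vfield M) : vfield M := fun p =>
  nabla X (nabla Y Z) p - nabla Y (nabla X Z) p - nabla (bracket X Y) Z p.

Definition torsion (X Y : vfield M) : vfield M := fun p =>
  nabla X Y p - nabla Y X p - bracket X Y p.

Definition flat : Prop :=
  (forall (W : set M) (X Y Z : vfield M), open W ->
     smooth_vfield W X -> smooth_vfield W Y -> smooth_vfield W Z ->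
     forall p, W p -> curvature X Y Z p = 0) /\
  (forall (W : set M) (X Y : vfield M), open W ->
     smooth_vfield W X -> smooth_vfield W Y ->
     forall p, W p -> torsion X Y p = 0).

Definition cov_metric (g : riemannian_metric M) (X Y Z : vfield M) (p : M) : R :=
  dfun (fun q => g q (Y q) (Z q)) (X p)
  - g p (nabla X Y p) (Z p) - g p (Y p) (nabla X Z p).

(* Invariance under the two transpositions (1 2) and (2 3), which generate all
   permutations of the three arguments. *)
Definition hessian (g : riemannian_metric M) : Prop :=
  flat /\
  forall (W : set M) (X Y Z : vfield M), open W ->
    smooth_vfield W X -> smooth_vfield W Y -> smooth_vfield W Z ->
    forall p, W p ->
      cov_metric g X Y Z p = cov_metric g Y X Z p /\
      cov_metric g X Y Z p = cov_metric g X Z Y p.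

(* nabla_(d_i) d_j = \sum_k christoffel c i j k *: d_k on cdom c. *)
Definition christoffel (c : chart R n M) (i j k : 'I_n) (p : M) : R :=
  nabla (coord_vf c i) (coord_vf c j) p c 0 k.

Definition metric_coef (g : riemannian_metric M) (c : chart R n M)
    (i j : 'I_n) (p : M) : R :=
  g p (coord_vf c i p) (coord_vf c j p).

Section frame.
Variables (c : chart R n M) (xi : tangent_bundle M).
Let p : M := tproj xi.
Let y (j : 'I_n) : R := tvect xi c 0 j.
Let tc : chart R (n + n) (tangent_bundle M) := tchart c.

Definition Hframe (i : 'I_n) : tangent xi :=
  coord_vf tc (lshift n i) xi
  - \sum_j \sum_k (christoffel c i j k p * y j) *:
      coord_vf tc (rshift n k) xi.

Definition Vframe (i : 'I_n) : tangent xi :=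
  coord_vf tc (rshift n i) xi.

Definition Hcoframe (i : 'I_n) (w : tangent xi) : R :=
  w tc 0 (lshift n i).

Definition Vcoframe (i : 'I_n) (w : tangent xi) : R :=
  \sum_j \sum_k christoffel c j k i p * y k * w tc 0 (lshift n j)
  + w tc 0 (rshift n i).

End frame.

(* The tensor fields below are defined, at xi in T_p M, by their expressions in
   the chart chart_at p of M; these do not depend on the chart about p. *)
Definition induced_pq : para_quaternionic_data (tangent_bundle M) := {|
  pqI := fun (xi : tangent_bundle M) w => let c := chart_at (tproj xi) in
    \sum_i (Hcoframe c i w *: Vframe c xi i - Vcoframe c i w *: Hframe c xi i);
  pqJ := fun (xi : tangent_bundle M) w => let c := chart_at (tproj xi) in
    \sum_i (Hcoframe c i w *: Vframe c xi i + Vcoframe c i w *: Hframe c xi i);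
  pqK := fun (xi : tangent_bundle M) w => let c := chart_at (tproj xi) in
    \sum_i (Hcoframe c i w *: Hframe c xi i - Vcoframe c i w *: Vframe c xi i) |}.

Definition induced_born (g : riemannian_metric M) : born_data (tangent_bundle M) := {|
  born_pq := induced_pq;
  born_h := fun (xi : tangent_bundle M) a b =>
    let p := tproj xi in let c := chart_at p in
    \sum_i \sum_j metric_coef g c i j p *
      (Hcoframe c i a * Hcoframe c j b + Vcoframe c i a * Vcoframe c j b);
  born_k := fun (xi : tangent_bundle M) a b =>
    let p := tproj xi in let c := chart_at p in
    \sum_i \sum_j metric_coef g c i j p *
      (Hcoframe c i a * Vcoframe c j b + Vcoframe c j a * Hcoframe c i b);
  born_omega := fun (xi : tangent_bundle M) a b =>
    let p := tproj xi in let c := chart_at p in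
    \sum_i \sum_j metric_coef g c i j p *
      (Hcoframe c i a * Vcoframe c j b - Vcoframe c j a * Hcoframe c i b) |}.

End connection.

(* Main.v *)
Require Import Defs.
From HB Require Import structures.
From mathcomp Require Import all_boot all_order all_algebra.
From mathcomp Require Import all_classical all_reals all_analysis.
From mathcomp Require Import ring lra.

(* The torsion and curvature coefficients of nabla in a chart of M are read off the
   Nijenhuis tensors on TM: the horizontal part of N_J(H_i, H_j) is the torsion and
   N_K(H_i, H_j) is a multiple of [H_i, H_j], hence of the curvature.  When both vanish,
   the overdetermined linear system d u = theta, nabla theta = 0 is solved by integrating
   along the rays issued from a point; flatness makes the result differentiable with the
   prescribed derivative (Gronwall's inequality between neighbouring rays), and the inverse
   function theorem turns n solutions u into a chart with zero connection coefficients.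
   The chart of TM induced by such an affine chart puts I, J and K simultaneously in normal
   form.  In it omega has the matrix [[0, G], [-G, 0]] with G the matrix of g, so d omega is
   the antisymmetrization of the derivatives of G, which vanishes exactly when nabla g is
   symmetric. *)

Set Implicit Arguments.
Unset Strict Implicit.
Unset Printing Implicit Defensive.

Import Order.TTheory GRing.Theory Num.Theory.
Import numFieldNormedType.Exports.

Local Open Scope classical_set_scope.
Local Open Scope ring_scope.

(** * Calculus of smooth maps *)

(** Individual integrability yields identities between connection coefficients in one chart only.
    They are exactly the compatibility conditions for an affine chart, where [nabla] is plain
    differentiation of components; curvature and torsion then vanish on arbitrary local fields by
    symmetry of second derivatives, so neither has to be shown tensorial. The induced structures are
    defined at each point through [chart_at], so a change of chart must be made before an affine
    chart can be used. The component rows [hco] and [vco] do this: second derivatives of a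
    transition map of M enter the transition maps of TM and the law of the connection coefficients,
    and cancel in [vco]. Smoothness asks for differentiability of all iterated directional
    derivatives, while analysis gives one derivative of a solution or of an inverse map. The rest
    comes from [smooth_bootstrap]: that derivative is a polynomial in the same family. The constant
    1/2 recurs: on short rays the linear equation over [0, 1] is a contraction of ratio 1/2, and
    Gronwall's inequality becomes an absorption without exponentials. *)

Section smooth_more.
Context {R : realType} {V : normedModType R} (U : set V) (oU : open U).

(** Polynomials in the members of [S] with smooth coefficients. Closure under agreement on [U]
    matters: product and chain rules identify a derivative with such a polynomial only at points of
    [U]. *)
Inductive generated (S : set (V -> R^o)) : (V -> R^o) -> Prop :=
| generated_base f : S f -> generated S f
| generated_smooth f : smooth_on U f -> generated S f
| generatedD f g : generated S f -> generated S g -> generated S (f \+ g)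
| generatedM f g : generated S f -> generated S g ->
                   generated S (fun x => f x * g x)
| generated_eq f g : generated S f -> (forall x, U x -> f x = g x) ->
                     generated S g.

(* Regularity bootstrap: a family of differentiable functions whose derivatives
   are polynomial expressions in the family (over the smooth functions) consists
   of smooth functions. *)
Lemma smooth_bootstrap (S : set (V -> R^o)) :
  (forall f, S f -> (forall x, U x -> differentiable f x) /\
                    forall v, generated S ('D_v f)) ->
  forall f, generated S f -> smooth_on U f.
Proof.
move=> SP; apply: smooth_on_coind => h.
elim=> {h} [f /SP//|f sf|f g Pf [df Df] Pg [dg Dg]|f g Pf [df Df] Pg [dg Dg]|f g Pf [df Df] fg].
- split=> [x /(smooth_on_diff sf)//|v].
  by apply: generated_smooth; exact: smooth_on_derive.
- split=> [x Ux|v]; first by apply: differentiableD; [exact: df|exact: dg].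
  apply: (generated_eq (generatedD (Df v) (Dg v))) => x Ux.
  by rewrite deriveD//; apply: diff_derivable; first [exact: df|exact: dg].
- split=> [x Ux|v]; first by apply: differentiableM; [exact: df|exact: dg].
  apply: (generated_eq (generatedD (generatedM Pf (Dg v)) (generatedM Pg (Df v)))).
  move=> x Ux.
  by rewrite deriveM//; apply: diff_derivable; first [exact: df|exact: dg].
- split=> [x Ux|v]; first exact: diff_eq_on fg Ux (df _ Ux).
  by apply: (generated_eq (Df v)); move=> x; exact: (derive_eq_on oU v fg).
Qed.

Lemma generated_sum (S : set (V -> R^o)) (I : Type) (r : seq I) (P : pred I)
    (f : I -> V -> R^o) :
  (forall i, P i -> generated S (f i)) ->
  generated S (fun x => \sum_(i <- r | P i) f i x).
Proof.
move=> Sf; elim: r => [|i r ih].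
  apply: (generated_eq (generated_smooth S (@smooth_on_cst _ _ U _ (0 : R^o)))) => x _.
  by rewrite big_nil.
have [Pi|Pi] := boolP (P i).
  apply: (generated_eq (generatedD (Sf i Pi) ih)) => x _.
  by rewrite big_cons Pi.
by apply: (generated_eq ih) => x _; rewrite big_cons (negbTE Pi).
Qed.

Lemma smooth_onD (W : normedModType R) (f g : V -> W) :
  smooth_on U f -> smooth_on U g -> smooth_on U (fun x => f x + g x).
Proof.
move=> sf sg.
pose P (h : V -> W) := exists f g, [/\ smooth_on U f, smooth_on U g &
  forall x, U x -> f x + g x = h x].
apply: (@smooth_on_coind _ _ _ _ P); last by exists f, g.
move=> h [k [l [sk sl kl]]]; split => [x Ux|v].
  apply: (diff_eq_on oU (f := k \+ l) kl Ux).
  by apply: differentiableD; exact: smooth_on_diff Ux.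
exists ('D_v k), ('D_v l); split; [exact: smooth_on_derive|exact: smooth_on_derive|].
move=> x Ux; rewrite -(derive_eq_on oU v (f := k \+ l) kl Ux) deriveD//.
  by apply: diff_derivable; exact: smooth_on_diff Ux.
by apply: diff_derivable; exact: smooth_on_diff Ux.
Qed.

Lemma smooth_on_bigsum (I : Type) (r : seq I) (P : pred I) (f : I -> V -> R^o) :
  (forall i, P i -> smooth_on U (f i)) ->
  smooth_on U (fun x => \sum_(i <- r | P i) f i x : R^o).
Proof.
move=> sf; apply: (@smooth_bootstrap set0) => //.
by apply: generated_sum => i Pi; apply: generated_smooth; exact: sf.
Qed.

Lemma smooth_on_bigprod (I : Type) (r : seq I) (P : pred I) (f : I -> V -> R^o) :
  (forall i, P i -> smooth_on U (f i)) ->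
  smooth_on U (fun x => \prod_(i <- r | P i) f i x : R^o).
Proof.
move=> sf; elim: r => [|i r ih].
  apply: (smooth_on_eq oU _ (@smooth_on_cst _ _ U _ (1 : R^o))) => x _.
  by rewrite big_nil.
have [Pi|Pi] := boolP (P i).
  apply: (smooth_on_eq oU _ (smooth_onM oU (sf i Pi) ih)) => x _.
  by rewrite big_cons Pi.
by apply: (smooth_on_eq oU _ ih) => x _; rewrite big_cons (negbTE Pi).
Qed.

Lemma smooth_onN (f : V -> R^o) : smooth_on U f -> smooth_on U (fun x => - f x : R^o).
Proof.
move=> sf; apply: (smooth_on_eq oU _ (smooth_onM oU (@smooth_on_cst _ _ U _ (-1 : R^o)) sf)).
by move=> x _; rewrite mulN1r.
Qed.

(** The one-element family [1/f] closes up under differentiation, because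
    [(1/f)' = - (1/f)^2 f']. *)
Lemma smooth_onV (f : V -> R^o) : smooth_on U f -> (forall x, U x -> f x != 0) ->
  smooth_on U (fun x => (f x)^-1 : R^o).
Proof.
move=> sf f0; apply: (@smooth_bootstrap [set fun x => (f x)^-1 : R^o]); last first.
  exact: generated_base.
have dV x : U x -> differentiable (fun x => (f x)^-1 : R^o) x.
  by move=> Ux; apply: differentiableV; [exact: smooth_on_diff Ux|exact: f0].
move=> _ ->; split => // v.
have gV : generated [set fun x => (f x)^-1 : R^o] (fun x => (f x)^-1 : R^o).
  exact: generated_base.
apply: (generated_eq (generatedM (generatedM gV gV)
  (generated_smooth _ (smooth_onN (smooth_on_derive v sf))))) => x Ux.
rewrite deriveV; [|exact: f0|]; last first.
  by apply: diff_derivable; exact: smooth_on_diff Ux.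
by rewrite -exprVn expr2 scaleNr mulrN.
Qed.

Lemma smooth_on_det m (A : V -> 'M[R]_m) :
  (forall i j, smooth_on U (fun x => A x i j : R^o)) ->
  smooth_on U (fun x => \det (A x) : R^o).
Proof.
move=> sA; apply: smooth_on_bigsum => s _; apply: smooth_onM => //.
  exact: smooth_on_cst.
by apply: smooth_on_bigprod => i _; exact: sA.
Qed.

(** Cramer's rule: the entries are cofactors, hence polynomials in the entries of [A], divided by a
    determinant that has no zero on [U]. *)
Lemma smooth_on_invmx m (A : V -> 'M[R]_m) :
  (forall i j, smooth_on U (fun x => A x i j : R^o)) ->
  (forall x, U x -> A x \in unitmx) ->
  forall i j, smooth_on U (fun x => invmx (A x) i j : R^o).
Proof.
move=> sA uA i j.
have sc : smooth_on U (fun x => cofactor (A x) j i : R^o).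
  apply: smooth_onM => //; first exact: smooth_on_cst.
  apply: smooth_on_det => k l.
  by apply: smooth_on_eq (sA (lift j k) (lift i l)) => // x _; rewrite !mxE.
have sd : smooth_on U (fun x => (\det (A x))^-1 : R^o).
  apply: smooth_onV; first exact: smooth_on_det.
  by move=> x /uA; rewrite unitmxE unitfE.
apply: (smooth_on_eq oU _ (smooth_onM oU sd sc)) => x Ux.
by rewrite /invmx uA// !mxE.
Qed.

Lemma smooth_onS (W : normedModType R) (B : set V) (f : V -> W) :
  U `<=` B -> smooth_on B f -> smooth_on U f.
Proof. by move=> UB sf s x /UB; exact: sf. Qed.

Lemma smooth_on_local (W : normedModType R) (f : V -> W) :
  (forall x, U x -> exists2 B, B x & smooth_on B f) -> smooth_on U f.
Proof. by move=> Uf s x /Uf[B Bx sf]; exact: sf. Qed.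

Lemma smooth_on_continuous (W : normedModType R) (f : V -> W) x :
  smooth_on U f -> U x -> {for x, continuous f}.
Proof. by move=> sf Ux; apply: differentiable_continuous; exact: smooth_on_diff Ux. Qed.

Lemma smooth_on_derivable (W : normedModType R) (f : V -> W) x v :
  smooth_on U f -> U x -> derivable f x v.
Proof. by move=> sf Ux; apply: diff_derivable; exact: smooth_on_diff Ux. Qed.

End smooth_more.

Section rV_calculus.
Context {R : realType}.

Lemma derive_sum_delta (W : normedModType R) n (f : 'rV[R]_n -> W) x v :
  differentiable f x -> 'D_v f x = \sum_i v 0 i *: 'D_(delta_mx 0 i) f x.
Proof.
move=> df; rewrite deriveE// [in LHS](row_sum_delta v) linear_sum.
by apply: eq_bigr => i _; rewrite linearZ deriveE.
Qed.

Lemma deriveDv (V W : normedModType R) (f : V -> W) x u v : differentiable f x ->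
  'D_(u + v) f x = 'D_u f x + 'D_v f x.
Proof. by move=> df; rewrite !deriveE// linearD. Qed.

Lemma deriveBv (V W : normedModType R) (f : V -> W) x u v : differentiable f x ->
  'D_(u - v) f x = 'D_u f x - 'D_v f x.
Proof. by move=> df; rewrite !deriveE// linearB. Qed.

Lemma deriveZv (V W : normedModType R) (f : V -> W) x a v : differentiable f x ->
  'D_(a *: v) f x = a *: 'D_v f x.
Proof. by move=> df; rewrite !deriveE// linearZ. Qed.

Lemma derive_comp (U V W : normedModType R) (f : U -> V) (g : V -> W) x v :
  differentiable f x -> differentiable g (f x) ->
  'D_v (g \o f) x = 'D_('D_v f x) g (f x).
Proof.
move=> df dg; rewrite !deriveE//; last exact: differentiable_comp.
by rewrite diff_comp.
Qed.

(** Bootstrap on the family of all [k \o f] with [k] smooth on [B]: the chain rule expands a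
    derivative into components of ['D_v f] times compositions of partial derivatives of [k] with
    [f]. *)
Lemma smooth_on_comp_scalar (V : normedModType R) m (A : set V) (B : set 'rV[R]_m)
    (f : V -> 'rV[R]_m) (g : 'rV[R]_m -> R^o) : open A ->
  (forall x, A x -> B (f x)) -> smooth_on A f -> smooth_on B g ->
  smooth_on A (g \o f).
Proof.
move=> oA AB sf sg.
pose S : set (V -> R^o) := [set h | exists2 g, smooth_on B g & h = g \o f].
apply: (@smooth_bootstrap _ _ _ oA S); last by apply: generated_base; exists g.
move=> _ [k sk ->].
have df x : A x -> differentiable f x by exact: smooth_on_diff.
have dk x : A x -> differentiable k (f x) by move=> /AB; exact: smooth_on_diff.
split => [x Ax|v]; first by apply: differentiable_comp; [exact: df|exact: dk].
apply: (generated_eq (f := fun x => \sum_(j < m) ('D_v f x 0 j * 'D_(delta_mx 0 j) k (f x)))).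
  apply: generated_sum => // j _; apply: generatedM.
    apply: generated_smooth.
    by have /(smooth_on_rVP oA)/(_ j) := smooth_on_derive v sf.
  by apply: generated_base; exists ('D_(delta_mx 0 j) k) => //; exact: smooth_on_derive.
move=> x Ax; rewrite derive_comp; [|exact: df|exact: dk].
by rewrite [RHS]derive_sum_delta//; exact: dk.
Qed.

Lemma smooth_on_comp (V : normedModType R) m k (A : set V) (B : set 'rV[R]_m)
    (f : V -> 'rV[R]_m) (g : 'rV[R]_m -> 'rV[R]_k) : open A -> open B ->
  (forall x, A x -> B (f x)) -> smooth_on A f -> smooth_on B g ->
  smooth_on A (g \o f).
Proof.
move=> oA oB AB sf /(smooth_on_rVP oB) sg; apply/(smooth_on_rVP oA) => j.
exact: smooth_on_comp_scalar AB sf (sg j).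
Qed.

End rV_calculus.

(** * Mean value inequalities, symmetry of second derivatives, second-order Taylor bound *)

Section mean_value.
Context {R : realType}.

Lemma norm_mx_coord m n (M : 'M[R]_(m, n)) i j : `|M i j| <= `|M|.
Proof.
rewrite [leRHS]/Num.norm /= mx_normrE; apply/bigmax_geP; right => /=.
by exists (i, j).
Qed.

Lemma norm_mx_le m n (M : 'M[R]_(m, n)) C : 0 <= C ->
  (forall i j, `|M i j| <= C) -> `|M| <= C.
Proof.
move=> C0 MC; rewrite /Num.norm /= mx_normrE; apply/bigmax_leP.
by split => // -[i j] _; exact: MC.
Qed.

Lemma norm_rV_le n (v : 'rV[R]_n) C : 0 <= C ->
  (forall i, `|v 0 i| <= C) -> `|v| <= C.
Proof. by move=> C0 vC; apply: norm_mx_le => // i j; rewrite (ord1 i). Qed.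

Lemma is_derive_coord n (y : R -> 'rV[R]_n) (t : R) (dy : 'rV[R]_n) i :
  is_derive t (1 : R) y dy -> is_derive t (1 : R) (fun s => y s 0 i : R^o) (dy 0 i).
Proof.
move=> [dd <-]; have df : differentiable y t by exact/derivable1_diffP.
apply: DeriveDef; last by rewrite derive_rV.
apply: diff_derivable.
exact: (@differentiable_comp _ _ _ _ y (fun N : 'rV[R]_n => N 0 i : R^o) t df (differentiable_coord (y t) 0 i)).
Qed.

Lemma is_derive_rV n (y : R -> 'rV[R]_n) (t : R) (dy : 'rV[R]_n) :
  (forall i, is_derive t (1 : R) (fun s => y s 0 i : R^o) (dy 0 i)) ->
  is_derive t (1 : R) y dy.
Proof.
move=> H; have df : differentiable y t.
  by apply: diff_rV => j; apply/derivable1_diffP; exact: (@ex_derive _ _ _ _ _ _ _ (H j)).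
apply: DeriveDef; first exact: diff_derivable.
by apply/rowP => i; rewrite derive_rV// derive_val.
Qed.

Lemma is_derive_continuous (W : normedModType R) (y : R -> W) (t : R) (dy : W) :
  is_derive t (1 : R) y dy -> {for t, continuous y}.
Proof. by move=> H; apply: differentiable_continuous; apply/derivable1_diffP; exact: ex_derive. Qed.

Lemma mvt_scalar (y dy : R -> R) (a b : R) : a <= b ->
  (forall t, a <= t <= b -> is_derive t (1 : R) (y : R -> R^o) (dy t)) ->
  exists2 c, a <= c <= b & y b - y a = dy c * (b - a).
Proof.
move=> ab H; have [||c cab E] := @MVT_segment R y dy a b ab.
- by move=> x; rewrite in_itv/= => /andP[ax xb]; apply: H; rewrite !ltW.
- apply: derivable_within_continuous => x; rewrite in_itv/= => /H.
  by move=> ?; exact: ex_derive.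
- by exists c.
Qed.

(** The norm is the maximum over coordinates, so the scalar theorem applied to each coordinate costs
    no factor, although the intermediate points differ. *)
Lemma mvt_rV n (y dy : R -> 'rV[R]_n) (a b C : R) : a <= b ->
  (forall t, a <= t <= b -> is_derive t (1 : R) y (dy t)) ->
  (forall t, a <= t <= b -> `|dy t| <= C) ->
  `|y b - y a| <= C * (b - a).
Proof.
move=> ab H HC; have C0 : 0 <= C by apply: le_trans (HC a _); rewrite ?lexx.
apply: norm_rV_le => [|i]; first by rewrite mulr_ge0// subr_ge0.
have [|c cab E] := @mvt_scalar (fun s => y s 0 i) (fun s => dy s 0 i) a b ab.
  by move=> t /H; exact: is_derive_coord.
rewrite !mxE E normrM ler_pM//; last by rewrite ger0_norm// subr_ge0.
by apply: le_trans (HC c cab); exact: norm_mx_coord.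
Qed.

Section line.
Context {V W : normedModType R}.

Lemma is_derive_line (x v : V) (t : R) :
  is_derive t (1 : R) (fun s : R => x + s *: v) v.
Proof.
have -> : (fun s : R => x + s *: v) = (cst x \+ (fun s : R => s *: v)) by [].
have dl : differentiable (fun s : R => s *: v) t by exact: differentiableZl.
apply: DeriveDef; first by apply: derivableD => //; exact: diff_derivable.
rewrite deriveD//; last exact: diff_derivable.
by rewrite derive_cst add0r deriveE// diffZl// diff_val scale1r.
Qed.

Lemma is_derive_along (f : V -> W) (x v : V) (t : R) : differentiable f (x + t *: v) ->
  is_derive t (1 : R) (fun s : R => f (x + s *: v)) ('D_v f (x + t *: v)).
Proof.
move=> df; have dl := is_derive_line x v t.
have ddl : differentiable (fun s : R => x + s *: v) t by apply/derivable1_diffP; exact: ex_derive.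
apply: DeriveDef; first by apply: diff_derivable; exact: (differentiable_comp ddl df).
by rewrite (derive_comp _ ddl df) derive_val.
Qed.

End line.

Lemma mvt_segment_rV (V : normedModType R) n (f : V -> 'rV[R]_n) x v C :
  (forall t : R, 0 <= t <= 1 -> differentiable f (x + t *: v)) ->
  (forall t : R, 0 <= t <= 1 -> `|'D_v f (x + t *: v)| <= C) ->
  `|f (x + v) - f x| <= C.
Proof.
move=> df HC; rewrite -[C]mulr1 -[X in C * X](subr0 1).
have -> : f (x + v) - f x = f (x + 1 *: v) - f (x + 0 *: v).
  by rewrite scale1r scale0r addr0.
apply: (@mvt_rV n (fun t => f (x + t *: v)) _ 0 1 C ler01 _ HC) => t t01.
exact/is_derive_along/df.
Qed.

Lemma continuous_near_dist (V W : normedModType R) (f : V -> W) x (e : R) :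
  {for x, continuous f} -> 0 < e -> \forall y \near x, `|f y - f x| < e.
Proof.
move=> cf e0; have /cvgrPdist_lt/(_ e e0) := cf.
by apply: filterS => y; rewrite distrC.
Qed.

Section schwarz.
Context {V : normedModType R} {U : set V} (oU : open U).

(** The mean value theorem is used along [v] and then along [w]. The second difference is symmetric
    in [v] and [w], the derivative that it approximates is not visibly so: this is the source of
    Schwarz's theorem. *)
Let second_difference (f : V -> R^o) x v w e : smooth_on U f -> U x -> 0 < e ->
  exists2 r, 0 < r & forall h, 0 < h < r ->
  exists2 c : R, `|c - ('D_w ('D_v f) x : R)| < e &
  f (x + h *: v + h *: w) - f (x + h *: v) - f (x + h *: w) + f x = h ^+ 2 * c.
Proof.
move=> sf Ux e0.
have sv := smooth_on_derive v sf; have sw := smooth_on_derive w sv.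
have [r0 r00 Br0] : exists2 r, 0 < r & forall y, `|x - y| < r -> U y /\ `|'D_w ('D_v f) y - 'D_w ('D_v f) x| < e.
  have /nbhs_ballP[r /= r0 Hr] : \forall y \near x, U y /\ `|'D_w ('D_v f) y - 'D_w ('D_v f) x| < e.
    apply: filterI; first exact: open_nbhs_nbhs.
    exact: continuous_near_dist (smooth_on_continuous sw Ux) e0.
  by exists r => // y xy; apply: Hr; rewrite -ball_normE.
(* If [h * K < r0], the whole parallelogram [x + s v + t w] with [s] and [t] in [0, h] stays within
   [r0] of [x]; the summand 1 keeps [K] positive when [v] and [w] vanish. *)
pose K := `|v| + `|w| + 1; have K0 : 0 < K by rewrite /K ltr_wpDl// addr_ge0.
exists (r0 / K); first exact: divr_gt0.
move=> h /andP[h0]; rewrite ltr_pdivlMr// => hr.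
have near s t : 0 <= s <= h -> 0 <= t <= h -> `|x - (x + s *: v + t *: w)| < r0.
  move=> /andP[s0 sh] /andP[t0 th].
  rewrite -addrA opprD addNKr normrN (le_lt_trans (ler_normD _ _))//.
  rewrite !normrZ !ger0_norm//; apply: le_lt_trans hr.
  rewrite /K !mulrDr mulr1 ler_wpDr ?(ltW h0)// lerD// ler_wpM2r//.
have h0' : 0 <= h by exact: ltW.
pose g s := f (x + s *: v + h *: w) - f (x + s *: v).
have Ig s : 0 <= s <= h -> is_derive s (1 : R) (g : R -> R^o) ('D_v f (x + s *: v + h *: w) - 'D_v f (x + s *: v)).
  move=> sh; rewrite /g.
  have U1 : U (x + h *: w + s *: v).
    by rewrite addrAC; have [] := Br0 _ (near s h sh _) => //; rewrite h0' lexx.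
  have U0 : U (x + s *: v).
    by have [] := Br0 _ (near s 0 sh _); rewrite ?lexx ?scale0r ?addr0.
  rewrite (_ : (fun _ => _) = (fun s => f (x + h *: w + s *: v)) \- (fun s => f (x + s *: v))); last first.
    by apply/funext => s' /=; rewrite addrAC.
  rewrite addrAC; apply: is_deriveB; apply: is_derive_along; exact: smooth_on_diff sf _.
have [s /andP[s0 sh] Es] := mvt_scalar h0' Ig.
have It t : 0 <= t <= h -> is_derive t (1 : R) (fun t => 'D_v f (x + s *: v + t *: w) : R^o) ('D_w ('D_v f) (x + s *: v + t *: w)).
  move=> th; apply: is_derive_along; apply: smooth_on_diff sv _.
  by have [] := Br0 _ (near s t _ th); rewrite ?s0.
have [t th Et] := mvt_scalar h0' It.
exists ('D_w ('D_v f) (x + s *: v + t *: w)).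
  by have [] := Br0 _ (near s t _ th); rewrite ?s0.
move: Es; rewrite /g scale0r addr0 => Es.
transitivity (f (x + h *: v + h *: w) - f (x + h *: v) - (f (x + h *: w) - f x)).
  by ring.
move: Et; rewrite Es scale0r addr0 !subr0 => ->; ring.
Qed.

(** For a common step [h] both orders give the same second difference, hence the same quotient by
    [h ^+ 2], and this quotient is within [e / 2] of each mixed derivative. *)
Lemma schwarz_scalar (f : V -> R^o) x v w : smooth_on U f -> U x ->
  'D_v ('D_w f) x = 'D_w ('D_v f) x.
Proof.
move=> sf Ux; apply/eqP; rewrite -subr_eq0 -normr_le0; apply/ler_addgt0Pl => e e0.
have e20 : 0 < e / 2 by rewrite divr_gt0.
have [r1 r10 H1] := second_difference v w sf Ux e20.
have [r2 r20 H2] := second_difference w v sf Ux e20.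
pose h := Num.min r1 r2 / 2.
have h0 : 0 < h by rewrite divr_gt0// lt_min r10.
have hm : h < Num.min r1 r2 by rewrite ltr_pdivrMr// ltr_pMr ?lt_min ?r10// ltr1n.
have [|c1 d1 E1] := H1 h; first by rewrite h0 (lt_le_trans hm)// ge_min lexx.
have [|c2 d2 E2] := H2 h; first by rewrite h0 (lt_le_trans hm)// ge_min lexx orbT.
have : c1 = c2.
  apply: (mulfI (_ : h ^+ 2 != 0)); first by rewrite expf_neq0// gt_eqF.
  by rewrite -E1 -E2 [x + h *: w + h *: v]addrAC; ring.
move=> c12; rewrite -c12 in d2.
have close (a b c : R) : `|c - a| < e / 2 -> `|c - b| < e / 2 -> `|b - a| <= e + 0.
  move=> ca cb; rewrite addr0 -(subrKA c b) (le_trans (ler_normD _ _))//.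
  by rewrite (splitr e) distrC lerD ?ltW// ltW.
exact: close d1 d2.
Qed.

Lemma schwarz n (f : V -> 'rV[R]_n) x v w : smooth_on U f -> U x ->
  'D_v ('D_w f) x = 'D_w ('D_v f) x.
Proof.
move=> sf Ux; apply/rowP => j.
have sj := (smooth_on_rVP oU f).1 sf j.
have dj a y : U y -> 'D_a f y 0 j = 'D_a (fun y => f y 0 j : R^o) y.
  by move=> Uy; rewrite derive_rV//; exact: smooth_on_diff Uy.
have DDj a b : ('D_a ('D_b f) x) 0 j = 'D_a ('D_b (fun y => f y 0 j : R^o)) x.
  rewrite (derive_rV _ _ (smooth_on_diff (smooth_on_derive b sf) Ux)).
  exact: derive_eq_on (dj b) Ux.
apply: (etrans (DDj v w)); apply: (etrans _ (esym (DDj w v))).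
exact: schwarz_scalar.
Qed.

End schwarz.

Lemma quadratic_bound n (w : 'rV[R]_n) (a : 'I_n -> 'I_n -> R) C :
  (forall i j, `|a i j| <= C) ->
  `|\sum_i \sum_j w 0 i * w 0 j * a i j| <= n%:R ^+ 2 * C * `|w| ^+ 2.
Proof.
move=> aC; rewrite (le_trans (ler_norm_sum _ _ _))//.
have -> : n%:R ^+ 2 * C * `|w| ^+ 2 = \sum_(i < n) \sum_(j < n) C * `|w| ^+ 2.
  by rewrite !sumr_const !card_ord -[RHS]mulr_natl -[X in _ = _ * X]mulr_natl !mulrA expr2.
apply: ler_sum => i _; rewrite (le_trans (ler_norm_sum _ _ _))//.
apply: ler_sum => j _; rewrite normrM mulrC ler_pM//.
by rewrite normrM expr2 ler_pM// norm_mx_coord.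
Qed.

(** The mean value theorem is applied to [f] on the segment and then to ['D_w f] on its initial
    part. The usual factor 1/2 is given up, and [n ^ 2] counts the second partial derivatives. *)
Lemma taylor2 n (U : set 'rV[R]_n) (f : 'rV[R]_n -> R^o) x w C : open U ->
  smooth_on U f -> (forall t : R, 0 <= t <= 1 -> U (x + t *: w)) ->
  (forall (i j : 'I_n) (t : R), 0 <= t <= 1 ->
    `|'D_(delta_mx 0 j) ('D_(delta_mx 0 i) f) (x + t *: w)| <= C) ->
  `|f (x + w) - f x - 'D_w f x| <= n%:R ^+ 2 * C * `|w| ^+ 2.
Proof.
move=> oU sf Uw HC.
have sw := smooth_on_derive w sf; have sww := smooth_on_derive w sw.
have [s s01 Es] := mvt_scalar ler01 (fun t t01 => is_derive_along (smooth_on_diff sf (Uw t t01))).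
have /andP[s0 s1] := s01.
have ts t : 0 <= t <= s -> 0 <= t <= 1 by move=> /andP[-> /le_trans->].
have [t /ts t01 Et] := mvt_scalar s0 (fun t ts' => is_derive_along (smooth_on_diff sw (Uw t (ts t ts')))).
move: Es; rewrite scale1r scale0r addr0 subr0 mulr1 => ->.
move: Et; rewrite scale0r addr0 => ->.
have DDE : 'D_w ('D_w f) (x + t *: w) = \sum_i \sum_j w 0 i * w 0 j * 'D_(delta_mx 0 j) ('D_(delta_mx 0 i) f) (x + t *: w).
  have E y : U y -> 'D_w f y = (\sum_i w 0 i *: 'D_(delta_mx 0 i) f) y.
    move=> Uy; rewrite derive_sum_delta ?fct_sumE//.
    exact: smooth_on_diff sf Uy.
  rewrite (derive_eq_on oU w E (Uw t t01)) derive_sum; last first.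
    by move=> i; apply: derivableZ; apply: smooth_on_derivable (Uw t t01); exact: smooth_on_derive.
  apply: eq_bigr => i _; rewrite deriveZ; last first.
    by apply: smooth_on_derivable (Uw t t01); exact: smooth_on_derive.
  rewrite derive_sum_delta; last exact: smooth_on_diff (smooth_on_derive _ sf) (Uw t t01).
  rewrite /GRing.scale/= mulr_sumr; apply: eq_bigr => j _; by rewrite mulrA.
have dC : `|('D_w ('D_w f) (x + t *: w) : R)| <= n%:R ^+ 2 * C * `|w| ^+ 2.
  by rewrite DDE; apply: quadratic_bound => i j; exact: HC.
rewrite -[leRHS]mulr1 subr0 normrM; apply: ler_pM => //.
by rewrite ger0_norm.
Qed.

End mean_value.

(** * Linear ordinary differential equations *)

Section linear_ode.
Context {R : realType}.

(** Retraction of the line onto [0, 1]. Composition with it turns a function controlled only on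
    [0, 1] into one that is continuous everywhere, so that derivatives at 0 and 1 can be
    two-sided. *)
Let clip (t : R) : R^o := Num.max 0 (Num.min 1 t).

Let clip_itv t : 0 <= clip t <= 1.
Proof. by rewrite /clip le_max lexx/= ge_max ler01/= ge_min lexx. Qed.

Let clip_id (t : R) : 0 <= t <= 1 -> clip t = t.
Proof. by move=> /andP[t0 t1]; rewrite /clip min_r// max_r. Qed.

Let clip_continuous : continuous clip.
Proof.
move=> t; apply: (@continuous_max _ _ (cst 0) (fun s : R => Num.min 1 s : R^o)).
  exact: cst_continuous.
by apply: (@continuous_min _ _ (cst 1) (fun s : R => s : R^o)); [exact: cst_continuous|].
Qed.

Lemma exists_primitive (f : R -> R) :
  (forall t : R, 0 <= t <= 1 -> {for t, continuous f}) ->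
  exists2 G : R -> R, G 0 = 0 & forall t : R, 0 <= t <= 1 -> is_derive t (1 : R) (G : R -> R^o) (f t).
Proof.
move=> cf; pose h : R -> R := f \o clip.
have ch : continuous h.
  move=> t; apply: continuous_comp; first exact: clip_continuous.
  exact: cf (clip_itv t).
(* The integral starts at -1, and 2 bounds the range below, so that both 0 and 1 are interior points
   for the fundamental theorem. *)
pose G0 (x : R) : R := \int[@lebesgue_measure R]_(t in [set` Interval (BLeft (-1)) (BRight x)]) h t.
exists (fun x => G0 x - G0 0); first by rewrite subrr.
move=> t t01; have /andP[t0 t1] := t01.
have [||||dG GE] := @continuous_FTC1 R h (BLeft (-1)) t 2.
- by rewrite (le_lt_trans t1)// ltr1n.
- apply: continuous_compact_integrable; first exact: segment_compact.
  exact: continuous_subspaceT.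
- by rewrite lte_fin (lt_le_trans _ t0)// ltrN10.
- exact: ch.
have IG : is_derive t (1 : R) (G0 : R -> R^o) (f t).
  by apply: DeriveDef; [exact: dG|rewrite -derive1E GE /h/= clip_id].
by rewrite -[f t]subr0; apply: is_deriveB.
Qed.

Lemma continuous_rV_coord (T : topologicalType) n (f : T -> 'rV[R]_n) t i :
  {for t, continuous f} -> {for t, continuous (fun s => f s 0 i : R^o)}.
Proof.
move=> ct; apply: (@continuous_comp _ _ _ f (fun v : 'rV[R]_n => v 0 i : R^o) t ct).
exact: coord_continuous.
Qed.

Lemma exists_primitive_rV n (f : R -> 'rV[R]_n) (y0 : 'rV[R]_n) :
  (forall t : R, 0 <= t <= 1 -> {for t, continuous f}) ->
  exists2 G : R -> 'rV[R]_n, G 0 = y0 & forall t : R, 0 <= t <= 1 -> is_derive t (1 : R) G (f t).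
Proof.
move=> cf.
have /choice[G HG] : forall i, exists G : R -> R, G 0 = 0 /\ forall t : R, 0 <= t <= 1 ->
    is_derive t (1 : R) (G : R -> R^o) (f t 0 i).
  move=> i; have [|G G0 HG] := @exists_primitive (fun t => f t 0 i); last by exists G.
  by move=> t /cf; exact: continuous_rV_coord.
exists (fun t => y0 + \row_i G i t).
  by apply/rowP => i; rewrite !mxE (HG i).1 addr0.
move=> t t01; apply: is_derive_rV => i.
have -> : (fun s => (y0 + \row_i G i s) 0 i : R^o) = cst (y0 0 i) \+ (G i : R -> R^o).
  by apply/funext => s; rewrite !mxE.
rewrite -[f t 0 i]add0r; apply: is_deriveD; exact: (HG i).2.
Qed.

(** Nested intervals: [e k] is the tail of the geometric series of the increments, so [u k - e k]
    increases, [u k + e k] decreases, and the supremum of the left endpoints lies in every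
    interval. *)
Lemma geometric_limit (u : nat -> R) C :
  (forall k, `|u k.+1 - u k| <= C / 2 ^+ k) ->
  exists l, forall k, `|l - u k| <= 2 * C / 2 ^+ k.
Proof.
move=> uC; pose e k : R := 2 * C / 2 ^+ k.
have eS k : e k = e k.+1 + C / 2 ^+ k.
  by rewrite /e exprS; field; rewrite expf_neq0.
have C0 : 0 <= C by have := le_trans (normr_ge0 _) (uC 0); rewrite expr0 divr1.
have e0 k : 0 <= e k by rewrite /e divr_ge0 ?exprn_ge0// mulr_ge0.
have nd : {homo (fun k => u k - e k) : m k / (m <= k)%N >-> m <= k}.
  apply: homo_leq => // [x y z|k]; first exact: le_trans.
  by move: (uC k); rewrite (eS k) ler_norml => /andP[]; lra.
have ni : {homo (fun k => u k + e k) : m k / (m <= k)%N >-> k <= m}.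
  apply: (homo_leq (r := fun x y => y <= x)) => // [x y z xy yz|k]; first exact: le_trans yz xy.
  by move: (uC k); rewrite (eS k) ler_norml => /andP[]; lra.
have ab k m : u k - e k <= u m + e m.
  apply: (le_trans (nd _ _ (leq_maxl k m))); apply: le_trans (ni _ _ (leq_maxr k m)).
  by rewrite lerD2l; have := e0 (maxn k m); lra.
pose S := [set u k - e k | k in [set: nat]].
have ubS m : ubound S (u m + e m) by move=> _ [k _ <-].
have S0 : S !=set0 by exists (u 0 - e 0); exists 0%N.
exists (sup S) => k; rewrite -/(e k) ler_distl; apply/andP; split; last exact: ge_sup.
by apply: ub_le_sup; [exists (u 0%N + e 0%N); exact: ubS|exists k].
Qed.

Lemma geometric_limit_rV n (u : nat -> 'rV[R]_n) C :
  (forall k, `|u k.+1 - u k| <= C / 2 ^+ k) ->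
  exists l, forall k, `|l - u k| <= 2 * C / 2 ^+ k.
Proof.
move=> uC.
have /choice[l Hl] : forall i, exists l, forall k, `|l - u k 0 i| <= 2 * C / 2 ^+ k.
  move=> i; apply: geometric_limit => k; apply: le_trans (uC k).
  by have := norm_mx_coord (u k.+1 - u k) 0 i; rewrite !mxE.
exists (\row_i l i) => k.
have C0 : 0 <= C by have := le_trans (normr_ge0 _) (uC 0%N); rewrite expr0 divr1.
apply: norm_rV_le => [|i]; first by rewrite divr_ge0 ?exprn_ge0// mulr_ge0.
by rewrite !mxE.
Qed.

Lemma small_geometric (C e : R) : 0 < e -> exists k, C / 2 ^+ k < e.
Proof.
move=> e0; have [k Hk] : exists k, C / e < 2 ^+ k.
  exists (Num.bound `|C / e|); apply: lt_trans (_ : (Num.bound `|C/e|)%:R < _).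
    by rewrite (le_lt_trans (ler_norm _))// archi_boundP.
  by rewrite -natrX ltr_nat ltn_expl.
by exists k; rewrite ltr_pdivrMr ?exprn_gt0// mulrC -ltr_pdivrMr.
Qed.

(** At a point [c] where [|d|] is maximal, the mean value inequality from 0 gives
    [|d c| <= |d c| / 2 + e], the interval having length 1; the first term is absorbed on the
    left. *)
Lemma gronwall_half n (d dd : R -> 'rV[R]_n) (e : R) :
  (forall t : R, 0 <= t <= 1 -> is_derive t (1 : R) d (dd t)) -> d 0 = 0 ->
  (forall t : R, 0 <= t <= 1 -> `|dd t| <= 2^-1 * `|d t| + e) ->
  forall t : R, 0 <= t <= 1 -> `|d t| <= 2 * e.
Proof.
move=> Hd d0 He.
have [|c c01 Hc] := @EVT_max R (fun t => `|d t|) 0 1 ler01.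
  apply: continuous_in_subspaceT => t; rewrite inE/= in_itv/= => t01.
  apply: (continuous_comp (is_derive_continuous (Hd t t01))).
  exact: norm_continuous.
have {}Hc t : 0 <= t <= 1 -> `|d t| <= `|d c| by move=> t01; apply: Hc; rewrite in_itv.
rewrite in_itv/= in c01; have /andP[c0 c1] := c01.
have dc : `|d c| <= 2^-1 * `|d c| + e.
  have : `|d c - d 0| <= (2^-1 * `|d c| + e) * (c - 0).
    have st (t : R) : 0 <= t <= c -> 0 <= t <= 1 by move=> /andP[-> /le_trans->].
    apply: (@mvt_rV _ _ d dd) => // t /st t01; first exact: Hd.
    by rewrite (le_trans (He t t01))// lerD2r ler_wpM2l// Hc.
  rewrite d0 !subr0 => /le_trans; apply; rewrite ler_piMr//.
  exact: le_trans (He c c01).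
by move=> t /Hc/le_trans; apply; move: dc; lra.
Qed.

Lemma continuous_rV (T : topologicalType) n (f : T -> 'rV[R]_n) t :
  (forall i, {for t, continuous (fun s => f s 0 i : R^o)}) -> {for t, continuous f}.
Proof.
move=> fi; apply/cvgrPdist_le => e e0.
have : \forall s \near t, forall i, `|f t 0 i - f s 0 i| <= e.
  apply: filter_forall => i.
  have /cvgrPdist_le/(_ e e0) := fi i; exact.
apply: filterS => s H; apply: norm_rV_le => [|i]; first exact: ltW.
by rewrite !mxE; exact: H.
Qed.

Section picard.
Variables (n : nat) (a : R -> 'M[R]_n) (y0 : 'rV[R]_n).
Hypothesis ca : forall t : R, 0 <= t <= 1 -> forall i j, {for t, continuous (fun t => a t i j)}.
Hypothesis half : forall t : R, 0 <= t <= 1 -> forall v : 'rV[R]_n, `|v *m a t| <= 2^-1 * `|v|.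

Lemma mulmx_continuous_at (y : R -> 'rV[R]_n) (t : R) : 0 <= t <= 1 ->
  {for t, continuous y} -> {for t, continuous (fun s => y s *m a s)}.
Proof.
move=> t01 cy.
apply: continuous_rV => j.
have -> : (fun s => (y s *m a s) 0 j : R^o) = \sum_i (fun s => y s 0 i * a s i j).
  by apply/funext => s; rewrite mxE fct_sumE.
elim/big_ind: _ => [|f g cf cg|i _]; first exact: cst_continuous.
  exact: cvgD cf cg.
by apply: cvgM; [exact: continuous_rV_coord|exact: ca].
Qed.

(** Picard iteration. By [half] the integral operator contracts by 1/2 on all of [0, 1], so no
    subdivision of the interval is involved. *)
Lemma linear_ode : exists2 y : R -> 'rV[R]_n, y 0 = y0 &
  forall t : R, 0 <= t <= 1 -> is_derive t (1 : R) y (y t *m a t).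
Proof.
pose cont (y : R -> 'rV[R]_n) := forall t : R, 0 <= t <= 1 -> {for t, continuous y}.
(* The Picard operator as a total function, with a junk value at functions that are not continuous
   on [0, 1]. *)
have /choice[T HT] : forall y, exists z : R -> 'rV[R]_n, cont y ->
    z 0 = y0 /\ forall t : R, 0 <= t <= 1 -> is_derive t (1 : R) z (y t *m a t).
  move=> y; have [cy|ncy] := pselect (cont y); last by exists y.
  have [t t01|z z0 Hz] := @exists_primitive_rV n (fun t => y t *m a t) y0.
    by apply: mulmx_continuous_at => //; exact: cy.
  by exists z.
pose Y k := iter k T (cst y0).
have cY k : cont (Y k).
  elim: k => [|k ih] t t01; first exact: cst_continuous.
  exact: is_derive_continuous ((HT _ ih).2 t t01).
have Y0 k : Y k.+1 0 = y0 by have [] := HT _ (cY k).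
have DY k (t : R) : 0 <= t <= 1 -> is_derive t (1 : R) (Y k.+1) (Y k t *m a t).
  by move=> t01; have [_] := HT _ (cY k); apply.
(* The contraction estimate. Here [du] and [dv] are the inputs whose Picard images are [u] and [v],
   not the derivatives of [u] and [v]. *)
have bound (u v du dv : R -> 'rV[R]_n) C : u 0 = v 0 ->
    (forall t : R, 0 <= t <= 1 -> is_derive t (1 : R) u (du t *m a t)) ->
    (forall t : R, 0 <= t <= 1 -> is_derive t (1 : R) v (dv t *m a t)) ->
    (forall t : R, 0 <= t <= 1 -> `|du t - dv t| <= C) ->
    forall t : R, 0 <= t <= 1 -> `|u t - v t| <= C / 2.
  move=> uv0 Du Dv HC t /andP[t0 t1].
  have C0 : 0 <= C by apply: le_trans (HC 0 _); rewrite ?lexx ?ler01.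
  have -> : u t - v t = (u t - v t) - (u 0 - v 0) by rewrite uv0 subrr subr0.
  apply: (@le_trans _ _ (C / 2 * (t - 0))); last by rewrite subr0 ler_piMr// divr_ge0.
  have st (s : R) : 0 <= s <= t -> 0 <= s <= 1 by move=> /andP[-> /le_trans->].
  apply: (@mvt_rV _ _ (fun s => u s - v s) (fun s => du s *m a s - dv s *m a s)) => // s /st s01.
    by apply: is_deriveB; [exact: Du|exact: Dv].
  by rewrite -mulmxBl (le_trans (half s01 _))// mulrC ler_wpM2r// HC.
have dY k (t : R) : 0 <= t <= 1 -> `|Y k.+1 t - Y k t| <= `|y0| / 2 ^+ k.
  elim: k t => [|k ih] t t01; last first.
    rewrite exprSr invfM mulrA; apply: (bound _ _ (Y k.+1) (Y k)) => //; rewrite ?Y0//.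
  rewrite expr0 divr1 (@le_trans _ _ (`|y0| / 2))//; last first.
    by rewrite ler_pdivrMr// ler_peMr// ler1n.
  (* The starting constant is itself a Picard image, namely of the zero function. *)
  apply: (bound _ _ (cst y0) (cst 0)) => // s _; last by rewrite subr0.
  by rewrite mul0mx; exact: is_derive_cst.
(* Through [clip] the uniform bound holds on the whole line, which makes the limit continuous from
   both sides at 0 and 1. *)
have /choice[y Hy] : forall t : R, exists l, forall k, `|l - Y k (clip t)| <= 2 * `|y0| / 2 ^+ k.
  by move=> t; apply: (@geometric_limit_rV _ (fun k => Y k (clip t))) => k; exact: dY.
have cy : cont y.
  move=> t t01; apply/cvgrPdist_lt => e e0.
  have [k Hk] := small_geometric (2 * `|y0|) (divr_gt0 e0 (ltr0n _ 3)).
  have cYk : {for t, continuous (Y k \o clip)}.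
    apply: continuous_comp; first exact: clip_continuous.
    by rewrite clip_id//; exact: cY.
  have /cvgrPdist_lt/(_ _ (divr_gt0 e0 (ltr0n _ 3))) := cYk.
  apply: filterS => s /= Hs.
  have -> : y t - y s = (y t - Y k (clip t)) + (Y k (clip t) - Y k (clip s)) + (Y k (clip s) - y s).
    by rewrite !addrA !subrK.
  have yt := le_lt_trans (Hy t k) Hk; have ys := le_lt_trans (Hy s k) Hk.
  rewrite distrC in ys.
  apply: le_lt_trans (ler_normD _ _) _; apply: le_lt_trans (lerD (ler_normD _ _) (lexx _)) _.
  by move: yt ys Hs; lra.
have [z z0 Dz] := exists_primitive_rV y0 (fun t t01 => mulmx_continuous_at t01 (cy t t01)).
exists z => // t t01; have -> : z t = y t; last exact: Dz.
apply/eqP; rewrite -subr_eq0 -normr_le0; apply/ler_addgt0Pl => e e0; rewrite addr0.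
(* The distances from [Y k.+1] to [z] and to [y] are each at most [|y0| / 2 ^ k]; the third such
   term is slack. *)
have [k Hk] := small_geometric (3 * `|y0|) e0.
apply: le_trans (ltW Hk).
rewrite -(subrKA (Y k.+1 t)) (le_trans (ler_normD _ _))//.
have yY s : 0 <= s <= 1 -> forall k, `|y s - Y k s| <= 2 * `|y0| / 2 ^+ k.
  by move=> s01 k'; have := Hy s k'; rewrite clip_id.
have -> : 3 * `|y0| / 2 ^+ k = 2 * `|y0| / 2 ^+ k / 2 + 2 * `|y0| / 2 ^+ k.+1 + `|y0| / 2 ^+ k.
  by rewrite exprS; field; rewrite expf_neq0.
rewrite ler_wpDr ?divr_ge0 ?exprn_ge0// lerD//; last by rewrite distrC yY.
by apply: (bound _ _ y (Y k)); rewrite ?z0 ?Y0// => s s01; exact: yY.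
Qed.

End picard.
End linear_ode.

(** * Matrix norm estimates, and differentiability from bounds on the remainder *)

Section estimates.
Context {R : realType}.

Lemma norm_mulmx m n p (A : 'M[R]_(m, n)) (B : 'M[R]_(n, p)) :
  `|A *m B| <= n%:R * `|A| * `|B|.
Proof.
apply: norm_mx_le => [|i j]; first by rewrite !mulr_ge0.
rewrite mxE (le_trans (ler_norm_sum _ _ _))//.
rewrite -[n in n%:R]card_ord -mulrA mulr_natl -sumr_const.
by apply: ler_sum => k _; rewrite normrM ler_pM// norm_mx_coord.
Qed.

Lemma norm_lincomb_le m p n (v : 'rV[R]_n) (M : 'I_n -> 'M[R]_(m, p)) C :
  (forall i, `|M i| <= C) -> `|\sum_i v 0 i *: M i| <= n%:R * C * `|v|.
Proof.
move=> MC; rewrite (le_trans (ler_norm_sum _ _ _))//.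
rewrite -[n in n%:R]card_ord -mulrA mulr_natl -sumr_const.
by apply: ler_sum => k _; rewrite normrZ mulrC ler_pM// norm_mx_coord.
Qed.

Lemma mulmxr_continuous n m (J : 'M[R]_(n, m)) : continuous (mulmxr J : 'rV[R]_n -> 'rV[R]_m).
Proof.
apply: bounded_linear_continuous; apply/linear_boundedP.
exists (n%:R * `|J|); split; first exact: num_real.
move=> K HK v; apply: le_trans (norm_mulmx _ _) _.
rewrite -mulrA [`|v| * _]mulrC mulrA ler_wpM2r// ltW//.
Qed.

Lemma differentiable_estimate (V W : normedModType R) (f : V -> W)
    (L : {linear V -> W}) x : continuous L ->
  (forall e, 0 < e -> \forall w \near 0, `|f (x + w) - f x - L w| <= e * `|w|) ->
  differentiable f x /\ 'd f x = L :> (V -> W).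
Proof.
move=> cL fL.
have fE : f \o shift x = cst (f x) + L +o_ 0 id.
  apply/eqaddoP => e e0; apply: filterS (fL e e0) => w.
  suff -> : (f \o shift x - (cst (f x) + L)) w = f (x + w) - f x - L w by [].
  by rewrite -[LHS]/(f (w + x) - (f x + L w)) opprD addrA [w + x]addrC.
have dE := diff_unique cL fE.
by split => //; apply/diff_locallyP; rewrite dE; split.
Qed.

Lemma differentiable_quadratic (V W : normedModType R) (f : V -> W)
    (L : {linear V -> W}) x r K : continuous L -> 0 < r ->
  (forall w, `|w| < r -> `|f (x + w) - f x - L w| <= K * `|w| ^+ 2) ->
  differentiable f x /\ 'd f x = L :> (V -> W).
Proof.
move=> cL r0 fL; apply: differentiable_estimate => // e e0.
have K0 : 0 < `|K| + 1 by rewrite ltr_wpDl.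
near=> w; apply: le_trans (fL w _) _.
  by near: w; apply: nbhs0_lt.
rewrite expr2 mulrA ler_wpM2r//; apply: (@le_trans _ _ ((`|K| + 1) * `|w|)).
  by rewrite ler_wpM2r// ler_wpDr// ler_norm.
rewrite mulrC -ler_pdivlMr//; near: w; apply: nbhs0_le; exact: divr_gt0.
Unshelve. all: by end_near. Qed.

Lemma near_dist (V : normedModType R) (P : set V) x :
  (\forall y \near x, P y) -> exists2 r, 0 < r & forall y, `|y - x| < r -> P y.
Proof.
move=> /nbhs_ballP[r /= r0 Hr]; exists r => // y yx.
by apply: Hr; rewrite -ball_normE /= distrC.
Qed.

Lemma locally_bounded_family (T : topologicalType) (I : finType) (f : I -> T -> R^o) x :
  (forall i, {for x, continuous (f i)}) ->
  exists2 C : R, 0 <= C & \forall y \near x, forall i, `|f i y : R| <= C.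
Proof.
move=> cf; exists (\sum_i `|f i x : R| + 1); first by rewrite addr_ge0// sumr_ge0.
apply: filter_forall => i.
have /cvgrPdist_lt/(_ 1 ltr01) := cf i; apply: filterS => y fy.
apply: (@le_trans _ _ (`|f i x : R| + 1)).
  have -> : f i y = f i x - (f i x - f i y) by rewrite subKr.
  by rewrite (le_trans (ler_normB _ _))// lerD2l ltW.
by rewrite lerD2r (bigD1 i)//= ler_wpDr// sumr_ge0.
Qed.

End estimates.

(** * The Frobenius theorem for linear total systems *)

Lemma is_derive_mulmx (R : realType) n m (y : R -> 'rV[R]_n) (M : R -> 'M[R]_(n, m))
    (t : R) (dy : 'rV[R]_n) (dM : 'M[R]_(n, m)) :
  is_derive t (1 : R) y dy ->
  (forall i j, is_derive t (1 : R) (fun s => M s i j : R^o) (dM i j)) ->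
  is_derive t (1 : R) (fun s => y s *m M s) (dy *m M t + y t *m dM).
Proof.
move=> Dy DM; apply: is_derive_rV => j.
have -> : (fun s => (y s *m M s) 0 j : R^o) = \sum_i (fun s => y s 0 i : R^o) * (fun s => M s i j : R^o).
  by apply/funext => s; rewrite mxE fct_sumE.
have -> : (dy *m M t + y t *m dM) 0 j = \sum_i (y t 0 i *: (dM i j : R^o) + M t i j *: (dy 0 i : R^o)).
  by rewrite !mxE -big_split; apply: eq_bigr => i _ /=; rewrite addrC; congr (_ + _); exact: mulrC.
apply: is_derive_sum => i; apply: is_deriveM; exact: is_derive_coord.
Qed.

Section linear_frobenius.
Context {R : realType} (n N : nat) (U : set 'rV[R]_n) (oU : open U).
Variable A : 'I_n -> 'rV[R]_n -> 'M[R]_N.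
Hypothesis sA : forall i k l, smooth_on U (fun x => A i x k l : R^o).

(** The matrix-valued one-form of the system ['D_v F = F *m AA x v]. In [DA x u v] below, [u] is the
    direction of differentiation and [v] the argument of the form. *)
Let AA x (v : 'rV[R]_n) := \sum_i v 0 i *: A i x.
Let D i x (u : 'rV[R]_n) := \matrix_(k, l) 'D_u (fun y => A i y k l : R^o) x.
Let DA x (u v : 'rV[R]_n) := \sum_i v 0 i *: D i x u.

Let AAD x u v : AA x (u + v) = AA x u + AA x v.
Proof. by rewrite -big_split; apply: eq_bigr => i _; rewrite mxE scalerDl. Qed.

Let DADr x w u v : DA x w (u + v) = DA x w u + DA x w v.
Proof. by rewrite -big_split; apply: eq_bigr => i _; rewrite mxE scalerDl. Qed.

Let D_delta i x u : U x -> D i x u = \sum_j u 0 j *: D i x (delta_mx 0 j).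
Proof.
move=> Ux; apply/matrixP => k l; rewrite mxE derive_sum_delta; last exact: smooth_on_diff (sA i k l) Ux.
by rewrite summxE; apply: eq_bigr => j _; rewrite !mxE.
Qed.

Let DZ i x a u : U x -> D i x (a *: u) = a *: D i x u.
Proof.
move=> Ux; apply/matrixP => k l; rewrite !mxE.
by rewrite deriveZv//; exact: smooth_on_diff (sA i k l) Ux.
Qed.

(** The two sides are the coefficients of [F] in the mixed second derivatives of a solution, taken
    in the two orders: the form [AA] has zero curvature. *)
Hypothesis flat : forall i j x, U x ->
  A j x *m A i x + D i x (delta_mx 0 j) = A i x *m A j x + D j x (delta_mx 0 i).

Let flatv x u v : U x -> AA x v *m AA x u + DA x v u = AA x u *m AA x v + DA x u v.
Proof.
move=> Ux.
have E a b : AA x b *m AA x a + DA x b a =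
    \sum_i \sum_j (a 0 i * b 0 j) *: (A j x *m A i x + D i x (delta_mx 0 j)).
  rewrite mulmx_sumr -big_split/=; apply: eq_bigr => i _.
  rewrite D_delta// -scalemxAr mulmx_suml -scalerDr -big_split/= scaler_sumr.
  by apply: eq_bigr => j _; rewrite -scalemxAl -scalerDr scalerA.
rewrite !E exchange_big/=; apply: eq_bigr => i _; apply: eq_bigr => j _.
by rewrite mulrC flat.
Qed.

(** Local boundedness of the coefficients and of their first two derivatives; the last bound is
    Taylor's, valid because a ball contains the segment between two of its points. *)
Let bounds x0 : U x0 -> exists r c, [/\ 0 < r /\ 0 <= c,
  forall x, `|x - x0| < r -> U x,
  forall x v, `|x - x0| < r -> `|AA x v| <= c * `|v|,
  forall x u v, `|x - x0| < r -> `|DA x u v| <= c * (`|u| * `|v|) &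
  forall x w v, `|x - x0| < r -> `|x + w - x0| < r ->
     `|AA (x + w) v - AA x v - DA x w v| <= c * (`|w| ^+ 2 * `|v|)].
Proof.
move=> Ux0.
have [C0 C00 H0] := @locally_bounded_family R _ ('I_n * 'I_N * 'I_N)%type
  (fun s y => A s.1.1 y s.1.2 s.2) x0 (fun s => smooth_on_continuous (sA _ _ _) Ux0).
have [C1 C10 H1] := @locally_bounded_family R _ ('I_n * 'I_N * 'I_N * 'I_n)%type
  (fun s => 'D_(delta_mx 0 s.2) (fun y => A s.1.1.1 y s.1.1.2 s.1.2 : R^o)) x0
  (fun s => smooth_on_continuous (smooth_on_derive _ (sA _ _ _)) Ux0).
have [C2 C20 H2] := @locally_bounded_family R _ ('I_n * 'I_N * 'I_N * 'I_n * 'I_n)%type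
  (fun s => 'D_(delta_mx 0 s.2) ('D_(delta_mx 0 s.1.2) (fun y => A s.1.1.1.1 y s.1.1.1.2 s.1.1.2 : R^o))) x0
  (fun s => smooth_on_continuous (smooth_on_derive _ (smooth_on_derive _ (sA _ _ _))) Ux0).
have HU : \forall y \near x0, U y by exact: open_nbhs_nbhs.
have [r r0 Hr] := @near_dist R 'rV[R]_n _ x0 (filterI HU (filterI H0 (filterI H1 H2))).
have {}Hr x : `|x - x0| < r -> [/\ U x,
    forall i k l, `|A i x k l| <= C0,
    forall i k l j, `|('D_(delta_mx 0 j) (fun y => A i y k l : R^o) x : R)| <= C1 &
    forall i k l j m, `|('D_(delta_mx 0 m) ('D_(delta_mx 0 j) (fun y => A i y k l : R^o)) x : R)| <= C2].
  move=> /Hr[? [H3 [H4 H5]]].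
  split => // [i k l|i k l j|i k l j m].
  - exact: (H3 (i, k, l)).
  - exact: (H4 (i, k, l, j)).
  - exact: (H5 (i, k, l, j, m)).
have segment x w (t : R) : `|x - x0| < r -> `|x + w - x0| < r -> 0 <= t <= 1 -> `|x + t *: w - x0| < r.
  move=> xr xwr /andP[t0 t1].
  have -> : x + t *: w - x0 = (1 - t) *: (x - x0) + t *: (x + w - x0).
    by apply/rowP => j; rewrite !mxE; ring.
  rewrite (le_lt_trans (ler_normD _ _))// !normrZ [`|t|]ger0_norm// ger0_norm ?subr_ge0//.
  have [->|tN1] := eqVneq t 1; first by rewrite subrr mul0r add0r mul1r.
  have t1' : 0 < 1 - t by rewrite subr_gt0 lt_neqAle tN1.
  have a := xr; rewrite -(ltr_pM2l t1') in a.
  have b := ltW xwr; have := ler_wpM2l t0 b; lra.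
(* The summands serve the form, its derivative and its Taylor remainder; each outer factor [n] comes
   from contracting the form with [v]. *)
pose c := n%:R * C0 + n%:R * (n%:R * C1) + n%:R * (n%:R ^+ 2 * C2).
have c0 : 0 <= n%:R * C0 by rewrite mulr_ge0.
have c1 : 0 <= n%:R * (n%:R * C1) by rewrite !mulr_ge0.
have c2 : 0 <= n%:R * (n%:R ^+ 2 * C2) by rewrite !mulr_ge0// exprn_ge0.
exists r, c; split => //.
- by split; rewrite // !addr_ge0.
- by move=> x /Hr[].
- move=> x v /Hr[Ux HA _ _]; apply: (@le_trans _ _ (n%:R * C0 * `|v|)).
    by apply: norm_lincomb_le => i; exact: norm_mx_le.
  by rewrite ler_wpM2r// /c -addrA lerDl addr_ge0.
- move=> x u v /Hr[Ux _ HD _]; apply: (@le_trans _ _ (n%:R * (n%:R * C1 * `|u|) * `|v|)).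
    apply: norm_lincomb_le => i; rewrite D_delta//.
    by apply: norm_lincomb_le => j; apply: norm_mx_le => // k l; rewrite mxE.
  have -> : n%:R * (n%:R * C1 * `|u|) * `|v| = n%:R * (n%:R * C1) * (`|u| * `|v|) by ring.
  by rewrite ler_wpM2r ?mulr_ge0// /c; move: c0 c1 c2; lra.
move=> x w v xr xwr.
have seg t t01 := segment x w t xr xwr t01.
have -> : AA (x + w) v - AA x v - DA x w v = \sum_i v 0 i *: (A i (x + w) - A i x - D i x w).
  by rewrite -!sumrB; apply: eq_bigr => i _; rewrite !scalerBr.
apply: (@le_trans _ _ (n%:R * (n%:R ^+ 2 * C2 * `|w| ^+ 2) * `|v|)).
  apply: norm_lincomb_le => i; apply: norm_mx_le => [|k l].
    by rewrite !mulr_ge0// exprn_ge0.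
  rewrite !mxE; apply: (taylor2 (f := fun y => A i y k l : R^o) oU (sA i k l)).
    by move=> t /seg/Hr[].
  by move=> p q t /seg/Hr[_ _ _]; exact.
have -> : n%:R * (n%:R ^+ 2 * C2 * `|w| ^+ 2) * `|v| = n%:R * (n%:R ^+ 2 * C2) * (`|w| ^+ 2 * `|v|) by ring.
by rewrite ler_wpM2r ?mulr_ge0 ?exprn_ge0// /c; move: c0 c1 c2; lra.
Qed.

Let is_derive_AA x v w (t : R) k l : U (x + t *: v) ->
  is_derive t (1 : R) (fun s : R => AA (x + s *: v) w k l : R^o) (DA (x + t *: v) v w k l).
Proof.
move=> Ux.
have -> : (fun s : R => AA (x + s *: v) w k l : R^o) =
    \sum_i (fun s : R => w 0 i *: (A i (x + s *: v) k l : R^o)).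
  apply/funext => s; rewrite /AA summxE fct_sumE; apply: eq_bigr => i _.
  by rewrite mxE.
have -> : DA (x + t *: v) v w k l =
    \sum_i w 0 i *: ('D_v (fun y => A i y k l : R^o) (x + t *: v)).
  by rewrite /DA summxE; apply: eq_bigr => i _; rewrite !mxE.
apply: is_derive_sum => i; apply: is_deriveZ.
apply: (@is_derive_along _ _ _ (fun y => A i y k l : R^o)).
exact: smooth_on_diff (sA i k l) Ux.
Qed.

(** [F x] is the value at time 1 of the solution on the ray to [x], so the content lies in the
    derivative across rays. Differentiation of the equation with respect to a parameter is avoided:
    the solution on a neighbouring ray is compared with an explicit approximate solution. *)
Theorem linear_frobenius x0 : U x0 -> exists r, [/\ 0 < r,
  forall x, `|x - x0| < r -> U x &
  forall F0 : 'rV[R]_N, exists2 F : 'rV[R]_n -> 'rV[R]_N, F x0 = F0 &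
    forall x, `|x - x0| < r -> differentiable F x /\
      forall v, 'D_v F x = F x *m \sum_i v 0 i *: A i x].
Proof.
move=> Ux0; have [r0 [c [[r00 c0] HU HA HDA Hrem]]] := bounds Ux0.
pose K := 2 * (N%:R * c) + 1.
have K0 : 0 < K by rewrite ltr_wpDl// !mulr_ge0.
pose r := Num.min r0 (Num.min 1 K^-1).
have r_gt0 : 0 < r by rewrite !lt_min r00 ltr01 invr_gt0 K0.
have rr0 : r <= r0 by rewrite ge_min lexx.
have r1 : r <= 1 by rewrite !ge_min lexx orbT.
have rK : N%:R * c * r <= 2^-1.
  have : r <= K^-1 by rewrite !ge_min lexx !orbT.
  have Nc : 0 <= N%:R * c by rewrite mulr_ge0.
  move=> /(ler_wpM2l Nc)/le_trans; apply.
  by rewrite ler_pdivrMr// /K; move: (N%:R * c) Nc => z; lra.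
exists r; split => // [x xr|F0]; first by apply: HU; exact: lt_le_trans rr0.
have inr (v : 'rV[R]_n) (t : R) : `|v| < r -> 0 <= t <= 1 -> `|x0 + t *: v - x0| < r0.
  move=> vr /andP[t0 t1]; rewrite addrC addKr normrZ ger0_norm//.
  by apply: lt_le_trans rr0; apply: le_lt_trans vr; rewrite ler_piMl.
have half v (t : R) : `|v| < r -> 0 <= t <= 1 -> forall y : 'rV[R]_N,
    `|y *m AA (x0 + t *: v) v| <= 2^-1 * `|y|.
  move=> vr t01 y; apply: le_trans (norm_mulmx _ _) _.
  rewrite -mulrA mulrCA mulrC ler_wpM2r//; apply: le_trans rK; rewrite -mulrA ler_wpM2l//.
  by apply: le_trans (HA _ _ (inr _ _ vr t01)) _; rewrite ler_wpM2l// ltW.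
have /choice[Y HY] : forall v, exists Y : R -> 'rV[R]_N, `|v| < r -> Y 0 = F0 /\
    forall t : R, 0 <= t <= 1 -> is_derive t (1 : R) Y (Y t *m AA (x0 + t *: v) v).
  move=> v; have [vr|vr] := boolP (`|v| < r); last by exists (cst 0).
  have [|t t01|y y0 Hy] := @linear_ode R N (fun t => AA (x0 + t *: v) v) F0; last by exists y.
    move=> t t01 i j; have Ut := HU _ (inr _ _ vr t01).
    exact: is_derive_continuous (is_derive_AA v i j Ut).
  exact: half.
(* Gronwall's inequality for [Y v - F0], whose derivative is at most half of [|Y v - F0| + |F0|]. *)
have Ybound v : `|v| < r -> forall t : R, 0 <= t <= 1 -> `|Y v t| <= 2 * `|F0|.
  move=> vr t t01; have [Yv0 DY] := HY v vr.
  have : `|Y v t - F0| <= 2 * (2^-1 * `|F0|).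
    apply: (@gronwall_half _ _ (fun s => Y v s - F0) (fun s => Y v s *m AA (x0 + s *: v) v)) => //.
    - move=> s s01; rewrite -[X in is_derive _ _ _ X]subr0; apply: is_deriveB; exact: DY.
    - by rewrite Yv0 subrr.
    - move=> s s01; apply: le_trans (half v s vr s01 _) _; rewrite -mulrDr ler_wpM2l//.
      by rewrite -{1}(subrK F0 (Y v s)) ler_normD.
  rewrite mulrA mulfV// mul1r => H.
  by rewrite -(subrK F0 (Y v t)) (le_trans (ler_normD _ _))//; lra.
pose F x := Y (x - x0) 1.
exists F.
  rewrite /F subrr; have [|Y0 DY] := HY 0; first by rewrite normr0.
  apply/eqP; rewrite -subr_eq0 -normr_le0 -[F0]Y0.
  have := @mvt_rV _ _ (Y 0) (fun s => Y 0 s *m AA (x0 + s *: 0) 0) 0 1 0 ler01 DY.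
  rewrite mul0r; apply => t _; rewrite /AA big1 ?mulmx0 ?normr0// => i _.
  by rewrite mxE scale0r.
move=> x; have [v vE] : exists v, v = x - x0 by exists (x - x0).
rewrite -vE => xr.
have [Y0 DY] := HY v xr.
pose J : 'M[R]_(n, N) := \matrix_i (F x *m A i x).
have JE w : F x *m AA x w = mulmxr J w.
  rewrite /= /AA mulmx_sumr mulmx_sum_row; apply: eq_bigr => i _.
  by rewrite -scalemxAr rowK.
(* The leading 2 comes from [gronwall_half], the factor [N * 2 |F0|] from multiplication by [Y v t],
   and the five summands from the five error terms in [Ebound], in the same order. *)
pose KK := 2 * (N%:R * (2 * `|F0|) * (c + N%:R * c * c + N%:R * c * c + c + N%:R * c * c)).
have rv : 0 < r - `|v| by rewrite subr_gt0.
have [|dF FE] := @differentiable_quadratic R _ _ F (mulmxr J) x (r - `|v|) KK (@mulmxr_continuous _ _ _ J) rv.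
  move=> w wr; change (`|F (x + w) - F x - w *m J| <= KK * `|w| ^+ 2).
  rewrite -[w *m J]/(mulmxr J w) -JE.
  have wr1 : `|w| <= 1 by apply: le_trans (ltW wr) _; rewrite lerBlDr ler_wpDr//.
  have vwr : `|v + w| < r.
    by apply: le_lt_trans (ler_normD _ _) _; rewrite addrC -ltrBrDr.
  have [Z0 DZw] := HY (v + w) vwr.
  pose X (t : R) := x0 + t *: v.
  have XE (t : R) : X t + t *: w = x0 + t *: (v + w) by rewrite scalerDr addrA.
  (* [q] is the transport along the ray to [v] corrected to first order in [w]; it satisfies
     the equation of the ray to [v + w] up to an error quadratic in [w], thanks to [flat]. *)
  pose q (t : R) := Y v t *m (1%:M + t *: AA (X t) w).
  pose dq (t : R) := Y v t *m AA (X t) v *m (1%:M + t *: AA (X t) w) +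
    Y v t *m (AA (X t) w + t *: DA (X t) v w).
  have Dq (t : R) : 0 <= t <= 1 -> is_derive t (1 : R) q (dq t).
    move=> t01; apply: is_derive_mulmx; first exact: DY.
    move=> i j; have Ut := HU _ (inr _ _ xr t01).
    have -> : (fun s : R => (1%:M + s *: AA (X s) w) i j : R^o) =
        cst ((1%:M : 'M[R]_N) i j : R^o) \+ (id : R -> R^o) * (fun s : R => AA (X s) w i j : R^o).
      apply/funext => s; by rewrite mxE [X in _ + X = _]mxE.
    have -> : (AA (X t) w + t *: DA (X t) v w) i j =
        0 + (t *: (DA (X t) v w i j : R^o) + AA (X t) w i j *: (1 : R^o)).
      by rewrite !mxE add0r addrC; congr (_ + _); rewrite /GRing.scale/= mulr1.
    by apply: is_deriveD; apply: is_deriveM; exact: is_derive_AA.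
  pose Z := Y (v + w).
  pose E := (c + N%:R * c * c + N%:R * c * c + c + N%:R * c * c) * `|w| ^+ 2.
  have w2 : 0 <= `|w| ^+ 2 by rewrite exprn_ge0.
  have Ebound (t : R) : 0 <= t <= 1 ->
      `|AA (X t) v *m (1%:M + t *: AA (X t) w) + (AA (X t) w + t *: DA (X t) v w)
        - (1%:M + t *: AA (X t) w) *m AA (x0 + t *: (v + w)) (v + w)| <= E.
    move=> t01; have Xt := inr _ _ xr t01; have Ut := HU _ Xt.
    have Xwt := inr _ _ vwr t01; rewrite -XE in Xwt *; rewrite -/(X t) in Xt Ut.
    set rho := AA (X t + t *: w) (v + w) - AA (X t) (v + w) - DA (X t) (t *: w) (v + w).
    have rhoE : AA (X t + t *: w) (v + w) =
        AA (X t) v + AA (X t) w + (t *: DA (X t) w v + t *: DA (X t) w w) + rho.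
      rewrite /rho -AAD -scalerDr -DADr.
      have -> : t *: DA (X t) w (v + w) = DA (X t) (t *: w) (v + w).
        by rewrite scaler_sumr; apply: eq_bigr => i _; rewrite DZ// scalerA mulrC -scalerA.
      move: (AA _ _) (AA _ _) (DA _ _ _) => a b d.
      by apply/matrixP => i j; rewrite !mxE; ring.
    have -> : AA (X t) v *m (1%:M + t *: AA (X t) w) + (AA (X t) w + t *: DA (X t) v w)
        - (1%:M + t *: AA (X t) w) *m AA (X t + t *: w) (v + w) =
      - (t *: DA (X t) w w + t *: (AA (X t) w *m AA (X t) w) +
         t *: (t *: (AA (X t) w *m DA (X t) w (v + w))) + rho + t *: (AA (X t) w *m rho)).
      (* The terms of first order in [w] that do not cancel formally are [t] times the two sides of
         the flatness identity. Each remaining term is [rho] or contains [w] at least twice. *)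
      have fl := flatv v w Ut.
      rewrite rhoE DADr; move: (rho) => h.
      rewrite !(mulmxDl, mulmxDr, mul1mx, mulmx1) -!scalemxAr -!scalemxAl.
      move: fl.
      move: (AA (X t) v *m AA (X t) w) (AA (X t) w *m AA (X t) v) (AA (X t) w *m AA (X t) w).
      move: (AA (X t) w *m h) (AA (X t) w *m DA (X t) w v) (AA (X t) w *m DA (X t) w w).
      move: (DA (X t) v w) (DA (X t) w v) (DA (X t) w w) (AA (X t) v) (AA (X t) w).
      move=> m1 m2 m3 m4 m5 m6 m7 m8 m9 m10 m11 /matrixP fl.
      apply/matrixP => i j; have := fl i j; rewrite !mxE => {}fl.
      have -> : m9 i j = m10 i j + m2 i j - m1 i j by rewrite fl addrK.
      ring.
    rewrite normrN; have /andP[t0 t1] := t01.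
    have vw1 : `|v + w| <= 1 by rewrite (le_trans (ltW vwr)).
    have DE := HDA (X t) w w Xt; have AE := HA (X t) w Xt.
    have DE' := HDA (X t) w (v + w) Xt.
    have RE : `|rho| <= c * `|w| ^+ 2.
      apply: le_trans (Hrem _ (t *: w) (v + w) Xt Xwt) _.
      rewrite ler_wpM2l// -[leRHS]mulr1 ler_pM//.
      by rewrite normrZ exprMn ger0_norm// ler_piMl// exprn_ile1.
    have tle (M : 'M[R]_N) B : `|M| <= B -> `|t *: M| <= B.
      by move=> MB; rewrite normrZ ger0_norm// (le_trans _ MB)// ler_piMl.
    have mle (M : 'M[R]_N) B : `|M| <= B -> `|AA (X t) w *m M| <= N%:R * c * (`|w| * B).
      move=> MB; apply: le_trans (norm_mulmx _ _) _.
      have -> : N%:R * c * (`|w| * B) = N%:R * (c * `|w|) * B by ring.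
      by rewrite ler_pM ?mulr_ge0// ler_wpM2l.
    rewrite /E; apply: le_trans (ler_normD _ _) _; rewrite [leRHS]mulrDl; apply: lerD; last first.
      apply: tle; apply: le_trans (mle _ _ RE) _.
      have -> : N%:R * c * (`|w| * (c * `|w| ^+ 2)) = (N%:R * c * c * `|w| ^+ 2) * `|w| by ring.
      by rewrite ler_piMr// !mulr_ge0.
    apply: le_trans (ler_normD _ _) _; rewrite [leRHS]mulrDl; apply: lerD; last first.
      exact: RE.
    apply: le_trans (ler_normD _ _) _; rewrite [leRHS]mulrDl; apply: lerD; last first.
      apply/tle/tle; apply: le_trans (mle _ (c * (`|w| * 1)) _) _; last by rewrite le_eqVlt; apply/orP; left; apply/eqP; ring.
      by apply: le_trans DE' _; rewrite ler_wpM2l// ler_wpM2l.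
    apply: le_trans (ler_normD _ _) _; rewrite [leRHS]mulrDl; apply: lerD; last first.
      by apply: tle; apply: le_trans (mle _ _ AE) _; rewrite expr2; rewrite le_eqVlt; apply/orP; left; apply/eqP; ring.
    by apply: tle; apply: le_trans DE _; rewrite expr2.
  have E0 : 0 <= E by rewrite mulr_ge0// !addr_ge0// !mulr_ge0.
  have dbound : `|q 1 - Z 1| <= 2 * (N%:R * (2 * `|F0|) * E).
    apply: (@gronwall_half _ _ (fun t => q t - Z t)
      (fun t => dq t - Z t *m AA (x0 + t *: (v + w)) (v + w))); last by rewrite ler01 lexx.
    - by move=> t t01; apply: is_deriveB; [exact: Dq|exact: DZw].
    - by rewrite /q scale0r addr0 mulmx1 Y0 /Z Z0 subrr.
    move=> t t01; have dE : dq t - Z t *m AA (x0 + t *: (v + w)) (v + w) =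
        (q t - Z t) *m AA (x0 + t *: (v + w)) (v + w) +
        Y v t *m (AA (X t) v *m (1%:M + t *: AA (X t) w) + (AA (X t) w + t *: DA (X t) v w)
        - (1%:M + t *: AA (X t) w) *m AA (x0 + t *: (v + w)) (v + w)).
      rewrite mulmxBl mulmxBr (mulmxDr (Y v t)) !mulmxA -/(q t) -/(dq t).
      by rewrite [RHS]addrC addrA subrK.
    rewrite dE (le_trans (ler_normD _ _))// lerD//; first exact: half.
    apply: le_trans (norm_mulmx _ _) _; rewrite ler_pM ?mulr_ge0//; last exact: Ebound.
    by rewrite ler_wpM2l// Ybound.
  have -> : F (x + w) - F x - F x *m AA x w = - (q 1 - Z 1).
    rewrite /F /q /Z /X scale1r (_ : x + w - x0 = v + w); last by rewrite vE addrAC.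
    rewrite -vE scale1r mulmxDr mulmx1 (_ : x0 + v = x); last by rewrite vE addrC subrK.
    by rewrite opprB opprD addrA.
  by rewrite normrN; apply: le_trans dbound _; rewrite /E /KK !mulrA.
by split => // u; rewrite deriveE// FE -[LHS]/(mulmxr J u) -JE.
Qed.

End linear_frobenius.

(** * The inverse function theorem *)

Section inverse_function.
Context {R : realType}.

(** Bootstrap on the coordinates of [F]: the system expresses their derivatives linearly in the
    coordinates themselves, with smooth coefficients. *)
Lemma total_system_smooth n N (B : set 'rV[R]_n) (F : 'rV[R]_n -> 'rV[R]_N)
    (A : 'I_n -> 'rV[R]_n -> 'M[R]_N) : open B ->
  (forall i k l, smooth_on B (fun x => A i x k l : R^o)) ->
  (forall x, B x -> differentiable F x /\
     forall v, 'D_v F x = F x *m \sum_i v 0 i *: A i x) ->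
  smooth_on B F.
Proof.
move=> oB sA HF; apply/(smooth_on_rVP oB) => k.
pose S : set ('rV[R]_n -> R^o) := [set h | exists k, h = fun x => F x 0 k : R^o].
apply: (@smooth_bootstrap _ _ _ oB S); last by apply: generated_base; exists k.
move=> _ [{}k ->]; split => [x Bx|v].
  exact: (@differentiable_comp _ _ _ _ F (fun N : 'rV[R]_N => N 0 k : R^o) x
    (HF x Bx).1 (differentiable_coord (F x) 0 k)).
apply: (generated_eq (f := fun x => \sum_l F x 0 l * \sum_i v 0 i * A i x l k)).
  apply: generated_sum => l _; apply: generatedM; first by apply: generated_base; exists l.
  apply: generated_sum => i _; apply: generatedM; apply: generated_smooth; last exact: sA.
  exact: smooth_on_cst.
move=> x Bx; rewrite -derive_rV; last exact: (HF x Bx).1.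
rewrite (HF x Bx).2 mxE; apply: eq_bigr => l _; congr (_ * _).
by rewrite summxE; apply: eq_bigr => i _; rewrite mxE.
Qed.

Lemma differentiable_remainder (V W : normedModType R) (f : V -> W) x (e : R) :
  differentiable f x -> 0 < e ->
  \forall w \near 0, `|f (x + w) - f x - 'd f x w| <= e * `|w|.
Proof.
move=> df e0; have /diff_locally/eqaddoP/(_ e e0) := df.
apply: filterS => w.
suff -> : (f \o shift x - (cst (f x) + 'd f x)) w = f (x + w) - f x - 'd f x w by [].
by rewrite -[LHS]/(f (w + x) - (f x + 'd f x w)) opprD addrA [w + x]addrC.
Qed.

(** Rows are indexed by the direction of differentiation, so that the matrix acts on row vectors
    from the right: it is the transpose of the usual Jacobian. *)
Definition jacobian_mx n (u : 'rV[R]_n -> 'rV[R]_n) x : 'M[R]_n :=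
  \matrix_(i, j) 'D_(delta_mx 0 i) u x 0 j.

Lemma derive_jacobian_mx n (u : 'rV[R]_n -> 'rV[R]_n) x v :
  differentiable u x -> 'D_v u x = v *m jacobian_mx u x.
Proof.
move=> du; rewrite derive_sum_delta//; apply/rowP => j; rewrite summxE mxE.
by apply: eq_bigr => i _; rewrite !mxE.
Qed.

Section near_identity.
Variables (n : nat) (B : set 'rV[R]_n) (u : 'rV[R]_n -> 'rV[R]_n).
Hypotheses (oB : open B) (su : smooth_on B u).
Hypothesis convexB : forall x y (t : R), B x -> B y -> 0 <= t <= 1 -> B (x + t *: (y - x)).
Hypothesis near_id : forall x w, B x -> `|'D_w u x - w| <= 2^-1 * `|w|.

Let du x : B x -> differentiable u x.
Proof. exact: smooth_on_diff. Qed.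

(** Mean value inequality for [u - id], whose derivative is at most 1/2 along the segment supplied
    by convexity. *)
Lemma near_identity_lipschitz x y : B x -> B y ->
  `|u y - u x - (y - x)| <= 2^-1 * `|y - x|.
Proof.
move=> Bx By; pose g z := u z - z.
have Dg z w : B z -> differentiable g z /\ 'D_w g z = 'D_w u z - w.
  move=> Bz; have di : differentiable (@id 'rV[R]_n) z by exact: ex_diff.
  split; first by apply: differentiableB => //; exact: du.
  by rewrite deriveB ?derive_id//; apply: diff_derivable => //; exact: du.
have := @mvt_segment_rV _ _ _ g x (y - x) (2^-1 * `|y - x|).
rewrite [x + _]addrC subrK.
have -> : g y - g x = u y - u x - (y - x).
  by rewrite /g; apply/rowP => j; rewrite !mxE; ring.
apply => t t01; have Bt := convexB Bx By t01; first exact: (Dg _ 0 Bt).1.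
by rewrite (Dg _ _ Bt).2; exact: near_id.
Qed.

Lemma near_identity_expand x y : B x -> B y -> `|y - x| <= 2 * `|u y - u x|.
Proof.
move=> Bx By; have H := near_identity_lipschitz Bx By.
have : `|y - x| <= `|u y - u x| + `|u y - u x - (y - x)|.
  have {1}-> : y - x = (u y - u x) - (u y - u x - (y - x)) by rewrite subKr.
  exact: ler_normB.
by move: H; move: `|y - x| `|u y - u x| => a b; lra.
Qed.

(** Instead of an iteration, [|u x - z|] is minimized on a compact ball. Moving the minimizer by the
    residual [e = z - u x] at least halves the residual, so minimality forces it to vanish. *)
Lemma near_identity_open (O : set 'rV[R]_n) : open O -> O `<=` B -> open (u @` O).
Proof.
move=> oO OB; rewrite openE => _ [x1 Ox1 <-].
have [r r0 Hr] := @near_dist R 'rV[R]_n O x1 (open_nbhs_nbhs (conj oO Ox1)).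
pose rho := r / 2; have rho0 : 0 < rho by rewrite divr_gt0.
have KO x : `|x - x1| <= rho -> O x.
  by move=> xr; apply: Hr; apply: le_lt_trans xr _; rewrite ltr_pdivrMr// ltr_pMr// ltr1n.
(* The residual at [x1], hence at the minimizer, is below [rho / 8]. The two images are then less
   than [rho / 4] apart, the points at most [rho / 2], and [rho / 2 + rho / 8 < rho] keeps the moved
   point in the ball. *)
apply/nbhs_ballP; exists (rho / 8) => /=; first by rewrite divr_gt0.
move=> z; rewrite -ball_normE /= => z1.
pose K := [set x | `|x1 - x| <= rho].
have cK : compact K.
  apply: bounded_closed_compact; last exact: closed_closed_ball_.
  exists (rho + `|x1|); split; first exact: num_real.
  move=> M HM x /= xr; apply: le_trans (ltW HM).
  by rewrite -(subrK x1 x) (le_trans (ler_normD _ _))// lerD2r distrC.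
have K0 : K !=set0 by exists x1; rewrite /K /= subrr normr0 ltW.
have {}KO x : K x -> O x by rewrite /K /= distrC; exact: KO.
have cphi : {within K, continuous (fun x => `|u x - z|)}.
  apply: continuous_in_subspaceT => x; rewrite inE => /KO/OB Bx.
  apply: (@continuous_comp _ _ _ (fun x => u x - z) (fun y : 'rV[R]_n => `|y|)); last exact: norm_continuous.
  apply: (@continuousB _ _ _ u (cst z)); last exact: cst_continuous.
  exact: smooth_on_continuous su Bx.
have [x /set_mem Kx Hx] := compact_EVT_min K0 cK cphi.
have B1 := OB _ Ox1; have Bx := OB _ (KO _ Kx).
exists x; first exact: KO.
have K1 : K x1 by rewrite /K /= subrr normr0 ltW.
have xz : `|u x - z| < rho / 8 by apply: le_lt_trans (Hx x1 (mem_set K1)) _.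
have x1x : `|x1 - x| <= rho / 2.
  have := near_identity_expand Bx B1; have : `|u x1 - u x| <= `|u x1 - z| + `|u x - z|.
    by rewrite -(subrKA z) (le_trans (ler_normD _ _))// lerD2l distrC.
  move: xz z1; move: `|u x - z| `|u x1 - z| `|u x1 - u x| `|x1 - x| => a b c d; lra.
pose e := z - u x.
have eE : `|e| = `|u x - z| by rewrite distrC.
have Ky : K (x + e).
  rewrite /K /= opprD addrA (le_trans (ler_normB _ _))// eE.
  by move: xz x1x; move: `|u x - z| `|x1 - x| => a b; lra.
have := Hx _ (mem_set Ky); have By := OB _ (KO _ Ky).
have := near_identity_lipschitz Bx By.
have -> : x + e - x = e by rewrite addrC addKr.
have -> : u (x + e) - u x - e = u (x + e) - z by rewrite /e opprB addrA subrK.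
rewrite eE => ab ba; apply/eqP; rewrite -subr_eq0 -normr_le0.
by move: ab ba; move: `|u x - z| `|u (x + e) - z| => a b; lra.
Qed.

(** A row [w] in the kernel satisfies [|w| <= |w| / 2]. *)
Lemma near_identity_unitmx x : B x -> jacobian_mx u x \in unitmx.
Proof.
move=> Bx; rewrite -row_free_unit -kermx_eq0; apply/eqP/row_matrixP => i.
rewrite row0; set w := row i _.
have := near_id w Bx; rewrite derive_jacobian_mx; last exact: du.
rewrite /w -row_mul mulmx_ker row0 sub0r normrN -/w => H.
by apply/eqP; rewrite -normr_le0; move: H; move: `|w| => a; lra.
Qed.

(** The derivative of [psi] is the inverse Jacobian taken at [psi]. Hence all [g \o psi] with [g]
    smooth form a family whose derivatives are polynomial in the family, which is what the bootstrap
    asks for. *)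
Lemma near_identity_inverse : exists psi : 'rV[R]_n -> 'rV[R]_n,
  (forall x, B x -> psi (u x) = x) /\ smooth_on (u @` B) psi.
Proof.
have /choice[psi Hpsi] : forall z, exists x, (u @` B) z -> B x /\ u x = z.
  move=> z; have [[x Bx xz]|nz] := pselect ((u @` B) z); first by exists x.
  by exists 0.
have psiK x : B x -> psi (u x) = x.
  move=> Bx; have [|By uy] := Hpsi (u x); first by exists x.
  apply/eqP; rewrite -subr_eq0 -normr_le0.
  by have := near_identity_expand Bx By; rewrite uy subrr normr0 mulr0.
exists psi; split => //.
have ouB : open (u @` B) by exact: near_identity_open.
have Dpsi z : (u @` B) z -> differentiable psi z /\
    forall v, 'D_v psi z = v *m invmx (jacobian_mx u (psi z)).
  move=> [x Bx <-]; rewrite (psiK x Bx).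
  have uJ := near_identity_unitmx Bx; set Ji := invmx _.
  have [|dpsi psiE] := @differentiable_estimate R _ _ psi (mulmxr Ji) (u x) (@mulmxr_continuous _ _ _ Ji); last first.
    by split => // v; rewrite deriveE// psiE.
  move=> e e0.
  (* The remainder of [u] is at most [e / C * |k|] with [|k| <= 2 |h|], and multiplication by [Ji]
     costs [n * |Ji|]; the total is then at most [e * |h|]. *)
  pose C := 2 * (n%:R * `|Ji|) + 1.
  have C0 : 0 < C by rewrite ltr_wpDl// !mulr_ge0.
  have [d d0 Hd] := @near_dist R 'rV[R]_n _ 0 (differentiable_remainder (du Bx) (divr_gt0 e0 C0)).
  have nB : \forall h \near (0 : 'rV[R]_n), (u @` B) (u x + h).
    have H : \forall z \near u x, (u @` B) z by apply: open_nbhs_nbhs; split => //; exists x.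
    rewrite (near_shift 0) in H; apply: filterS H => h; by rewrite /= subr0 addrC.
  have nd : \forall h \near (0 : 'rV[R]_n), `|h| < d / 2 by apply: nbhs0_lt; exact: divr_gt0.
  apply: filterS2 nB nd => h Bh hd.
  have [By uy] := Hpsi _ Bh; rewrite (psiK x Bx).
  set k := psi (u x + h) - x.
  have xk : x + k = psi (u x + h) by rewrite addrC subrK.
  have kh : `|k| <= 2 * `|h|.
    by have := near_identity_expand Bx By; rewrite -/k uy (addrC (u x)) addrK.
  have := Hd k; rewrite subr0 xk uy [u x + h]addrC addrK -deriveE; last exact: du.
  rewrite derive_jacobian_mx; last exact: du.
  move=> H; have {}H : `|h - k *m jacobian_mx u x| <= e / C * `|k|.
    apply: H; apply: le_lt_trans kh _; move: hd; move: `|h| => a; lra.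
  rewrite -[X in `|X| <= _]/(k - h *m Ji).
  have -> : k - h *m Ji = - ((h - k *m jacobian_mx u x) *m Ji).
    by rewrite mulmxBl mulmxK// opprB.
  rewrite normrN; apply: le_trans (norm_mulmx _ _) _.
  apply: (@le_trans _ _ (n%:R * (e / C * (2 * `|h|)) * `|Ji|)).
    rewrite ler_wpM2r// ler_wpM2l//; apply: le_trans H _.
    by rewrite ler_wpM2l// ltW// divr_gt0.
  have -> : n%:R * (e / C * (2 * `|h|)) * `|Ji| = e * `|h| * ((2 * (n%:R * `|Ji|)) / C) by ring.
  rewrite ler_piMr// ?mulr_ge0// ?(ltW e0)//.
  by rewrite ler_pdivrMr// mul1r /C lerDl.
apply/(smooth_on_rVP ouB) => j.
pose S : set ('rV[R]_n -> R^o) := [set h | exists2 g : 'rV[R]_n -> R^o, smooth_on B g & h = g \o psi].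
have Bpsi z : (u @` B) z -> B (psi z) by move=> /Hpsi[].
apply: (@smooth_bootstrap _ _ _ ouB S); last first.
  apply: generated_base; exists (fun x => x 0 j) => //.
  exact: (smooth_on_rVP oB _).1 (@smooth_on_id _ _ B) j.
move=> _ [g sg ->].
have dg z : (u @` B) z -> differentiable g (psi z) by move=> /Bpsi; exact: smooth_on_diff.
split => [z Bz|v].
  by apply: differentiable_comp; [exact: (Dpsi z Bz).1|exact: dg].
have sJ : forall i k, smooth_on B (fun x => invmx (jacobian_mx u x) i k : R^o).
  apply: (smooth_on_invmx oB); last exact: near_identity_unitmx.
  move=> i k; have := (smooth_on_rVP oB _).1 (smooth_on_derive (delta_mx 0 i) su) k.
  by apply: smooth_on_eq => // x _; rewrite mxE.
apply: (generated_eq (f := fun z => \sum_k (\sum_i v 0 i * invmx (jacobian_mx u (psi z)) i k) *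
    'D_(delta_mx 0 k) g (psi z))).
  apply: generated_sum => k _; apply: generatedM; last first.
    by apply: generated_base; exists ('D_(delta_mx 0 k) g) => //; exact: smooth_on_derive.
  apply: generated_sum => i _; apply: generatedM.
    by apply: generated_smooth; exact: smooth_on_cst.
  by apply: generated_base; exists (fun x => invmx (jacobian_mx u x) i k).
move=> z Bz; have [d1 d2] := Dpsi z Bz.
rewrite (derive_comp v d1 (dg z Bz)) [RHS]derive_sum_delta; last exact: dg.
by apply: eq_bigr => k _; rewrite d2 mxE.
Qed.

End near_identity.

(** The derivative at [x0] is normalized to the identity, as it is for the flat coordinates built
    later. Openness is stated for images of all open subsets of [B], since the overlaps of a new
    chart with old ones are such images. *)
Theorem inverse_function n (U : set 'rV[R]_n) (u : 'rV[R]_n -> 'rV[R]_n) x0 :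
  open U -> U x0 -> smooth_on U u -> (forall v, 'D_v u x0 = v) ->
  exists B : set 'rV[R]_n, [/\ open B, B x0, B `<=` U,
    (forall O : set 'rV[R]_n, open O -> O `<=` B -> open (u @` O)) &
    exists psi : 'rV[R]_n -> 'rV[R]_n,
      (forall x, B x -> psi (u x) = x) /\ smooth_on (u @` B) psi].
Proof.
move=> oU Ux0 su u0.
(* Jacobian entries within [1 / C] of those of the identity change [w] by at most [n / C * |w|],
   which is at most [|w| / 2]. *)
pose C : R := 2 * n%:R + 1; have C0 : 0 < C by rewrite ltr_wpDl// mulr_ge0.
have ci (i j : 'I_n) : {for x0, continuous (fun x => jacobian_mx u x i j : R^o)}.
  have sij : smooth_on U (fun x => jacobian_mx u x i j : R^o).
    have := (smooth_on_rVP oU _).1 (smooth_on_derive (delta_mx 0 i) su) j.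
    by apply: smooth_on_eq => // x _; rewrite mxE.
  exact: smooth_on_continuous sij Ux0.
pose close (ij : 'I_n * 'I_n) x : Prop := `|(jacobian_mx u x ij.1 ij.2 : R^o) - jacobian_mx u x0 ij.1 ij.2| < C^-1.
have near_c : \forall x \near x0, forall ij, close ij x.
  have H ij : \forall x \near x0, close ij x.
    by have := continuous_near_dist (ci ij.1 ij.2); apply; rewrite invr_gt0.
  exact: (@filter_forall _ _ close (nbhs x0) _ H).
have [r r0 Hr] := @near_dist R 'rV[R]_n _ x0 (filterI (open_nbhs_nbhs (conj oU Ux0)) near_c).
pose B := ball x0 r.
have Bx x : B x <-> `|x - x0| < r by rewrite /B -ball_normE /= distrC.
have BU : B `<=` U by move=> x /Bx/Hr[].
have oB : open B by exact: ball_open.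
have suB : smooth_on B u by exact: smooth_onS BU su.
have cvxB x y (t : R) : B x -> B y -> 0 <= t <= 1 -> B (x + t *: (y - x)).
  move=> /Bx xr /Bx yr /andP[t0 t1]; apply/Bx.
  have -> : x + t *: (y - x) - x0 = (1 - t) *: (x - x0) + t *: (y - x0).
    by apply/rowP => j; rewrite !mxE; ring.
  rewrite (le_lt_trans (ler_normD _ _))// !normrZ [`|t|]ger0_norm// ger0_norm ?subr_ge0//.
  have [->|tN1] := eqVneq t 1; first by rewrite subrr mul0r add0r mul1r.
  have t1' : 0 < 1 - t by rewrite subr_gt0 lt_neqAle tN1.
  have a := xr; rewrite -(ltr_pM2l t1') in a.
  by have b := ler_wpM2l t0 (ltW yr); lra.
have dux x : U x -> differentiable u x by exact: smooth_on_diff.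
have J0 : jacobian_mx u x0 = 1%:M.
  apply/row_matrixP => i; rewrite !rowE -derive_jacobian_mx ?u0 ?mulmx1//; exact: dux.
have nid x w : B x -> `|'D_w u x - w| <= 2^-1 * `|w|.
  move=> /Bx/Hr[Ux HJ]; rewrite derive_jacobian_mx; last exact: dux.
  rewrite -{2}(mulmx1 w) -mulmxBr -J0; apply: le_trans (norm_mulmx _ _) _.
  have HJ' : `|jacobian_mx u x - jacobian_mx u x0| <= C^-1.
    apply: norm_mx_le => [|i j]; first by rewrite invr_ge0 ltW.
    by have := HJ (i, j); rewrite /close /= => /ltW; rewrite !mxE.
  rewrite mulrAC ler_wpM2r//; apply: le_trans (ler_wpM2l _ HJ') _ => //.
  by rewrite ler_pdivrMr// /C; lra.
exists B; split => //; first exact/ballxx.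
  move=> O oO OB; exact: (near_identity_open suB cvxB nid oO OB).
exact: (near_identity_inverse oB suB cvxB nid).
Qed.

End inverse_function.

(** * Calculus in charts of a manifold *)

Section derivative_lemmas.
Context {R : realType}.

Lemma open_preimage_smooth (V W : normedModType R) (A : set V) (B : set W) (f : V -> W) :
  open A -> open B -> smooth_on A f -> open (A `&` f @^-1` B).
Proof.
move=> oA oB sf; rewrite openE => x [Ax Bfx]; apply: filterI.
  exact: open_nbhs_nbhs.
by apply: (smooth_on_continuous sf Ax); exact: open_nbhs_nbhs.
Qed.

Lemma smooth_on_derive_along n (V : normedModType R) (A : set V) (B : set 'rV[R]_n)
    k (f : V -> 'rV[R]_n) (Y : V -> 'rV[R]_n) (tau : 'rV[R]_n -> 'rV[R]_k) :
  open A -> open B -> (forall x, A x -> B (f x)) -> smooth_on A f -> smooth_on A Y ->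
  smooth_on B tau -> smooth_on A (fun x => 'D_(Y x) tau (f x)).
Proof.
move=> oA oB AB sf sY st; apply/(smooth_on_rVP oA) => j.
apply: (smooth_on_eq oA (f := fun x => \sum_i Y x 0 i * 'D_(delta_mx 0 i) tau (f x) 0 j)).
  move=> x Ax; rewrite derive_sum_delta; last exact: smooth_on_diff st (AB x Ax).
  by rewrite summxE; apply: eq_bigr => i _; rewrite mxE.
apply: smooth_on_bigsum => // i _; apply: smooth_onM => //.
  exact: (smooth_on_rVP oA _).1 sY i.
have := smooth_on_comp oA oB AB sf (smooth_on_derive (delta_mx 0 i) st).
by move=> /(smooth_on_rVP oA)/(_ j).
Qed.

(** Product rule for a derivative whose direction and base point both vary. It lies behind the
    change of chart for brackets and for tangent vectors of the tangent bundle. *)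
Lemma derive_derive_comp (V : normedModType R) n k (A : set V) (U : set 'rV[R]_n)
    (f Y : V -> 'rV[R]_n) (tau : 'rV[R]_n -> 'rV[R]_k) x u :
  open A -> open U -> A x -> (forall x, A x -> U (f x)) ->
  smooth_on A f -> smooth_on A Y -> smooth_on U tau ->
  'D_u (fun y => 'D_(Y y) tau (f y)) x =
  'D_('D_u Y x) tau (f x) + 'D_('D_u f x) ('D_(Y x) tau) (f x).
Proof.
move=> oA oU Ax AU sf sY st; apply/rowP => j; rewrite [RHS]mxE.
have sYt := smooth_on_derive_along oA oU AU sf sY st.
have dt y : U y -> differentiable tau y by exact: smooth_on_diff.
have sD v := smooth_on_derive v st.
apply: (etrans (derive_rV u j (smooth_on_diff sYt Ax))).
pose y i (z : V) : R := Y z 0 i.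
pose d i (z : 'rV[R]_n) : R := 'D_(delta_mx 0 i) tau z 0 j.
have sy i : smooth_on A (y i : _ -> R^o) by exact: (smooth_on_rVP oA _).1 sY i.
have sd i : smooth_on U (d i : _ -> R^o) by exact: (smooth_on_rVP oU _).1 (sD _) j.
have sdf i : smooth_on A ((d i : _ -> R^o) \o f) by exact: smooth_on_comp_scalar oA AU sf (sd i).
have E z : A z -> 'D_(Y z) tau (f z) 0 j =
    (\sum_i ((y i : _ -> R^o) * ((d i : _ -> R^o) \o f)) : _ -> R^o) z.
  move=> Az; rewrite derive_sum_delta; last exact: dt (AU z Az).
  by rewrite summxE fct_sumE; apply: eq_bigr => i _; rewrite mxE.
have dy i : derivable (y i : _ -> R^o) x u by exact: smooth_on_derivable (sy i) Ax.
have dd i : derivable ((d i : _ -> R^o) \o f) x u by exact: smooth_on_derivable (sdf i) Ax.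
have Dc i : 'D_u ((d i : _ -> R^o) \o f) x = 'D_('D_u f x) (d i : _ -> R^o) (f x).
  have df := smooth_on_diff sf Ax; have ddi := smooth_on_diff (sd i) (AU x Ax).
  exact: (derive_comp u df ddi).
rewrite (derive_eq_on oA u E Ax) derive_sum; last by move=> i; exact: derivableM.
under eq_bigr => i _ do rewrite (deriveM (dy i) (dd i)).
rewrite big_split /= addrC; congr (_ + _).
  rewrite derive_sum_delta; last exact: dt (AU x Ax).
  rewrite summxE; apply: eq_bigr => i _; rewrite mxE.
  by rewrite (derive_rV u i (smooth_on_diff sY Ax)); exact: mulrC.
apply/esym; apply: (etrans (derive_rV _ j (smooth_on_diff (sD _) (AU x Ax)))).
have E' z : U z -> 'D_(Y x) tau z 0 j = (\sum_i (y i x *: (d i : _ -> R^o))) z.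
  move=> Uz; rewrite derive_sum_delta; last exact: dt.
  by rewrite summxE fct_sumE; apply: eq_bigr => i _; rewrite mxE.
rewrite (derive_eq_on oU _ E' (AU x Ax)) derive_sum; last first.
  by move=> i; apply: derivableZ; exact: smooth_on_derivable (sd i) (AU x Ax).
apply: eq_bigr => i _; rewrite deriveZ; last exact: smooth_on_derivable (sd i) (AU x Ax).
by rewrite Dc.
Qed.

Lemma derive_derive_along n k (U : set 'rV[R]_n) (Y : 'rV[R]_n -> 'rV[R]_n)
    (tau : 'rV[R]_n -> 'rV[R]_k) x u : open U -> U x ->
  smooth_on U Y -> smooth_on U tau ->
  'D_u (fun y => 'D_(Y y) tau y) x = 'D_('D_u Y x) tau x + 'D_u ('D_(Y x) tau) x.
Proof.
move=> oU Ux sY st.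
have := derive_derive_comp u oU oU Ux (fun x => id) (@smooth_on_id _ _ U) sY st.
by rewrite derive_id.
Qed.

End derivative_lemmas.

Section manifold.
Context {R : realType} {n : nat} {M : smooth_structure R n}.
Implicit Types (p : M) (c : chart R n M) (W : set M).

(** [is_chart] tests only against the atlas. Near each point of the overlap the transition map
    factors through an atlas chart, and openness and smoothness are local. *)
Lemma is_chart_compat c c' : is_chart c -> is_chart c' -> smooth_compat c c'.
Proof.
move=> hc hc'.
have loc x : overlap c c' x -> exists V : set 'rV[R]_n, [/\ open V, V x, V `<=` overlap c c' &
    smooth_on V (transition c c')].
  move=> [p [cp c'p] <-]; set a := chart_at p.
  have ap : cdom a p := chart_at_dom p.
  have [oca sca] := (hc a (chart_at_atlas p)).1.
  have [oac sac] := (hc' a (chart_at_atlas p)).2.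
  pose V := overlap c a `&` transition c a @^-1` overlap a c'.
  have oV : open V by exact: open_preimage_smooth.
  have VE y : V y -> overlap c c' y /\ (transition a c' \o transition c a) y = transition c c' y.
    move=> [[q [cq aq] <-]]; rewrite /transition /= (cmapK cq).
    move=> [r [ar c'r] rq]; have {}rq : r = q by rewrite -(cmapK ar) rq cmapK.
    by rewrite (cmapK aq); split => //; exists q => //; split => //; rewrite -rq.
  exists V; split => //.
  - split; first by exists p.
    by rewrite /transition/= cmapK//; exists p.
  - by move=> y /VE[].
  - apply: (smooth_on_eq oV (f := transition a c' \o transition c a)) => [y /VE[]//|].
    by apply: (smooth_on_comp oV oac _ (smooth_onS _ sca) sac) => y [].
split.
  rewrite openE => x /loc[V [oV Vx VS _]].
  by apply: filterS VS _; exact: open_nbhs_nbhs.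
by apply: smooth_on_local => x /loc[V [? ? ? ?]]; exists V.
Qed.

Lemma open_manifoldE W : open W = manifold_open W.
Proof. by []. Qed.

Lemma open_chart_image c W : is_chart c -> open W -> open (c @` (W `&` cdom c)).
Proof.
move=> hc oW; rewrite openE => _ [p [Wp cp] <-]; set a := chart_at p.
have ap : cdom a p := chart_at_dom p.
have [oca sca] := (hc a (chart_at_atlas p)).1.
have oaW : open (a @` (W `&` cdom a)) by exact: oW (chart_at_atlas p).
have oV := open_preimage_smooth oca oaW sca.
have VS : overlap c a `&` transition c a @^-1` (a @` (W `&` cdom a)) `<=` c @` (W `&` cdom c).
  move=> _ [[q [cq aq] <-]]; rewrite /transition /= (cmapK cq) => -[r [Wr ar] rq].
  have {}rq : r = q by rewrite -(cmapK ar) rq cmapK.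
  by exists q => //; split => //; rewrite -rq.
apply: filterS VS _; apply: open_nbhs_nbhs; split => //.
split; first by exists p.
by rewrite /transition/= cmapK//; exists p.
Qed.

Lemma open_cdom c : is_chart c -> open (cdom c).
Proof.
move=> hc; rewrite open_manifoldE => a aa.
by have [oac _] := (hc a aa).2; rewrite setIC.
Qed.

Lemma tangent_change p (v : tangent p) c c' : is_chart c -> cdom c p ->
  is_chart c' -> cdom c' p -> v c' = 'D_(v c) (transition c c') (c p).
Proof.
move=> hc cp hc' c'p; have /asboolP[v1 _] := tcompP v.
by rewrite (v1 c hc cp c' hc' c'p) deriveE//; exact: chart_transition_diff.
Qed.

Lemma vcomp_change (X : vfield M) c c' x : is_chart c -> is_chart c' ->
  overlap c c' x -> vcomp X c' (transition c c' x) = 'D_(vcomp X c x) (transition c c') x.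
Proof.
move=> hc hc' [p [cp c'p] <-]; rewrite /vcomp {1}/transition /= !cmapK//.
exact: tangent_change.
Qed.

Lemma overlap_transition c c' x : overlap c c' x -> overlap c' c (transition c c' x).
Proof. by move=> [p [cp c'p] <-]; rewrite /transition/= cmapK//; exists p. Qed.

Lemma transitionK c c' x : overlap c c' x -> transition c' c (transition c c' x) = x.
Proof. by move=> [p [cp c'p] <-]; rewrite /transition/= cmapK// cmapK. Qed.

Lemma smooth_vfieldS W W' (X : vfield M) : W' `<=` W -> smooth_vfield W X -> smooth_vfield W' X.
Proof.
by move=> WW sX c hc; apply: smooth_onS (sX c hc) => x [p [/WW Wp cp] <-]; exists p.
Qed.

(** On passing from [chart_at p] to [c], each of the two derivatives acquires a second derivative of
    the transition map; Schwarz's theorem makes these equal, so they drop out of the difference. *)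
Lemma bracket_chart W (X Y : vfield M) c p : open W -> W p ->
  smooth_vfield W X -> smooth_vfield W Y -> is_chart c -> cdom c p ->
  bracket X Y p c = 'D_(X p c) (vcomp Y c) (c p) - 'D_(Y p c) (vcomp X c) (c p).
Proof.
move=> oW Wp sX sY hc cp; pose a := chart_at p.
have ha : is_chart a := atlas_chart (chart_at_atlas p).
have ap : cdom a p := chart_at_dom p.
have [oac sac] := is_chart_compat ha hc.
pose V := overlap a c `&` (a @` (W `&` cdom a)).
have oV : open V by apply: openI => //; exact: open_chart_image.
have Vp : V (a p) by split; exists p.
have sVX : smooth_on V (vcomp X a) by apply: smooth_onS (sX a ha); exact: subIsetr.
have sVY : smooth_on V (vcomp Y a) by apply: smooth_onS (sY a ha); exact: subIsetr.
have sVt : smooth_on V (transition a c) by apply: smooth_onS sac; exact: subIsetl.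
have tp : transition a c (a p) = c p by rewrite /transition/= cmapK.
have dt : differentiable (transition a c) (a p) by apply: smooth_on_diff sac _; exact: Vp.1.
have key (Z T : vfield M) : smooth_vfield W Z -> smooth_vfield W T ->
    'D_(Z p c) (vcomp T c) (c p) = 'D_('D_(Z p a) (vcomp T a) (a p)) (transition a c) (a p) +
      'D_(Z p a) ('D_(T p a) (transition a c)) (a p).
  move=> sZ sT.
  have sVT : smooth_on V (vcomp T a) by apply: smooth_onS (sT a ha); exact: subIsetr.
  have -> : T p a = vcomp T a (a p) by rewrite /vcomp cmapK.
  rewrite -(derive_derive_along _ oV Vp sVT sVt).
  have E y : V y -> (vcomp T c \o transition a c) y = 'D_(vcomp T a y) (transition a c) y.
    by move=> [oy _]; exact: vcomp_change.
  have dT : differentiable (vcomp T c) (transition a c (a p)).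
    by rewrite tp; apply: smooth_on_diff (sT c hc) _; exists p.
  apply/esym; apply: (etrans (esym (derive_eq_on oV _ E Vp))).
  apply: (etrans (derive_comp _ dt dT)).
  by rewrite -(tangent_change (Z p) ha ap hc cp) tp.
have EX := deriveE (Y p a) (smooth_on_diff sVX Vp).
have EY := deriveE (X p a) (smooth_on_diff sVY Vp).
have Ba : bracket X Y p a = 'D_(X p a) (vcomp Y a) (a p) - 'D_(Y p a) (vcomp X a) (a p).
  by rewrite EX EY; exact: tvec_comp.
rewrite (tangent_change (bracket X Y p) ha ap hc cp) Ba (deriveBv _ _ dt).
rewrite (key X Y sX sY) (key Y X sY sX) (schwarz oV (X p a) (Y p a) sVt Vp).
have alg (b d s : 'rV[R]_n) : b - d = b + s - (d + s).
  by rewrite opprD addrACA subrr addr0.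
exact: alg.
Qed.

Lemma dfun_chart W (f : M -> R) c p (v : tangent p) : open W -> W p -> smooth_fun W f ->
  is_chart c -> cdom c p -> dfun f v = 'D_(v c) (f \o cinv c : _ -> R^o) (c p).
Proof.
move=> oW Wp sf hc cp; rewrite /dfun; set a := chart_at p.
have ha : is_chart a := atlas_chart (chart_at_atlas p).
have ap : cdom a p := chart_at_dom p.
have [oac sac] := is_chart_compat ha hc.
have oV : open (overlap a c `&` (a @` (W `&` cdom a))) by apply: openI => //; exact: open_chart_image.
have Vp : (overlap a c `&` (a @` (W `&` cdom a))) (a p) by split; exists p.
have tp : transition a c (a p) = c p by rewrite /transition/= cmapK.
have E y : (overlap a c `&` (a @` (W `&` cdom a))) y ->
    (f \o cinv a) y = ((f \o cinv c : _ -> R^o) \o transition a c) y.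
  by move=> [[q [aq cq] <-] _]; rewrite /transition /= !cmapK.
rewrite -deriveE; last by apply: smooth_on_diff (sf a ha) _; exists p.
rewrite (derive_eq_on oV _ E Vp) derive_comp ?tp -?(tangent_change v ha ap hc cp)//.
  by apply: smooth_on_diff sac _; exact: Vp.1.
by apply: smooth_on_diff (sf c hc) _; exists p.
Qed.

(** A single chart decides: components in any other chart arise by composing with a transition map
    and applying the derivative of its inverse. *)
Lemma smooth_vfield_chart W (X : vfield M) c : open W -> is_chart c -> W `<=` cdom c ->
  smooth_on (c @` W) (vcomp X c) -> smooth_vfield W X.
Proof.
move=> oW hc Wc sX c' hc'.
have [oc'c sc'c] := is_chart_compat hc' hc; have [occ' scc'] := is_chart_compat hc hc'.
have oA : open (c' @` (W `&` cdom c')) by exact: open_chart_image.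
have AO : c' @` (W `&` cdom c') `<=` overlap c' c.
  by move=> _ [p [Wp c'p] <-]; exists p => //; split => //; exact: Wc.
have sA := smooth_onS AO sc'c.
have oc : open (c @` W).
  by have := open_chart_image hc oW; rewrite (_ : W `&` cdom c = W)//; exact: setIidl.
have AB x : (c' @` (W `&` cdom c')) x -> overlap c c' (transition c' c x).
  by move=> /AO; exact: overlap_transition.
have AW x : (c' @` (W `&` cdom c')) x -> (c @` W) (transition c' c x).
  by move=> [p [Wp c'p] <-]; exists p => //; rewrite /transition /= cmapK.
apply: (smooth_on_eq oA (f := fun x => 'D_((vcomp X c \o transition c' c) x) (transition c c') (transition c' c x))).
  move=> x Ax; rewrite /= -vcomp_change//; last exact: AB.
  by rewrite transitionK//; exact: AO.
apply: (smooth_on_derive_along oA occ' AB sA _ scc').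
exact: (smooth_on_comp oA oc AW sA sX).
Qed.

Lemma smooth_fun_chart W (f : M -> R) c : open W -> is_chart c -> W `<=` cdom c ->
  smooth_on (c @` W) (f \o cinv c : _ -> R^o) -> smooth_fun W f.
Proof.
move=> oW hc Wc sf c' hc'.
have [oc'c sc'c] := is_chart_compat hc' hc.
have oA : open (c' @` (W `&` cdom c')) by exact: open_chart_image.
have AO : c' @` (W `&` cdom c') `<=` overlap c' c.
  by move=> _ [p [Wp c'p] <-]; exists p => //; split => //; exact: Wc.
have AW x : (c' @` (W `&` cdom c')) x -> (c @` W) (transition c' c x).
  by move=> [p [Wp c'p] <-]; exists p => //; rewrite /transition /= cmapK.
apply: (smooth_on_eq oA (f := (f \o cinv c : _ -> R^o) \o transition c' c)).
  move=> _ [p [Wp c'p] <-]; rewrite /transition /= !cmapK//; exact: Wc.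
exact: (smooth_on_comp_scalar oA AW (smooth_onS AO sc'c) sf).
Qed.

Lemma coord_vf_comp c i p : is_chart c -> cdom c p -> coord_vf c i p c = delta_mx 0 i.
Proof. by move=> hc cp; rewrite tvec_comp. Qed.

Lemma vcomp_coord_vf c i x : is_chart c -> (c @` cdom c) x -> vcomp (coord_vf c i) c x = delta_mx 0 i.
Proof. by move=> hc [p cp <-]; rewrite /vcomp cmapK// coord_vf_comp. Qed.

Lemma smooth_coord_vf c i : is_chart c -> smooth_vfield (cdom c) (coord_vf c i).
Proof.
move=> hc; apply: (smooth_vfield_chart (open_cdom hc) hc) => //.
apply: (smooth_on_eq (@cimg_open _ _ _ c) _ (smooth_on_cst (delta_mx 0 i : 'rV[R]_n))).
by move=> x cx; rewrite vcomp_coord_vf.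
Qed.

Lemma tcompD p (u v : tangent p) c : (u + v) c = u c + v c.
Proof. by []. Qed.

Lemma tcompB p (u v : tangent p) c : (u - v) c = u c - v c.
Proof. by []. Qed.

Lemma tcompZ p (a : R) (v : tangent p) c : (a *: v) c = a *: v c.
Proof. by []. Qed.

Lemma tcomp_sum (I : Type) (r : seq I) (P : pred I) p (v : I -> tangent p) c :
  (\sum_(i <- r | P i) v i) c = \sum_(i <- r | P i) v i c.
Proof. by elim/big_rec2: _ => // i a b _ <-. Qed.

Lemma tangent_sum_coord c p (v : tangent p) : is_chart c -> cdom c p ->
  v = \sum_i v c 0 i *: coord_vf c i p.
Proof.
move=> hc cp; apply: (tangent_eq hc cp); rewrite tcomp_sum [LHS]row_sum_delta.
by apply: eq_bigr => i _; rewrite tcompZ coord_vf_comp.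
Qed.

End manifold.

(** * Connections and affine charts *)

Section vfield_algebra.
Context {R : realType} {n : nat} {M : smooth_structure R n}.
Implicit Types (W : set M) (X Y : vfield M) (f : M -> R) (c : chart R n M).

Lemma smooth_vfield0 W : smooth_vfield W (fun p : M => 0 : tangent p).
Proof. by move=> c hc; exact: smooth_on_cst. Qed.

Lemma smooth_vfieldD W X Y : open W -> smooth_vfield W X -> smooth_vfield W Y ->
  smooth_vfield W (fun p => X p + Y p).
Proof.
move=> oW sX sY c hc; have oA := open_chart_image hc oW.
exact: (smooth_onD oA (sX c hc) (sY c hc)).
Qed.

Lemma smooth_vfieldZ W f X : open W -> smooth_fun W f -> smooth_vfield W X ->
  smooth_vfield W (fun p => f p *: X p).
Proof.
move=> oW sf sX c hc; have oA := open_chart_image hc oW.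
apply/(smooth_on_rVP oA) => j.
apply: (smooth_on_eq oA _ (smooth_onM oA (sf c hc) ((smooth_on_rVP oA _).1 (sX c hc) j))).
move=> x _; have -> : vcomp (fun p => f p *: X p) c x = f (cinv c x) *: vcomp X c x by [].
by rewrite mxE.
Qed.

Lemma smooth_vfield_sum W (I : Type) (r : seq I) (X : I -> vfield M) : open W ->
  (forall i, smooth_vfield W (X i)) -> smooth_vfield W (fun p => \sum_(i <- r) X i p).
Proof.
move=> oW sX; elim: r => [|i r ih].
  have -> : (fun p : M => \sum_(i <- [::]) X i p) = (fun p : M => 0 : tangent p).
    by apply: functional_extensionality_dep => p; rewrite big_nil.
  exact: smooth_vfield0.
have -> : (fun p : M => \sum_(i <- i :: r) X i p) = (fun p : M => X i p + \sum_(i <- r) X i p).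
  by apply: functional_extensionality_dep => p; rewrite big_cons.
exact: smooth_vfieldD.
Qed.

Lemma smooth_fun_coord W X c i : open W -> is_chart c -> W `<=` cdom c ->
  smooth_vfield W X -> smooth_fun W (fun p => X p c 0 i).
Proof.
move=> oW hc Wc sX; apply: (smooth_fun_chart oW hc Wc).
have oA : open (c @` W).
  by have := open_chart_image hc oW; rewrite (_ : W `&` cdom c = W)//; exact: setIidl.
have sXc : smooth_on (c @` W) (vcomp X c).
  by apply: smooth_onS (sX c hc) => x [p Wp <-]; exists p => //; split => //; exact: Wc.
exact: (smooth_on_rVP oA _).1 sXc i.
Qed.

Definition const_vf c (v : 'rV[R]_n) : vfield M := fun p => tvec c p v.

Lemma vcomp_const_vf c v x : is_chart c -> (c @` cdom c) x -> vcomp (const_vf c v) c x = v.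
Proof. by move=> hc [p cp <-]; rewrite /vcomp cmapK// /const_vf tvec_comp. Qed.

Lemma smooth_const_vf c v : is_chart c -> smooth_vfield (cdom c) (const_vf c v).
Proof.
move=> hc; apply: (smooth_vfield_chart (open_cdom hc) hc) => //.
apply: (smooth_on_eq (@cimg_open _ _ _ c) _ (smooth_on_cst v)).
by move=> x cx; rewrite vcomp_const_vf.
Qed.

Lemma smooth_bracket W X Y : open W -> smooth_vfield W X -> smooth_vfield W Y ->
  smooth_vfield W (bracket X Y).
Proof.
move=> oW sX sY c hc; have oA := open_chart_image hc oW.
have sD (Z T : vfield M) : smooth_vfield W Z -> smooth_vfield W T ->
    smooth_on (c @` (W `&` cdom c)) (fun x => 'D_(vcomp Z c x) (vcomp T c) x).
  move=> sZ sT; exact: (smooth_on_derive_along oA oA (fun x => id) (@smooth_on_id _ _ _) (sZ c hc) (sT c hc)).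
have sN : smooth_on (c @` (W `&` cdom c)) (fun x => - 'D_(vcomp Y c x) (vcomp X c) x).
  apply/(smooth_on_rVP oA) => j.
  have := smooth_onN oA ((smooth_on_rVP oA _).1 (sD _ _ sY sX) j).
  by apply: smooth_on_eq => // x _; rewrite mxE.
apply: (smooth_on_eq oA _ (smooth_onD oA (sD _ _ sX sY) sN)) => _ [p [Wp cp] <-].
by rewrite /vcomp cmapK// (bracket_chart oW Wp sX sY hc cp).
Qed.

End vfield_algebra.

Section connection_coordinates.
Context {R : realType} {n : nat} {M : smooth_structure R n} (nabla : connection M).
Implicit Types (W : set M) (X Y : vfield M) (f : M -> R) (c : chart R n M) (p : M).

Lemma smooth_fun_cst W (a : R) : open W -> smooth_fun W (fun=> a).
Proof. by move=> oW c hc; exact: (@smooth_on_cst _ _ _ _ (a : R^o)). Qed.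

Lemma cov0l W Y p : open W -> smooth_vfield W Y -> W p ->
  nabla (fun p : M => 0 : tangent p) Y p = 0.
Proof.
move=> oW sY Wp.
have E : (fun p : M => 0 : tangent p) = (fun p : M => 0 *: (0 : tangent p)).
  by apply: functional_extensionality_dep => q; rewrite scale0r.
by rewrite E (cov_scalel nabla oW (smooth_fun_cst 0 oW) (@smooth_vfield0 _ _ _ W) sY Wp) scale0r.
Qed.

Lemma cov0r W X p : open W -> smooth_vfield W X -> W p ->
  nabla X (fun p : M => 0 : tangent p) p = 0.
Proof.
move=> oW sX Wp.
have := cov_addr nabla oW sX (@smooth_vfield0 _ _ _ W) (@smooth_vfield0 _ _ _ W) Wp.
have -> : (fun p : M => 0 + 0 : tangent p) = (fun p : M => 0 : tangent p).
  by apply: functional_extensionality_dep => q; rewrite addr0.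
by move=> /eqP; rewrite -subr_eq subrr => /eqP <-.
Qed.

Lemma cov_suml W (I : Type) (r : seq I) (X : I -> vfield M) Y p : open W ->
  (forall i, smooth_vfield W (X i)) -> smooth_vfield W Y -> W p ->
  nabla (fun q => \sum_(i <- r) X i q) Y p = \sum_(i <- r) nabla (X i) Y p.
Proof.
move=> oW sX sY Wp; elim: r => [|i r ih].
  have -> : (fun q : M => \sum_(i <- [::]) X i q) = (fun q : M => 0 : tangent q).
    by apply: functional_extensionality_dep => q; rewrite big_nil.
  by rewrite big_nil (cov0l oW sY Wp).
rewrite big_cons -ih -(cov_addl nabla oW (sX i) (smooth_vfield_sum r oW sX) sY Wp).
have -> // : (fun q : M => \sum_(i <- i :: r) X i q) = (fun q : M => X i q + \sum_(i <- r) X i q).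
by apply: functional_extensionality_dep => q; rewrite big_cons.
Qed.

Lemma cov_sumr W (I : Type) (r : seq I) X (Y : I -> vfield M) p : open W ->
  (forall i, smooth_vfield W (Y i)) -> smooth_vfield W X -> W p ->
  nabla X (fun q => \sum_(i <- r) Y i q) p = \sum_(i <- r) nabla X (Y i) p.
Proof.
move=> oW sY sX Wp; elim: r => [|i r ih].
  have -> : (fun q : M => \sum_(i <- [::]) Y i q) = (fun q : M => 0 : tangent q).
    by apply: functional_extensionality_dep => q; rewrite big_nil.
  by rewrite big_nil (cov0r oW sX Wp).
rewrite big_cons -ih -(cov_addr nabla oW sX (sY i) (smooth_vfield_sum r oW sY) Wp).
have -> // : (fun q : M => \sum_(i <- i :: r) Y i q) = (fun q : M => Y i q + \sum_(i <- r) Y i q).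
by apply: functional_extensionality_dep => q; rewrite big_cons.
Qed.

(** The Christoffel symbols as a bilinear map on component rows. It is not a tensor;
    [gamma_transition] is its transformation law. *)
Definition gamma c p (u v : 'rV[R]_n) : 'rV[R]_n :=
  \sum_i \sum_j (u 0 i * v 0 j) *: nabla (coord_vf c i) (coord_vf c j) p c.

Lemma gammaDl c p u1 u2 v : gamma c p (u1 + u2) v = gamma c p u1 v + gamma c p u2 v.
Proof.
rewrite /gamma -big_split; apply: eq_bigr => i _; rewrite -big_split.
by apply: eq_bigr => j _; rewrite mxE mulrDl scalerDl.
Qed.

Lemma gamma0l c p v : gamma c p 0 v = 0.
Proof. by rewrite /gamma big1// => i _; rewrite big1// => j _; rewrite mxE mul0r scale0r. Qed.

(** Locality allows both fields to be replaced, on the part of [W] inside the chart, by their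
    expansions in the coordinate frame; additivity and the Leibniz rule then apply term by term. *)
Lemma cov_chart W X Y c p : open W -> W p -> smooth_vfield W X -> smooth_vfield W Y ->
  is_chart c -> cdom c p ->
  nabla X Y p c = 'D_(X p c) (vcomp Y c) (c p) + gamma c p (X p c) (Y p c).
Proof.
move=> oW0 Wp0 sX0 sY0 hc cp.
pose W' := W `&` cdom c; have Wp : W' p by [].
have oW : open W' by apply: openI => //; exact: open_cdom.
have Wc : W' `<=` cdom c by exact: subIsetr.
have sX : smooth_vfield W' X by apply: smooth_vfieldS sX0; exact: subIsetl.
have sY : smooth_vfield W' Y by apply: smooth_vfieldS sY0; exact: subIsetl.
have sd i : smooth_vfield W' (coord_vf c i) by apply: smooth_vfieldS Wc (smooth_coord_vf i hc).
have sXi i := smooth_fun_coord i oW hc Wc sX.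
have sYi i := smooth_fun_coord i oW hc Wc sY.
have dY i : nabla (coord_vf c i) Y p = \sum_j (Y p c 0 j *: nabla (coord_vf c i) (coord_vf c j) p +
    'D_(delta_mx 0 i) (vcomp Y c) (c p) 0 j *: coord_vf c j p).
  have sYj j := smooth_vfieldZ oW (sYi j) (sd j).
  rewrite (cov_local nabla (X' := coord_vf c i)
    (Y' := fun q => \sum_j (Y q c 0 j *: coord_vf c j q)) oW (sd i) sY _ _ Wp) => [||q Wq]//; last first.
    by apply: tangent_sum_coord => //; exact: Wc.
  rewrite (cov_sumr _ oW sYj (sd i) Wp); apply: eq_bigr => j _.
  rewrite (cov_leibniz nabla oW (sYi j) (sd i) (sd j) Wp); congr (_ + _ *: _).
  rewrite (dfun_chart _ oW Wp (sYi j) hc cp) coord_vf_comp//.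
  by rewrite derive_rV//; apply: smooth_on_diff (sY c hc) _; exists p.
have -> : nabla X Y p = \sum_i X p c 0 i *: nabla (coord_vf c i) Y p.
  have sXj j := smooth_vfieldZ oW (sXi j) (sd j).
  rewrite (cov_local nabla (X' := fun q => \sum_j (X q c 0 j *: coord_vf c j q))
    (Y' := Y) oW sX sY _ _ Wp) => [|q Wq|]//; last first.
    by apply: tangent_sum_coord => //; exact: Wc.
  rewrite (cov_suml _ oW sXj sY Wp); apply: eq_bigr => j _.
  by rewrite (cov_scalel nabla oW (sXi j) (sd j) sY Wp).
rewrite tcomp_sum addrC derive_sum_delta; last by apply: smooth_on_diff (sY c hc) _; exists p.
rewrite /gamma -big_split; apply: eq_bigr => i _; rewrite [RHS]/= tcompZ dY tcomp_sum.
rewrite [in RHS](row_sum_delta ('D_(delta_mx 0 i) (vcomp Y c) (c p))).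
rewrite !scaler_sumr -big_split; apply: eq_bigr => j _.
by rewrite [RHS]/= tcompD !tcompZ coord_vf_comp// scalerDr !scalerA.
Qed.

Lemma smooth_gamma_coord c i j : is_chart c ->
  smooth_on (c @` cdom c) (vcomp (nabla (coord_vf c i) (coord_vf c j)) c).
Proof.
move=> hc.
have := cov_smooth nabla (open_cdom hc) (smooth_coord_vf i hc) (smooth_coord_vf j hc) hc.
by rewrite setIid; exact.
Qed.

(** [nabla] of two fields with constant components in [c] is computed in both charts. In [c] only
    the connection coefficients remain; in [c'] the components are derivatives of the transition
    map, whence the second derivative. *)
Lemma gamma_transition c c' p u v : is_chart c -> cdom c p -> is_chart c' -> cdom c' p ->
  'D_(gamma c p u v) (transition c c') (c p) =
  'D_u ('D_v (transition c c')) (c p) +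
  gamma c' p ('D_u (transition c c') (c p)) ('D_v (transition c c') (c p)).
Proof.
move=> hc cp hc' c'p.
have [oV sV] := is_chart_compat hc hc'.
have Vp : overlap c c' (c p) by exists p.
have sU := smooth_const_vf u hc; have sv := smooth_const_vf v hc; have oW := open_cdom hc.
have E w : const_vf c w p c' = 'D_w (transition c c') (c p).
  by rewrite (tangent_change _ hc cp hc' c'p) /const_vf tvec_comp.
have Ec := cov_chart oW cp sU sv hc cp.
have Ec' := cov_chart oW cp sU sv hc' c'p.
have D0 : 'D_(const_vf c u p c) (vcomp (const_vf c v) c) (c p) = 0.
  have E0 y : (c @` cdom c) y -> vcomp (const_vf c v) c y = cst v y.
    by move=> cy; rewrite vcomp_const_vf.
  have cpI : (c @` cdom c) (c p) by exists p.
  by rewrite (derive_eq_on (@cimg_open _ _ _ c) _ E0 cpI) derive_cst.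
rewrite D0 add0r /const_vf !tvec_comp// in Ec.
rewrite -/(const_vf c u) -/(const_vf c v) in Ec.
rewrite -Ec -(tangent_change _ hc cp hc' c'p) Ec' !E; congr (_ + _).
have tp : transition c c' (c p) = c' p by rewrite /transition/= cmapK.
have dt : differentiable (transition c c') (c p) by exact: smooth_on_diff sV Vp.
have dv : differentiable (vcomp (const_vf c v) c') (transition c c' (c p)).
  by rewrite tp; apply: smooth_on_diff (sv c' hc') _; exists p.
rewrite -tp; apply: (etrans (esym (derive_comp _ dt dv))).
apply: (derive_eq_on oV u _ Vp) => y Vy /=; rewrite vcomp_change// vcomp_const_vf//.
by case: Vy => q [cq _] <-; exists q.
Qed.

End connection_coordinates.

Section affine_charts.
Context {R : realType} {n : nat} {M : smooth_structure R n} (nabla : connection M).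
Implicit Types (W : set M) (X Y Z : vfield M) (c : chart R n M) (p : M).

Definition affine_chart c := is_chart c /\
  forall p, cdom c p -> forall u v, gamma nabla c p u v = 0.

Let ncoef c i j := vcomp (nabla (coord_vf c i) (coord_vf c j)) c.

(* The components of torsion, then of curvature, vanish on the domain of [c]. *)
Definition flat_coefficients c := forall p, cdom c p ->
  (forall i j, ncoef c i j (c p) = ncoef c j i (c p)) /\
  (forall i j k,
    'D_(delta_mx 0 i) (ncoef c j k) (c p) + gamma nabla c p (delta_mx 0 i) (ncoef c j k (c p)) =
    'D_(delta_mx 0 j) (ncoef c i k) (c p) + gamma nabla c p (delta_mx 0 j) (ncoef c i k (c p))).

Lemma vcomp_cmap X c p : cdom c p -> vcomp X c (c p) = X p c.
Proof. by move=> cp; rewrite /vcomp cmapK. Qed.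

Lemma cov_affine_chart W X Y c : open W -> smooth_vfield W X -> smooth_vfield W Y ->
  affine_chart c -> forall x, (c @` (W `&` cdom c)) x ->
  vcomp (nabla X Y) c x = 'D_(vcomp X c x) (vcomp Y c) x.
Proof.
move=> oW sX sY [hc c0] _ [p [Wp cp] <-].
by rewrite !vcomp_cmap// (cov_chart nabla oW Wp sX sY hc cp) c0// addr0.
Qed.

(** In an affine chart [nabla] differentiates components. Torsion is then the coordinate formula of
    the bracket minus itself, and curvature reduces to the commutation of second derivatives. *)
Lemma affine_flat : (forall p, exists2 c, affine_chart c & cdom c p) -> flat nabla.
Proof.
move=> aff; split=> [W X Y Z oW sX sY sZ p Wp|W X Y oW sX sY p Wp].
  have [c ac cp] := aff p; have hc := ac.1.
  apply: (tangent_eq hc cp); rewrite /curvature 2!tcompB.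
  have oA := open_chart_image hc oW.
  have Ap : (c @` (W `&` cdom c)) (c p) by exists p.
  have E T T' : smooth_vfield W T -> smooth_vfield W T' ->
      nabla T (nabla T' Z) p c =
      'D_('D_(T p c) (vcomp T' c) (c p)) (vcomp Z c) (c p) +
      'D_(T p c) ('D_(T' p c) (vcomp Z c)) (c p).
    move=> sT sT'; have sN := cov_smooth nabla oW sT' sZ.
    rewrite -[LHS](vcomp_cmap _ cp) (cov_affine_chart oW sT sN ac Ap) vcomp_cmap//.
    rewrite (derive_eq_on oA _ (cov_affine_chart oW sT' sZ ac) Ap).
    by rewrite -(vcomp_cmap T' cp); exact: (derive_derive_along _ oA Ap (sT' c hc) (sZ c hc)).
  rewrite (E X Y sX sY) (E Y X sY sX).
  rewrite -[nabla (bracket X Y) Z p c](vcomp_cmap _ cp).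
  rewrite (cov_affine_chart oW (smooth_bracket oW sX sY) sZ ac Ap) vcomp_cmap//.
  rewrite (bracket_chart oW Wp sX sY hc cp) deriveBv; last exact: smooth_on_diff (sZ c hc) Ap.
  rewrite (schwarz oA (X p c) (Y p c) (sZ c hc) Ap).
  have alg (a b s : 'rV[R]_n) : a + s - (b + s) - (a - b) = 0.
    by rewrite [b + s]addrC opprD addrA addrK subrr.
  exact: alg.
have [c ac cp] := aff p; have hc := ac.1.
apply: (tangent_eq hc cp); rewrite /torsion 2!tcompB.
have Ap : (c @` (W `&` cdom c)) (c p) by exists p.
rewrite (bracket_chart oW Wp sX sY hc cp) -![nabla _ _ p c](vcomp_cmap _ cp).
by rewrite !(cov_affine_chart oW _ _ ac Ap)// !vcomp_cmap// subrr.
Qed.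

Lemma bracket_coord_vf c i j p : is_chart c -> cdom c p ->
  bracket (coord_vf c i) (coord_vf c j) p = 0.
Proof.
move=> hc cp; apply: (tangent_eq hc cp).
rewrite (bracket_chart (open_cdom hc) cp (smooth_coord_vf i hc) (smooth_coord_vf j hc) hc cp).
have D0 k u : 'D_u (vcomp (coord_vf c k) c) (c p) = 0.
  have E0 y : (c @` cdom c) y -> vcomp (coord_vf c k) c y = cst (delta_mx 0 k) y.
    by move=> cy; rewrite vcomp_coord_vf.
  have cpI : (c @` cdom c) (c p) by exists p.
  by rewrite (derive_eq_on (@cimg_open _ _ _ c) _ E0 cpI) derive_cst.
by rewrite !D0 subrr.
Qed.

(** Coordinate fields commute over the chart domain, so the bracket terms of torsion and curvature
    drop out. *)
Lemma flat_flat_coefficients c : flat nabla -> is_chart c -> flat_coefficients c.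
Proof.
move=> [R0 T0] hc p cp; have oW := open_cdom hc.
have sd i := smooth_coord_vf i hc.
split=> [i j|i j k].
  have := T0 _ _ _ oW (sd i) (sd j) p cp.
  rewrite /torsion bracket_coord_vf// subr0 => /eqP; rewrite subr_eq0 => /eqP E.
  by rewrite /ncoef !vcomp_cmap// E.
have E a b d : nabla (coord_vf c a) (nabla (coord_vf c b) (coord_vf c d)) p c =
    'D_(delta_mx 0 a) (ncoef c b d) (c p) + gamma nabla c p (delta_mx 0 a) (ncoef c b d (c p)).
  rewrite (cov_chart nabla oW cp (sd a) (cov_smooth nabla oW (sd b) (sd d)) hc cp).
  by rewrite coord_vf_comp// /ncoef vcomp_cmap.
have := R0 _ _ _ _ oW (sd i) (sd j) (sd k) p cp; rewrite /curvature.
have -> : nabla (bracket (coord_vf c i) (coord_vf c j)) (coord_vf c k) p = 0.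
  rewrite (cov_local nabla (X' := fun p : M => 0 : tangent p) (Y' := coord_vf c k) oW
    (smooth_bracket oW (sd i) (sd j)) (sd k) _ _ cp)//.
    exact: (cov0l nabla oW (sd k) cp).
  by move=> q cq; exact: bracket_coord_vf.
rewrite subr0 => /eqP; rewrite subr_eq0 => /eqP E'.
by rewrite -!E E'.
Qed.

Section flat_coordinates.
Variables (c : chart R n M) (p0 : M).
Hypotheses (hc : is_chart c) (cp0 : cdom c p0) (fc : flat_coefficients c).

Let U := c @` cdom c.
Let oU : open U. Proof. exact: cimg_open. Qed.

(* The coefficient matrices of the system [d u = theta], [nabla theta = 0] in the
   unknown row [(u, theta)]. *)
Let B i x : 'M[R]_n := \matrix_(l, k) ncoef c i k x 0 l.
Let A i x : 'M[R]_(1 + n) := block_mx 0 0 (delta_mx i 0) (B i x).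

Let sncoef i j : smooth_on U (ncoef c i j).
Proof. exact: smooth_gamma_coord. Qed.

Let sB i k l : smooth_on U (fun x => B i x k l : R^o).
Proof.
apply: (smooth_on_eq oU _ ((smooth_on_rVP oU _).1 (sncoef i l) k)) => x _.
by rewrite mxE.
Qed.

Let sA i k l : smooth_on U (fun x => A i x k l : R^o).
Proof.
rewrite -(splitK k) -(splitK l).
case: (fintype.split k) => a; case: (fintype.split l) => b /=; rewrite /A.
- by apply: (smooth_on_eq oU _ (smooth_on_cst (0 : R^o))) => x _; rewrite block_mxEul mxE.
- by apply: (smooth_on_eq oU _ (smooth_on_cst (0 : R^o))) => x _; rewrite block_mxEur mxE.
- by apply: (smooth_on_eq oU _ (smooth_on_cst ((delta_mx i 0 : 'M[R]_(n, 1)) a b : R^o))) => x _; rewrite block_mxEdl.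
- by apply: (smooth_on_eq oU _ (sB i a b)) => x _; rewrite block_mxEdr.
Qed.

Let DA i x u : U x -> \matrix_(k, l) 'D_u (fun y => A i y k l : R^o) x =
  block_mx 0 0 0 (\matrix_(l, k) 'D_u (ncoef c i k) x 0 l) :> 'M[R]_(1 + n).
Proof.
move=> Ux; apply/matrixP => k l; rewrite mxE.
rewrite -(splitK k) -(splitK l).
have cst0 (f : 'rV[R]_n -> R^o) (a : R) : (forall y, U y -> f y = a) -> 'D_u f x = 0.
  by move=> fa; rewrite (derive_eq_on oU u (g := cst (a : R^o)) fa Ux) derive_cst.
case: (fintype.split k) => a; case: (fintype.split l) => b /=; rewrite /A.
- by rewrite block_mxEul mxE; apply: (cst0 _ 0) => y _; rewrite block_mxEul mxE.
- by rewrite block_mxEur mxE; apply: (cst0 _ 0) => y _; rewrite block_mxEur mxE.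
- by rewrite block_mxEdl mxE; apply: (cst0 _ ((delta_mx i 0 : 'M[R]_(n, 1)) a b)) => y _; rewrite block_mxEdl.
rewrite block_mxEdr mxE (derive_rV _ _ (smooth_on_diff (sncoef i b) Ux)).
by apply: (derive_eq_on oU u _ Ux) => y _; rewrite block_mxEdr mxE.
Qed.

Let gammaE i (w : 'rV[R]_n) p l : cdom c p ->
  gamma nabla c p (delta_mx 0 i) w 0 l = \sum_m w 0 m * ncoef c i m (c p) 0 l.
Proof.
move=> cp; rewrite /gamma summxE (bigD1 i)//= [X in _ + X]big1 ?addr0 => [|k ki]; last first.
  by rewrite summxE big1// => j _; rewrite !mxE (negbTE ki) andbF !mul0r.
rewrite summxE; apply: eq_bigr => m _.
by rewrite !mxE !eqxx mul1r /ncoef vcomp_cmap.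
Qed.

(** Compatibility splits along the blocks of [A], where [(u, theta) *m A i] is
    [(theta_i, theta *m B i)]: the lower left block is the symmetry of the connection coefficients,
    the lower right block the vanishing of curvature. *)
Let flatA i j x : U x ->
  A j x *m A i x + \matrix_(k, l) 'D_(delta_mx 0 j) (fun y => A i y k l : R^o) x =
  A i x *m A j x + \matrix_(k, l) 'D_(delta_mx 0 i) (fun y => A j y k l : R^o) x.
Proof.
move=> Ux; rewrite (DA i (delta_mx 0 j) Ux) (DA j (delta_mx 0 i) Ux).
move: Ux => -[p cp <-]; have [sym cur] := fc cp.
rewrite /A !mulmx_block !add_block_mx !(mul0mx, mulmx0, addr0, add0r).
have -> : B j (c p) *m delta_mx i 0 = B i (c p) *m delta_mx j 0 :> 'M[R]_(n, 1).
  by apply/matrixP => l o; rewrite -!colE !mxE sym.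
apply: (congr1 (block_mx 0 0 _)); apply/matrixP => l k; rewrite [LHS]mxE [RHS]mxE.
have E a b : (B a (c p) *m B b (c p)) l k = gamma nabla c p (delta_mx 0 a) (ncoef c b k (c p)) 0 l.
  rewrite gammaE// mxE; apply: eq_bigr => m _; rewrite !mxE; exact: mulrC.
rewrite !E [X in _ + X = _]mxE [X in _ = _ + X]mxE addrC [RHS]addrC.
by have := cur i j k => /rowP/(_ l); rewrite !mxE => ->.
Qed.

(** The last clause says that the components of [u] have zero covariant Hessian; by
    [gamma_transition] this is what annihilates the connection coefficients in the coordinates
    [u]. *)
Lemma flat_coordinates : exists (B : set 'rV[R]_n) (u : 'rV[R]_n -> 'rV[R]_n),
  [/\ open B, B (c p0), B `<=` U, smooth_on B u &
  (forall v, 'D_v u (c p0) = v) /\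
  forall p v w, B (c p) -> cdom c p ->
    'D_v ('D_w u) (c p) = 'D_(gamma nabla c p v w) u (c p)].
Proof.
have Ux0 : U (c p0) by exists p0.
have [r [r0 HU HF]] := linear_frobenius oU sA flatA Ux0.
(* The [a]-th solution starts with value 0 and covector [dx^a], so that [u] has the identity as
   derivative at the base point. *)
have /choice[F HF'] : forall a : 'I_n, exists F : 'rV[R]_n -> 'rV[R]_(1 + n),
    F (c p0) = row_mx 0 (delta_mx 0 a) /\ forall x, `|x - c p0| < r -> differentiable F x /\
      forall v, 'D_v F x = F x *m \sum_i v 0 i *: A i x.
  by move=> a; have [F F0 DF] := HF (row_mx 0 (delta_mx 0 a)); exists F.
pose D := ball (c p0) r.
have DE x : D x -> `|x - c p0| < r by rewrite /D -ball_normE /= distrC.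
have DU : D `<=` U by move=> x /DE/HU.
have oD : open D by exact: ball_open.
have D0 : D (c p0) by exact: ballxx.
have sF a : smooth_on D (F a).
  apply: (total_system_smooth oD (A := A)) => [i k l|x Dx]; first exact: smooth_onS DU (sA i k l).
  by apply: (HF' a).2; exact: DE.
have sFj a j : smooth_on D (fun x => F a x 0 j : R^o) by exact: (smooth_on_rVP oD _).1 (sF a) j.
pose u (x : 'rV[R]_n) : 'rV[R]_n := \row_a F a x 0 (lshift n ord0).
pose theta a (x : 'rV[R]_n) : 'rV[R]_n := rsubmx (F a x).
have FE a x v : D x -> 'D_v (F a) x =
    row_mx (\sum_i v 0 i *: (theta a x *m delta_mx i 0)) (\sum_i v 0 i *: (theta a x *m B i x)).
  move=> Dx; rewrite ((HF' a).2 x (DE _ Dx)).2 mulmx_sumr.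
  have row_sum (s : seq 'I_n) (f : 'I_n -> 'rV[R]_1) (g : 'I_n -> 'rV[R]_n) :
      row_mx (\sum_(i <- s) f i) (\sum_(i <- s) g i) = \sum_(i <- s) row_mx (f i) (g i).
    by elim: s => [|i s ih]; rewrite ?big_nil ?row_mx0// !big_cons -add_row_mx ih.
  rewrite row_sum.
  apply: eq_bigr => i _; rewrite -scalemxAr -[F a x in LHS]hsubmxK -/(theta a x).
  by rewrite /A mul_row_block !mulmx0 !add0r scale_row_mx.
have su : smooth_on D u.
  apply/(smooth_on_rVP oD) => a; apply: smooth_on_eq (sFj a (lshift n ord0)) => // x _.
  by rewrite mxE.
have du x : D x -> differentiable u x by exact: smooth_on_diff.
have uE x v a : D x -> 'D_v u x 0 a = \sum_i v 0 i * theta a x 0 i.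
  move=> Dx; rewrite (derive_rV _ _ (du x Dx)).
  have -> : (fun y => u y 0 a : R^o) = (fun y => F a y 0 (lshift n ord0)).
    by apply/funext => y; rewrite mxE.
  rewrite -(derive_rV _ _ (smooth_on_diff (sF a) Dx)) FE// row_mxEl summxE.
  by apply: eq_bigr => i _; rewrite mxE -colE mxE.
exists D, u; split => //; split=> [v|p v w Dp cp].
  apply/rowP => a; rewrite uE// [in RHS](row_sum_delta v) summxE.
  by apply: eq_bigr => i _; rewrite /theta (HF' a).1 row_mxKr !mxE eqxx /= eq_sym.
apply/rowP => a; rewrite uE//.
rewrite (derive_rV _ _ (smooth_on_diff (smooth_on_derive w su) Dp)).
have E y : D y -> 'D_w u y 0 a = (\sum_i (w 0 i *: (fun x => F a x 0 (rshift 1 i) : R^o))) y.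
  by move=> Dy; rewrite uE// fct_sumE; apply: eq_bigr => i _; rewrite mxE.
rewrite (derive_eq_on oD v E Dp) derive_sum; last first.
  by move=> i; apply: derivableZ; exact: smooth_on_derivable (sFj a _) Dp.
transitivity (\sum_i w 0 i * \sum_j v 0 j * \sum_l theta a (c p) 0 l * ncoef c j i (c p) 0 l).
  apply: eq_bigr => i _; rewrite deriveZ; last exact: smooth_on_derivable (sFj a _) Dp.
  rewrite -(derive_rV _ _ (smooth_on_diff (sF a) Dp)) FE// row_mxEr summxE.
  congr (_ * _); apply: eq_bigr => j _; rewrite mxE; congr (_ * _).
  by rewrite mxE; apply: eq_bigr => l _; rewrite [B j _ _ _]mxE.
rewrite /gamma.
under [RHS]eq_bigr => l _ do rewrite summxE mulr_suml.
rewrite exchange_big /=.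
transitivity (\sum_j \sum_i \sum_l v 0 j * w 0 i * theta a (c p) 0 l * ncoef c j i (c p) 0 l).
  rewrite exchange_big /=; apply: eq_bigr => i _; rewrite mulr_sumr; apply: eq_bigr => j _.
  by rewrite !mulr_sumr; apply: eq_bigr => l _; ring.
apply: eq_bigr => j _; rewrite exchange_big /=; apply: eq_bigr => l _.
rewrite summxE mulr_suml; apply: eq_bigr => i _; rewrite [X in _ = X * _]mxE /ncoef vcomp_cmap//; ring.
Qed.

End flat_coordinates.
End affine_charts.

(** * New charts from local diffeomorphisms, and the existence of affine charts *)

Section new_charts.
Context {R : realType} {n : nat} {M : smooth_structure R n}.
Implicit Types (c : chart R n M) (p : M).

Section local_diffeo.
Variables (c : chart R n M) (B : set 'rV[R]_n) (u psi : 'rV[R]_n -> 'rV[R]_n).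
Hypotheses (hc : is_chart c) (oB : open B) (BU : B `<=` c @` cdom c).
Hypotheses (su : smooth_on B u) (psiK : forall x, B x -> psi (u x) = x).
Hypothesis openu : forall O : set 'rV[R]_n, open O -> O `<=` B -> open (u @` O).
Hypothesis spsi : smooth_on (u @` B) psi.

Let D : set M := [set q | cdom c q /\ B (c q)].

Let image_comp (O : set 'rV[R]_n) : O `<=` B ->
  (u \o c) @` [set q | D q /\ O (c q)] = u @` O.
Proof.
move=> OB; apply/seteqP; split=> [_ [q [_ Oq] <-]|_ [x Ox <-]]; first by exists (c q).
by have [q cq qx] := BU (OB _ Ox); exists q; rewrite /= ?qx//; split; rewrite ?qx//; split; rewrite ?qx//; exact: OB.
Qed.

Let chart_open : open ((u \o c) @` D).
Proof.
have -> : D = [set q | D q /\ B (c q)] by apply/seteqP; split => q; [move=> [? ?]; split|case].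
by rewrite image_comp//; exact: openu.
Qed.

Let chartK q : D q -> (cinv c \o psi) ((u \o c) q) = q.
Proof. by move=> [cq Bq]; rewrite /= psiK// cmapK. Qed.

Definition recoordinatized : chart R n M := Chart chart_open chartK.

(** Overlaps with an atlas chart are images under [u] of open subsets of [B] in one direction and
    preimages of [B] under a transition map in the other; the transition maps gain a factor [psi] or
    [u]. *)
Lemma is_chart_recoordinatized : is_chart recoordinatized.
Proof.
move=> a aa; have [[oca sca] [oac sac]] := hc aa.
have oV : open (B `&` overlap c a) by exact: openI.
have VB : B `&` overlap c a `<=` B by exact: subIsetl.
have E1 : overlap recoordinatized a = u @` (B `&` overlap c a).
  rewrite -image_comp//; congr (_ @` _); apply/seteqP; split=> q.
    by move=> [[cq Bq] aq]; split => //; split => //; exists q.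
  by move=> [[cq Bq] [_ [r [cr ar] rq]]]; split => //; rewrite -(cmapK cq) -rq cmapK.
have E2 : overlap a recoordinatized = overlap a c `&` transition a c @^-1` B.
  apply/seteqP; split=> [_ [q [aq [cq Bq]] <-]|_ [[q [aq cq] <-]]].
    by split; [exists q|rewrite /transition /= cmapK].
  by rewrite /transition /= cmapK// => Bq; exists q.
split; split.
- by rewrite E1; exact: openu.
- rewrite E1; have oW := openu oV VB.
  apply: (smooth_on_comp oW oca (f := psi) (g := transition c a)) sca.
    by move=> _ [x [Bx ox] <-]; rewrite psiK.
  by apply: smooth_onS spsi => _ [x [Bx _] <-]; exists x.
- by rewrite E2; exact: open_preimage_smooth.
- rewrite E2; have oW := open_preimage_smooth oac oB sac.
  apply: (smooth_on_comp oW oB (f := transition a c) (g := u)) su; first by move=> x [].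
  by apply: smooth_onS sac; exact: subIsetl.
Qed.

End local_diffeo.

Variable nabla : connection M.

(** In [gamma_transition] the second derivative of [u] already equals the transported coefficients
    of [c], which leaves 0 for those of the new chart. *)
Lemma exists_affine_chart c p : is_chart c -> cdom c p -> flat_coefficients nabla c ->
  exists2 c', affine_chart nabla c' & cdom c' p.
Proof.
move=> hc cp fc; have [B0 [u [oB0 B0p B0U su [u0 DDu]]]] := flat_coordinates hc cp fc.
have [B [oB Bp BB0 openu [psi [psiK spsi]]]] := inverse_function oB0 B0p su u0.
have BU : B `<=` c @` cdom c by exact: subset_trans B0U.
have suB := smooth_onS BB0 su.
pose c' := recoordinatized oB BU psiK openu.
have hc' : is_chart c' by exact: is_chart_recoordinatized.
exists c' => //; split => // q [cq Bq] v w.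
have c'q : cdom c' q by [].
have tE y : B y -> transition c c' y = u y.
  by move=> /BU[r cr <-]; rewrite /transition/= cmapK.
have DtE y a : B y -> 'D_a (transition c c') y = 'D_a u y.
  by move=> By; exact: (derive_eq_on oB a tE By).
(* The transformation law speaks only of transported vectors; surjectivity turns these into
   arbitrary [v] and [w]. *)
have onto b : exists a, 'D_a (transition c c') (c q) = b.
  exists (tvec c' q b c).
  by rewrite -(tangent_change _ hc cq hc' c'q) tvec_comp.
have [v' <-] := onto v; have [w' <-] := onto w.
have := gamma_transition nabla v' w' hc cq hc' c'q.
rewrite (DtE _ _ Bq) (derive_eq_on oB v' (fun y => DtE y w') Bq) (DDu q) //; last exact: BB0.
by rewrite -[LHS]addr0 => /addrI ->.
Qed.

End new_charts.

(** * Charts of the tangent bundle *)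

Section tangent_bundle_charts.
Context {R : realType} {n : nat} {M : smooth_structure R n}.
Implicit Types (c : chart R n M) (p : M).

Lemma smooth_row_mx (V : normedModType R) m k (A : set V) (f : V -> 'rV[R]_m)
    (g : V -> 'rV[R]_k) : open A -> smooth_on A f -> smooth_on A g ->
  smooth_on A (fun x => row_mx (f x) (g x)).
Proof.
move=> oA sf sg; apply/(smooth_on_rVP oA) => j; rewrite -(splitK j).
case: (fintype.split j) => i /=.
  by apply: smooth_on_eq ((smooth_on_rVP oA _).1 sf i) => // x _; rewrite row_mxEl.
by apply: smooth_on_eq ((smooth_on_rVP oA _).1 sg i) => // x _; rewrite row_mxEr.
Qed.

Lemma derive_row_mx (V : normedModType R) m k (f : V -> 'rV[R]_m)
    (g : V -> 'rV[R]_k) x v : differentiable f x -> differentiable g x ->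
  'D_v (fun x => row_mx (f x) (g x)) x = row_mx ('D_v f x) ('D_v g x).
Proof.
move=> df dg; pose h y := row_mx (f y) (g y).
have hl i : (fun y => h y 0 (lshift k i) : R^o) = (fun y => f y 0 i).
  by apply/funext => y; rewrite /h row_mxEl.
have hr i : (fun y => h y 0 (rshift m i) : R^o) = (fun y => g y 0 i).
  by apply/funext => y; rewrite /h row_mxEr.
have dh : differentiable h x.
  apply: diff_rV => j; rewrite -(splitK j); case: (fintype.split j) => i /=.
    rewrite hl; exact: (@differentiable_comp _ _ _ _ f (fun N : 'rV[R]_m => N 0 i : R^o) x
      df (differentiable_coord (f x) 0 i)).
  rewrite hr; exact: (@differentiable_comp _ _ _ _ g (fun N : 'rV[R]_k => N 0 i : R^o) x
    dg (differentiable_coord (g x) 0 i)).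
apply/rowP => j; apply: (etrans (derive_rV _ _ dh)); rewrite -(splitK j).
case: (fintype.split j) => i /=.
  by rewrite row_mxEl hl derive_rV.
by rewrite row_mxEr hr derive_rV.
Qed.

Lemma smooth_lsubmx m k (A : set 'rV[R]_(m + k)) : open A -> smooth_on A (lsubmx : 'rV[R]_(m + k) -> 'rV[R]_m).
Proof.
move=> oA; apply/(smooth_on_rVP oA) => j.
by apply: smooth_on_eq ((smooth_on_rVP oA _).1 (@smooth_on_id _ _ A) (lshift k j)) => // x _; rewrite mxE.
Qed.

Lemma smooth_rsubmx m k (A : set 'rV[R]_(m + k)) : open A -> smooth_on A (rsubmx : 'rV[R]_(m + k) -> 'rV[R]_k).
Proof.
move=> oA; apply/(smooth_on_rVP oA) => j.
by apply: smooth_on_eq ((smooth_on_rVP oA _).1 (@smooth_on_id _ _ A) (rshift m j)) => // x _; rewrite mxE.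
Qed.

Lemma derive_lsubmx m k (z w : 'rV[R]_(m + k)) : 'D_w (lsubmx : 'rV[R]_(m + k) -> 'rV[R]_m) z = lsubmx w.
Proof.
apply/rowP => j; rewrite derive_rV; last exact: smooth_on_diff (smooth_lsubmx openT) _.
have -> : (fun y : 'rV[R]_(m + k) => lsubmx y 0 j : R^o) = (fun y => id y 0 (lshift k j) : R^o).
  by apply/funext => y; rewrite mxE.
by rewrite -derive_rV ?derive_id ?mxE//; exact: ex_diff.
Qed.

Lemma derive_rsubmx m k (z w : 'rV[R]_(m + k)) : 'D_w (rsubmx : 'rV[R]_(m + k) -> 'rV[R]_k) z = rsubmx w.
Proof.
apply/rowP => j; rewrite derive_rV; last exact: smooth_on_diff (smooth_rsubmx openT) _.
have -> : (fun y : 'rV[R]_(m + k) => rsubmx y 0 j : R^o) = (fun y => id y 0 (rshift m j) : R^o).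
  by apply/funext => y; rewrite mxE.
by rewrite -derive_rV ?derive_id ?mxE//; exact: ex_diff.
Qed.

(** Extends [tchart_compat] beyond the atlas, since affine charts need not belong to it. *)
Lemma tchart_is_chart_compat c c' : is_chart c -> is_chart c' ->
  smooth_compat (tchart c) (tchart c').
Proof.
move=> hc hc'; have [oV sV] := is_chart_compat hc hc'.
rewrite /smooth_compat tchart_overlapE//; have oU := open_lsubmx oV; split => //.
apply: (smooth_on_eq oU (f := fun z => row_mx (transition c c' (lsubmx z))
  ('D_(rsubmx z) (transition c c') (lsubmx z)))).
  move=> z Vz; rewrite tchart_transitionE// deriveE//; exact: smooth_on_diff sV Vz.
have sl := @smooth_lsubmx n n _ oU; have sr := @smooth_rsubmx n n _ oU.
apply: smooth_row_mx => //.
  exact: (smooth_on_comp oU oV (fun x => id) sl sV).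
exact: (smooth_on_derive_along oU oV (fun x => id) sl sr sV).
Qed.

Lemma is_chart_tchart c : is_chart c -> is_chart (tchart c : chart R (n + n) (tangent_bundle M)).
Proof.
move=> hc _ [a aa <-]; have ha := atlas_chart aa.
by split; exact: tchart_is_chart_compat.
Qed.

Section lift.
Variable xi : tangent_bundle M.
Let p : M := tproj xi.

Lemma cdom_tchart c : is_chart c -> cdom c p -> cdom (tchart c : chart R (n + n) (tangent_bundle M)) xi.
Proof. by []. Qed.

(** The transition map sends a point and a fibre vector to their image under the transition map of M
    and its derivative. Differentiating the second part in the base direction produces the second
    derivative. *)
Lemma tangent_bundle_change (w : tangent xi) c c' : is_chart c -> cdom c p -> is_chart c' -> cdom c' p ->
  w (tchart c') =
  row_mx ('D_(lsubmx (w (tchart c))) (transition c c') (c p))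
   ('D_(rsubmx (w (tchart c))) (transition c c') (c p) +
    'D_(lsubmx (w (tchart c))) ('D_(tvect xi c) (transition c c')) (c p)).
Proof.
move=> hc cp hc' c'p; have [oV sV] := is_chart_compat hc hc'.
have Vp : overlap c c' (c p) by exists p.
rewrite (tangent_change w (is_chart_tchart hc) (cdom_tchart hc cp) (is_chart_tchart hc') (cdom_tchart hc' c'p)).
have oU := open_lsubmx oV; set U := [set z | _] in oU.
pose T z := row_mx (transition c c' (lsubmx z)) ('D_(rsubmx z) (transition c c') (lsubmx z)).
have E z : U z -> transition (tchart c) (tchart c') z = T z.
  by move=> Uz; rewrite tchart_transitionE// -deriveE//; exact: smooth_on_diff sV Uz.
set z := (X in 'D_ _ _ X).
have lz : lsubmx z = c p by exact: row_mxKl.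
have rz : rsubmx z = tvect xi c by exact: row_mxKr.
have Uz : U z by rewrite /U /= lz.
rewrite (derive_eq_on oU _ E Uz).
have sl := @smooth_lsubmx n n _ oU; have sr := @smooth_rsubmx n n _ oU.
have s1 := smooth_on_comp oU oV (fun x => id) sl sV.
have s2 := smooth_on_derive_along oU oV (fun x => id) sl sr sV.
have dt : differentiable (transition c c') (lsubmx z) by exact: smooth_on_diff sV Uz.
rewrite (derive_row_mx _ (smooth_on_diff s1 Uz) (smooth_on_diff s2 Uz)); congr row_mx.
  by rewrite (derive_comp _ (smooth_on_diff sl Uz) dt) derive_lsubmx lz.
rewrite (derive_derive_comp _ oU oV Uz (fun x => id) sl sr sV).
by rewrite derive_lsubmx derive_rsubmx lz rz.
Qed.

Variable nabla : connection M.

(** With [vco], the coefficients of [w] in the frame of the [H_i] and [V_i], gathered into rows.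
    Both rows change like components of a tangent vector of M at [p], so relations between them do
    not depend on the chart. *)
Definition hco c (w : tangent xi) : 'rV[R]_n := lsubmx (w (tchart c)).

Definition vco c (w : tangent xi) : 'rV[R]_n :=
  rsubmx (w (tchart c)) + gamma nabla c p (hco c w) (tvect xi c).

Lemma hco_change (w : tangent xi) c c' : is_chart c -> cdom c p -> is_chart c' -> cdom c' p ->
  hco c' w = 'D_(hco c w) (transition c c') (c p).
Proof. by move=> *; rewrite /hco (tangent_bundle_change w (c := c))// row_mxKl. Qed.

(** The second derivative of the transition map in the fibre components of [w] is the inhomogeneous
    term of [gamma_transition], and the two combine into the transported connection term. *)
Lemma vco_change (w : tangent xi) c c' : is_chart c -> cdom c p -> is_chart c' -> cdom c' p ->
  vco c' w = 'D_(vco c w) (transition c c') (c p).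
Proof.
move=> hc cp hc' c'p; rewrite /vco (hco_change w hc cp hc' c'p).
rewrite (tangent_bundle_change w hc cp hc' c'p) row_mxKr.
rewrite (tangent_change (tvect xi) hc cp hc' c'p).
have [oV sV] := is_chart_compat hc hc'.
have dt : differentiable (transition c c') (c p) by apply: smooth_on_diff sV _; exists p.
rewrite (deriveDv _ _ dt) (gamma_transition nabla _ _ hc cp hc' c'p) -/(hco c w) -addrA.
by [].
Qed.

Lemma hcoD c (u v : tangent xi) : hco c (u + v) = hco c u + hco c v.
Proof. by rewrite /hco tcompD; apply/rowP => i; rewrite !mxE. Qed.

Lemma hcoZ c a (v : tangent xi) : hco c (a *: v) = a *: hco c v.
Proof. by rewrite /hco tcompZ; apply/rowP => i; rewrite !mxE. Qed.

Lemma hcoN c (v : tangent xi) : hco c (- v) = - hco c v.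
Proof. by rewrite -scaleN1r hcoZ scaleN1r. Qed.

Lemma hco0 c : hco c (0 : tangent xi) = 0.
Proof. by rewrite -[0 in LHS](scale0r 0) hcoZ scale0r. Qed.

Lemma hco_sum c (I : Type) (r : seq I) (P : pred I) (v : I -> tangent xi) :
  hco c (\sum_(i <- r | P i) v i) = \sum_(i <- r | P i) hco c (v i).
Proof. by apply: (big_morph _ (hcoD c) (hco0 c)). Qed.

Lemma vcoD c (u v : tangent xi) : vco c (u + v) = vco c u + vco c v.
Proof.
rewrite /vco hcoD gammaDl tcompD addrACA; congr (_ + _).
by apply/rowP => i; rewrite !mxE.
Qed.

Lemma gammaZl c q a u v : gamma nabla c q (a *: u) v = a *: gamma nabla c q u v.
Proof.
rewrite /gamma scaler_sumr; apply: eq_bigr => i _; rewrite scaler_sumr.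
by apply: eq_bigr => j _; rewrite mxE scalerA mulrA.
Qed.

Lemma vcoZ c a (v : tangent xi) : vco c (a *: v) = a *: vco c v.
Proof.
rewrite /vco hcoZ gammaZl tcompZ scalerDr; congr (_ + _).
by apply/rowP => i; rewrite !mxE.
Qed.

Lemma vcoN c (v : tangent xi) : vco c (- v) = - vco c v.
Proof. by rewrite -scaleN1r vcoZ scaleN1r. Qed.

Lemma vco0 c : vco c (0 : tangent xi) = 0.
Proof. by rewrite -[0 in LHS](scale0r 0) vcoZ scale0r. Qed.

Lemma vco_sum c (I : Type) (r : seq I) (P : pred I) (v : I -> tangent xi) :
  vco c (\sum_(i <- r | P i) v i) = \sum_(i <- r | P i) vco c (v i).
Proof. by apply: (big_morph _ (vcoD c) (vco0 c)). Qed.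

Lemma tangent_bundle_eq c (u v : tangent xi) : is_chart c -> cdom c p ->
  hco c u = hco c v -> vco c u = vco c v -> u = v.
Proof.
move=> hc cp huv; rewrite /vco huv => /addIr ruv.
apply: (tangent_eq (is_chart_tchart hc) (cdom_tchart hc cp)).
by rewrite -[LHS]hsubmxK -[RHS]hsubmxK ruv -/(hco c u) huv.
Qed.

Lemma HcoframeE c i (w : tangent xi) : Hcoframe c i w = hco c w 0 i.
Proof. by rewrite mxE. Qed.

Lemma VcoframeE c i (w : tangent xi) : Vcoframe nabla c i w = vco c w 0 i.
Proof.
rewrite /Vcoframe /vco [in RHS]mxE [in RHS]mxE addrC; congr (_ + _).
rewrite /gamma summxE; apply: eq_bigr => j _; rewrite summxE; apply: eq_bigr => k _.
by rewrite !mxE /christoffel mulrC mulrAC mulrA.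
Qed.

Lemma gamma_deltal c q i v : gamma nabla c q (delta_mx 0 i) v =
  \sum_j v 0 j *: nabla (coord_vf c i) (coord_vf c j) q c.
Proof.
rewrite /gamma (bigD1 i)//= [X in _ + X]big1 ?addr0 => [|k ki]; last first.
  by rewrite big1// => j _; rewrite !mxE (negbTE ki) andbF mul0r scale0r.
by apply: eq_bigr => j _; rewrite !mxE !eqxx mul1r.
Qed.

Section frame.
Variables (c : chart R n M).
Hypotheses (hc : is_chart c) (cp : cdom c p).

Let tcE k : coord_vf (tchart c : chart _ _ (tangent_bundle M)) k xi (tchart c) = delta_mx 0 k.
Proof. exact: coord_vf_comp (is_chart_tchart hc) (cdom_tchart hc cp). Qed.

Lemma hco_coord_lshift i : hco c (coord_vf (tchart c : chart R (n + n) (tangent_bundle M)) (lshift n i) xi) = delta_mx 0 i.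
Proof. by rewrite /hco tcE; apply/rowP => j; rewrite !mxE eq_lshift. Qed.

Lemma hco_coord_rshift i : hco c (coord_vf (tchart c : chart R (n + n) (tangent_bundle M)) (rshift n i) xi) = 0.
Proof. by rewrite /hco tcE; apply/rowP => j; rewrite !mxE eq_lrshift andbF. Qed.

Lemma vco_coord_lshift i :
  vco c (coord_vf (tchart c : chart R (n + n) (tangent_bundle M)) (lshift n i) xi) = gamma nabla c p (delta_mx 0 i) (tvect xi c).
Proof.
rewrite /vco hco_coord_lshift tcE -[RHS]add0r; congr (_ + _).
by apply/rowP => j; rewrite !mxE eq_rlshift andbF.
Qed.

Lemma vco_coord_rshift i : vco c (coord_vf (tchart c : chart R (n + n) (tangent_bundle M)) (rshift n i) xi) = delta_mx 0 i.
Proof.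
rewrite /vco hco_coord_rshift tcE gamma0l addr0.
by apply/rowP => j; rewrite !mxE eq_rshift.
Qed.

Lemma hco_Hframe i : hco c (Hframe nabla c xi i) = delta_mx 0 i.
Proof.
rewrite /Hframe hcoD hcoN hco_coord_lshift hco_sum big1 ?subr0// => j _.
by rewrite hco_sum big1// => k _; rewrite hcoZ hco_coord_rshift scaler0.
Qed.

Lemma vco_Hframe i : vco c (Hframe nabla c xi i) = 0.
Proof.
rewrite /Hframe vcoD vcoN vco_coord_lshift vco_sum gamma_deltal -sumrB big1// => j _.
rewrite vco_sum [X in _ *: X - _](row_sum_delta (nabla _ _ p c)) scaler_sumr -sumrB big1// => k _.
by rewrite vcoZ vco_coord_rshift scalerA mulrC subrr.
Qed.

Lemma hco_Vframe i : hco c (Vframe c xi i) = 0.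
Proof. exact: hco_coord_rshift. Qed.

Lemma vco_Vframe i : vco c (Vframe c xi i) = delta_mx 0 i.
Proof. exact: vco_coord_rshift. Qed.

End frame.

Let a := chart_at p.
Let ha : is_chart a := atlas_chart (chart_at_atlas p).
Let ap : cdom a p := chart_at_dom p.

(** One computation for I, J and K: each is a sum of this shape with [s] equal to 1 or -1, and [L]
    stands for [hco] or [vco], on which the frames have coefficients 0 or 1. *)
Let combine (f g : 'I_n -> R) (X Y : 'I_n -> tangent xi) (x y : 'rV[R]_n) (s : R)
    (L : tangent xi -> 'rV[R]_n) :
  (forall u v, L (u + v) = L u + L v) -> (forall b u, L (b *: u) = b *: L u) ->
  (forall i, f i = x 0 i) -> (forall i, g i = y 0 i) ->
  forall e1 e2 : R, (forall i, L (X i) = e1 *: delta_mx 0 i) -> (forall i, L (Y i) = e2 *: delta_mx 0 i) ->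
  L (\sum_i (f i *: X i + s *: (g i *: Y i))) = e1 *: x + (s * e2) *: y.
Proof.
move=> LD LZ fx gy e1 e2 LX LY.
have L0 : L 0 = 0 by rewrite -[0 in LHS](scale0r 0) LZ scale0r.
rewrite (big_morph _ LD L0) [x in RHS]row_sum_delta [y in RHS]row_sum_delta !scaler_sumr -big_split.
apply: eq_bigr => i _; rewrite [RHS]/= LD !LZ LX LY fx gy !scalerA.
by congr (_ *: _ + _ *: _); [exact: mulrC|rewrite mulrAC].
Qed.

(** Both families obey the linear law of tangent vectors, so a proportionality seen in [chart_at]
    holds in every chart. This is how the induced structures become independent of the chart. *)
Let transport (F G : chart R n M -> 'rV[R]_n) c : is_chart c -> cdom c p ->
  (forall c c', is_chart c -> cdom c p -> is_chart c' -> cdom c' p ->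
     F c' = 'D_(F c) (transition c c') (c p)) ->
  (forall c c', is_chart c -> cdom c p -> is_chart c' -> cdom c' p ->
     G c' = 'D_(G c) (transition c c') (c p)) ->
  forall s : R, F a = s *: G a -> F c = s *: G c.
Proof.
move=> hc cp HF HG s FG; rewrite (HF a c)// (HG a c)// FG deriveZv//.
exact: chart_transition_diff.
Qed.

Section structure.
Variables (c : chart R n M) (w : tangent xi).
Hypotheses (hc : is_chart c) (cp : cdom c p).
Let S := induced_pq nabla.

Let at_chart_at (X Y : 'I_n -> tangent xi) (e1 e2 e3 e4 s : R) :
  (forall i, hco a (X i) = e1 *: delta_mx 0 i) -> (forall i, hco a (Y i) = e2 *: delta_mx 0 i) ->
  (forall i, vco a (X i) = e3 *: delta_mx 0 i) -> (forall i, vco a (Y i) = e4 *: delta_mx 0 i) ->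
  let v := \sum_i (Hcoframe a i w *: X i + s *: (Vcoframe nabla a i w *: Y i)) in
  hco a v = e1 *: hco a w + (s * e2) *: vco a w /\
  vco a v = e3 *: hco a w + (s * e4) *: vco a w.
Proof.
move=> h1 h2 h3 h4 v; rewrite /v.
have fH i : Hcoframe a i w = hco a w 0 i by exact: HcoframeE.
have fV i : Vcoframe nabla a i w = vco a w 0 i by exact: VcoframeE.
split.
  exact: (combine s (hcoD a) (hcoZ a) fH fV h1 h2).
exact: (combine s (vcoD a) (vcoZ a) fH fV h3 h4).
Qed.

Let hH i : hco a (Hframe nabla a xi i) = 1 *: delta_mx 0 i.
Proof. by rewrite scale1r hco_Hframe. Qed.
Let vH i : vco a (Hframe nabla a xi i) = 0 *: delta_mx 0 i.
Proof. by rewrite scale0r vco_Hframe. Qed.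
Let hV i : hco a (Vframe a xi i) = 0 *: delta_mx 0 i.
Proof. by rewrite scale0r hco_Vframe. Qed.
Let vV i : vco a (Vframe a xi i) = 1 *: delta_mx 0 i.
Proof. by rewrite scale1r vco_Vframe. Qed.

Let transport2 (v : tangent xi) (F G : forall c, tangent xi -> 'rV[R]_n) (e f : R) :
  (forall w c c', is_chart c -> cdom c p -> is_chart c' -> cdom c' p ->
     F c' w = 'D_(F c w) (transition c c') (c p)) ->
  (forall w c c', is_chart c -> cdom c p -> is_chart c' -> cdom c' p ->
     G c' w = 'D_(G c w) (transition c c') (c p)) ->
  hco a v = e *: F a w /\ vco a v = f *: G a w ->
  hco c v = e *: F c w /\ vco c v = f *: G c w.
Proof.
move=> HF HG [E1 E2]; split.
  exact: (transport hc cp (@hco_change v) (HF w) E1).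
exact: (transport hc cp (@vco_change v) (HG w) E2).
Qed.

Lemma pqI_coframe : hco c (pqI S w) = - vco c w /\ vco c (pqI S w) = hco c w.
Proof.
rewrite -[- vco c w]scaleN1r -[hco c w]scale1r.
apply: (transport2 (F := vco) (G := hco) vco_change hco_change).
have -> : pqI S w = \sum_i (Hcoframe a i w *: Vframe a xi i + (-1) *: (Vcoframe nabla a i w *: Hframe nabla a xi i)).
  by apply: eq_bigr => i _; rewrite scaleN1r.
have [-> ->] := at_chart_at (-1) hV hH vV vH.
by rewrite scale0r add0r mulr1 mulr0 scale0r addr0.
Qed.

Lemma pqJ_coframe : hco c (pqJ S w) = vco c w /\ vco c (pqJ S w) = hco c w.
Proof.
rewrite -[vco c w]scale1r -[hco c w]scale1r.
apply: (transport2 (F := vco) (G := hco) vco_change hco_change).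
have -> : pqJ S w = \sum_i (Hcoframe a i w *: Vframe a xi i + 1 *: (Vcoframe nabla a i w *: Hframe nabla a xi i)).
  by apply: eq_bigr => i _; rewrite scale1r.
have [-> ->] := at_chart_at 1 hV hH vV vH.
by rewrite scale0r add0r mulr1 mulr0 scale0r addr0.
Qed.

Lemma pqK_coframe : hco c (pqK S w) = hco c w /\ vco c (pqK S w) = - vco c w.
Proof.
rewrite -[X in _ = X /\ _]scale1r -[- vco c w]scaleN1r.
apply: (transport2 (F := hco) (G := vco) hco_change vco_change).
have -> : pqK S w = \sum_i (Hcoframe a i w *: Hframe nabla a xi i + (-1) *: (Vcoframe nabla a i w *: Vframe a xi i)).
  by apply: eq_bigr => i _; rewrite scaleN1r.
have [-> ->] := at_chart_at (-1) hH hV vH vV.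
by rewrite !mulr0 !scale0r addr0 add0r mulr1.
Qed.

End structure.

End lift.
End tangent_bundle_charts.

(** * Integrability of the para-quaternionic structure *)

Section constant_frame.
Context {R : realType} {n : nat} {N : smooth_structure R n}.
Implicit Types (c : chart R n N) (W : set N) (X Y : vfield N).

Lemma smooth_on_mulmxr (V : normedModType R) m k (A : set V) (f : V -> 'rV[R]_m)
    (Q : 'M[R]_(m, k)) : open A -> smooth_on A f -> smooth_on A (fun x => f x *m Q).
Proof.
move=> oA sf; apply/(smooth_on_rVP oA) => j.
apply: (smooth_on_eq oA (f := fun x => \sum_i f x 0 i * Q i j)) => [x _|]; first by rewrite mxE.
apply: smooth_on_bigsum => // i _; apply: smooth_onM => //; last exact: smooth_on_cst.
exact: (smooth_on_rVP oA _).1 sf i.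
Qed.

Lemma derive_mulmxr (V : normedModType R) m k (f : V -> 'rV[R]_m) (Q : 'M[R]_(m, k)) x v :
  differentiable f x -> 'D_v (fun x => f x *m Q) x = 'D_v f x *m Q.
Proof.
move=> df; have cQ : continuous (mulmxr Q : 'rV[R]_m -> 'rV[R]_k) by exact: mulmxr_continuous.
have dQ y : differentiable (mulmxr Q : 'rV[R]_m -> 'rV[R]_k) y by exact: linear_differentiable.
have -> : (fun x => f x *m Q) = (mulmxr Q : 'rV[R]_m -> 'rV[R]_k) \o f by [].
by rewrite (derive_comp v df (dQ (f x))) deriveE// diff_lin.
Qed.

(** The Nijenhuis tensor involves fields [A X] that are identified with frame fields only over a
    chart domain; locality of the bracket permits the substitution. *)
Lemma bracket_eq_on W X X' Y Y' p : open W -> W p ->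
  smooth_vfield W X' -> smooth_vfield W Y' ->
  (forall q, W q -> X q = X' q) -> (forall q, W q -> Y q = Y' q) ->
  bracket X Y p = bracket X' Y' p.
Proof.
move=> oW Wp sX sY XX YY; have ac := chart_at_atlas p; have hc := atlas_chart ac.
have cp := chart_at_dom p; rewrite /bracket; set c := chart_at p in ac hc cp *.
have oA := open_chart_image hc oW; have Ap : (c @` (W `&` cdom c)) (c p) by exists p.
have E Z Z' : smooth_vfield W Z' -> (forall q, W q -> Z q = Z' q) ->
    'd (vcomp Z c) (c p) = 'd (vcomp Z' c) (c p) :> (_ -> _).
  move=> sZ ZZ; have ZE : {near c p, vcomp Z' c =1 vcomp Z c}.
    apply: (open_near oA Ap) => _ [q [Wq cq] <-]; rewrite /vcomp cmapK//.
    by rewrite ZZ.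
  exact: (near_eq_diff ZE (smooth_on_diff (sZ c hc) Ap)).2.
have tB (a b a' b' : 'rV[R]_n) : a = a' -> b = b' -> tvec c p (a - b) = tvec c p (a' - b').
  by move=> -> ->.
rewrite (XX p Wp).
rewrite (YY p Wp).
apply: tB.
  exact: (congr1 (@^~ (X' p c)) (E Y Y' sY YY)).
exact: (congr1 (@^~ (Y' p c)) (E X X' sX XX)).
Qed.

(** The transpose appears because components are rows while [frame_mx] stores images of basis
    vectors as columns. *)
Lemma endo_frame_mx (A : endo_field N) c p (w : tangent p) :
  (forall a (u v : tangent p), A p (a *: u + v) = a *: A p u + A p v) ->
  is_chart c -> cdom c p -> A p w c = w c *m (frame_mx A c p)^T.
Proof.
move=> linA hc cp.
have A0 : A p 0 = 0.
  by have := linA 1 0 0; rewrite !scale1r addr0 => /eqP; rewrite -subr_eq subrr => /eqP <-.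
have AD u v : A p (u + v) = A p u + A p v by have := linA 1 u v; rewrite !scale1r.
have AZ a u : A p (a *: u) = a *: A p u by have := linA a u 0; rewrite !addr0 A0 addr0.
rewrite [in LHS](tangent_sum_coord w hc cp) (big_morph _ AD A0) tcomp_sum.
apply/rowP => i; rewrite summxE mxE; apply: eq_bigr => j _.
by rewrite AZ tcompZ !mxE.
Qed.

(** Right multiplication by a constant matrix [Q] commutes with directional derivatives, so the
    coordinate expressions of the four brackets cancel pairwise. *)
Lemma constant_frame_integrable (A : endo_field N) :
  (forall p a (u v : tangent p), A p (a *: u + v) = a *: A p u + A p v) ->
  (forall p, exists c P, [/\ is_chart c, cdom c p & forall q, cdom c q -> frame_mx A c q = P]) ->
  integrable_endo A.
Proof.
move=> linA HA W0 X Y oW0 sX0 sY0 p Wp0; have [c [P [hc cp HP]]] := HA p.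
pose W := W0 `&` cdom c; have oW : open W by apply: openI => //; exact: open_cdom.
have Wp : W p by [].
have sX : smooth_vfield W X by apply: smooth_vfieldS sX0; exact: subIsetl.
have sY : smooth_vfield W Y by apply: smooth_vfieldS sY0; exact: subIsetl.
have Wc : W `<=` cdom c by exact: subIsetr.
pose Q := P^T; pose AX (Z : vfield N) : vfield N := fun q => A q (Z q).
have AE q (w : tangent q) : cdom c q -> A q w c = w c *m Q.
  by move=> cq; rewrite (endo_frame_mx w (linA q) hc cq) HP.
have AXE Z x : (c @` W) x -> vcomp (AX Z) c x = vcomp Z c x *m Q.
  by move=> [q [_ cq] <-]; rewrite /vcomp cmapK// AE.
have WE : c @` (W `&` cdom c) = c @` W by congr (_ @` _); exact: setIidl.
have oA : open (c @` W) by rewrite -WE; exact: open_chart_image.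
have Ap : (c @` W) (c p) by exists p.
have sAX Z : smooth_vfield W Z -> smooth_vfield W (AX Z).
  move=> sZ; apply: (smooth_vfield_chart oW hc Wc).
  have sZc := sZ c hc; rewrite WE in sZc.
  by apply: (smooth_on_eq oA _ (smooth_on_mulmxr Q oA sZc)) => x Ax; rewrite AXE.
have D Z v : smooth_vfield W Z -> 'D_v (vcomp (AX Z) c) (c p) = 'D_v (vcomp Z c) (c p) *m Q.
  move=> sZ; rewrite (derive_eq_on oA v (AXE Z) Ap) derive_mulmxr//.
  by apply: smooth_on_diff (sZ c hc) _; rewrite WE.
have B Z T : smooth_vfield W Z -> smooth_vfield W T ->
    bracket Z T p c = 'D_(Z p c) (vcomp T c) (c p) - 'D_(T p c) (vcomp Z c) (c p).
  by move=> sZ sT; exact: (bracket_chart oW Wp sZ sT hc cp).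
have E1 := B _ _ sX sY; have E2 := B _ _ (sAX _ sX) sY.
have E3 := B _ _ sX (sAX _ sY); have E4 := B _ _ (sAX _ sX) (sAX _ sY).
rewrite (D _ _ sX) in E2; rewrite (D _ _ sY) in E3; rewrite (D _ _ sX) (D _ _ sY) in E4.
apply: (tangent_eq hc cp); rewrite /nijenhuis -/(AX X) -/(AX Y).
move: E1 E2 E3 E4.
move: (bracket X Y p) (bracket (AX X) Y p) (bracket X (AX Y) p) (bracket (AX X) (AX Y) p).
move=> b1 b2 b3 b4 E1 E2 E3 E4.
rewrite tcompD tcompB !AE// tcompD E1 E2 E3 E4 !mulmxDl !mulNmx.
move: ('D_(X p c) _ _ *m Q) ('D_(Y p c) _ _ *m Q) ('D_(AX X p c) _ _) ('D_(AX Y p c) _ _).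
move=> a b d e; have alg (a' b' d' e' : 'rV[R]_n) : a' - b' - (d' - b' + (a' - e')) + (d' - e') = 0.
  by apply/rowP => i; rewrite !mxE; ring.
exact: alg.
Qed.

End constant_frame.

Section para_quaternionic.
Context {R : realType} {n : nat} {M : smooth_structure R n} (nabla : connection M).
Let TM := tangent_bundle M.
Let S := induced_pq nabla.

Lemma pq_linear (xi : TM) a (u v : tangent xi) :
  [/\ pqI S (a *: u + v) = a *: pqI S u + pqI S v,
      pqJ S (a *: u + v) = a *: pqJ S u + pqJ S v &
      pqK S (a *: u + v) = a *: pqK S u + pqK S v].
Proof.
set c := chart_at (tproj xi).
have hc : is_chart c := atlas_chart (chart_at_atlas (tproj xi)).
have cp : cdom c (tproj xi) := chart_at_dom (tproj xi).
have II w := pqI_coframe nabla w hc cp.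
have JJ w := pqJ_coframe nabla w hc cp.
have KK w := pqK_coframe nabla w hc cp.
split; apply: (tangent_bundle_eq (nabla := nabla) hc cp).
- by rewrite hcoD hcoZ !(II _).1 vcoD vcoZ opprD scalerN.
- by rewrite vcoD vcoZ !(II _).2 hcoD hcoZ.
- by rewrite hcoD hcoZ !(JJ _).1 vcoD vcoZ.
- by rewrite vcoD vcoZ !(JJ _).2 hcoD hcoZ.
- by rewrite hcoD hcoZ !(KK _).1 hcoD hcoZ.
- by rewrite vcoD vcoZ !(KK _).2 vcoD vcoZ opprD scalerN.
Qed.

Lemma pq_integrable_individually : pq_integrable S -> pq_individually_integrable S.
Proof.
move=> HS; split; apply: constant_frame_integrable.
- by move=> p a u v; have [] := pq_linear a u v.
- by move=> p; have [c [hc cp Hc]] := HS p; eexists; eexists; split; [exact: hc|exact: cp|move=> q /Hc[E _ _]; exact: E].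
- by move=> p a u v; have [] := pq_linear a u v.
- by move=> p; have [c [hc cp Hc]] := HS p; eexists; eexists; split; [exact: hc|exact: cp|move=> q /Hc[_ E _]; exact: E].
- by move=> p a u v; have [] := pq_linear a u v.
- by move=> p; have [c [hc cp Hc]] := HS p; eexists; eexists; split; [exact: hc|exact: cp|move=> q /Hc[_ _ E]; exact: E].
Qed.

(** Where the connection coefficients vanish, the frame of the [H_i] and [V_i] is the coordinate
    frame of [tchart c], and [hco] and [vco] are the two halves of a component row. *)
Lemma affine_pq_integrable :
  (forall p, exists2 c, affine_chart nabla c & cdom c p) -> pq_integrable S.
Proof.
move=> aff xi; have [c [hc c0] cp] := aff (tproj xi).
exists (tchart c : chart R (n + n) TM); split; [exact: is_chart_tchart|by []|].
move=> q [_ cq].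
have wE (w : tangent q) : w (tchart c) = row_mx (hco c w) (vco nabla c w).
  by rewrite /vco c0// addr0 hsubmxK.
have cl i := vco_coord_lshift nabla hc cq i.
have cl' i : vco nabla c (coord_vf (tchart c : chart R (n + n) TM) (lshift n i) q) = 0 by rewrite cl c0.
have cr i := vco_coord_rshift nabla hc cq i.
have hl i := hco_coord_lshift hc cq i.
have hr i := hco_coord_rshift hc cq i.
split; apply/matrixP => k l; rewrite -(splitK k) -(splitK l) mxE wE;
  case: (fintype.split k) => i; case: (fintype.split l) => j /=;
  rewrite ?block_mxEul ?block_mxEur ?block_mxEdl ?block_mxEdr ?row_mxEl ?row_mxEr.
- by rewrite (pqI_coframe nabla _ hc cq).1 cl' oppr0 !mxE.
- by rewrite (pqI_coframe nabla _ hc cq).1 cr !mxE.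
- by rewrite (pqI_coframe nabla _ hc cq).2 hl !mxE.
- by rewrite (pqI_coframe nabla _ hc cq).2 hr !mxE.
- by rewrite (pqJ_coframe nabla _ hc cq).1 cl' !mxE.
- by rewrite (pqJ_coframe nabla _ hc cq).1 cr !mxE.
- by rewrite (pqJ_coframe nabla _ hc cq).2 hl !mxE.
- by rewrite (pqJ_coframe nabla _ hc cq).2 hr !mxE.
- by rewrite (pqK_coframe nabla _ hc cq).1 hl !mxE.
- by rewrite (pqK_coframe nabla _ hc cq).1 hr !mxE.
- by rewrite (pqK_coframe nabla _ hc cq).2 cl' oppr0 !mxE.
- by rewrite (pqK_coframe nabla _ hc cq).2 cr !mxE.
Qed.

End para_quaternionic.

(** * From the Nijenhuis tensors to torsion and curvature coefficients *)

Section individually_integrable_flat.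
Context {R : realType} {n : nat} {M : smooth_structure R n} (nabla : connection M).
Let TM := tangent_bundle M.
Let S := induced_pq nabla.

Lemma smooth_lincomb (V : normedModType R) m k (A : set V) (s : 'I_k -> V -> R^o)
    (f : 'I_k -> V -> 'rV[R]_m) : open A -> (forall i, smooth_on A (s i)) ->
  (forall i, smooth_on A (f i)) -> smooth_on A (fun z => \sum_i s i z *: f i z).
Proof.
move=> oA ss sf; apply/(smooth_on_rVP oA) => j.
apply: (smooth_on_eq oA (f := fun z => \sum_i s i z * f i z 0 j)) => [z _|].
  by rewrite summxE; apply: eq_bigr => i _; rewrite mxE.
apply: smooth_on_bigsum => // i _; apply: smooth_onM => //.
exact: (smooth_on_rVP oA _).1 (sf i) j.
Qed.

Lemma derive_lincomb (V : normedModType R) m k (A : set V) (s : 'I_k -> V -> R^o)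
    (f : 'I_k -> V -> 'rV[R]_m) z w : open A -> A z -> (forall i, smooth_on A (s i)) ->
  (forall i, smooth_on A (f i)) ->
  'D_w (fun z => \sum_i s i z *: f i z) z =
  \sum_i ('D_w (s i) z *: f i z + s i z *: 'D_w (f i) z).
Proof.
move=> oA Az ss sf; apply/rowP => j.
have sj i : smooth_on A (fun z => f i z 0 j : R^o) by exact: (smooth_on_rVP oA _).1 (sf i) j.
apply: (etrans (derive_rV w j (smooth_on_diff (smooth_lincomb oA ss sf) Az))).
have -> : (fun y => (\sum_i s i y *: f i y) 0 j : R^o) = \sum_i (s i * (fun z => f i z 0 j : R^o)).
  by apply/funext => y; rewrite fct_sumE summxE; apply: eq_bigr => i _; rewrite mxE.
have ds i : derivable (s i) z w by exact: smooth_on_derivable (ss i) Az.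
have dj i : derivable (fun z => f i z 0 j : R^o) z w by exact: smooth_on_derivable (sj i) Az.
rewrite derive_sum; last by move=> i; exact: derivableM.
rewrite summxE; apply: eq_bigr => i _; rewrite (deriveM (ds i) (dj i)) addrC !mxE.
rewrite (derive_rV w j (smooth_on_diff (sf i) Az)); congr (_ + _); exact: mulrC.
Qed.

Variable c : chart R n M.
Hypothesis hc : is_chart c.
Let tc : chart R (n + n) TM := tchart c.
Let htc : is_chart tc. Proof. exact: is_chart_tchart. Qed.
Let U : set 'rV[R]_(n + n) := tc @` cdom tc.
Let oU : open U. Proof. exact: cimg_open. Qed.
Let N i j := vcomp (nabla (coord_vf c i) (coord_vf c j)) c.

Let Ul z : U z -> (c @` cdom c) (lsubmx z).
Proof. by move=> [xi [_ cx] <-]; exists (tproj xi) => //; rewrite row_mxKl. Qed.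

Let sN i j : smooth_on U (N i j \o lsubmx).
Proof.
apply: (smooth_on_comp oU (@cimg_open _ _ _ c) Ul); last exact: smooth_gamma_coord.
exact: smooth_lsubmx.
Qed.

(** The connection term of [H_i] as a function of the coordinates of TM; [h i] below is then the
    component row of [H_i], which allows it to be differentiated as a smooth field. *)
Let g i (z : 'rV[R]_(n + n)) := \sum_k rsubmx z 0 k *: N i k (lsubmx z).

Let sr k : smooth_on U (fun z : 'rV[R]_(n + n) => rsubmx z 0 k : R^o).
Proof. exact: (smooth_on_rVP oU _).1 (smooth_rsubmx oU) k. Qed.

Let sg i : smooth_on U (g i).
Proof. exact: (smooth_lincomb oU sr (sN i)). Qed.

Let sNg i : smooth_on U (fun z => - g i z).
Proof.
apply/(smooth_on_rVP oU) => j; have := smooth_onN oU ((smooth_on_rVP oU _).1 (sg i) j).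
by apply: smooth_on_eq => // x _; rewrite mxE.
Qed.

Let Dg i z w : U z -> 'D_w (g i) z =
  \sum_k (rsubmx w 0 k *: N i k (lsubmx z) + rsubmx z 0 k *: 'D_(lsubmx w) (N i k) (lsubmx z)).
Proof.
move=> Uz; rewrite (derive_lincomb w oU Uz sr (sN i)); apply: eq_bigr => k _.
have dl := smooth_on_diff (@smooth_lsubmx R n n _ oU) Uz.
have dr := smooth_on_diff (@smooth_rsubmx R n n _ oU) Uz.
have dN : differentiable (N i k) (lsubmx z).
  by apply: smooth_on_diff (Ul Uz); exact: smooth_gamma_coord.
rewrite (derive_comp w dl dN) derive_lsubmx.
by rewrite -(derive_rV w k dr) derive_rsubmx.
Qed.

Let h i z := row_mx (delta_mx 0 i) (- g i z) : 'rV[R]_(n + n).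

Let Dh i z w : U z -> 'D_w (h i) z = row_mx 0 (- 'D_w (g i) z).
Proof.
move=> Uz; rewrite (derive_row_mx w (f := cst (delta_mx 0 i)) (g := fun z => - g i z)).
- by rewrite derive_cst deriveN//; exact: smooth_on_derivable (sg i) Uz.
- exact: differentiable_cst.
- exact: smooth_on_diff (sNg i) Uz.
Qed.

Let Hf i : vfield TM := fun xi => tvec tc xi (h i (tc xi)).
Let Vf i : vfield TM := const_vf tc (row_mx 0 (delta_mx 0 i)).

Let vcompH i z : U z -> vcomp (Hf i) tc z = h i z.
Proof. by move=> [xi cx <-]; rewrite /vcomp cmapK// /Hf tvec_comp. Qed.

Let sH i : smooth_vfield (cdom tc) (Hf i).
Proof.
apply: (smooth_vfield_chart (open_cdom htc) htc) => //.
apply: (smooth_on_eq oU (f := h i)) => [z Uz|]; first by rewrite vcompH.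
apply: smooth_row_mx => //; exact: smooth_on_cst.
Qed.

Let sV i : smooth_vfield (cdom tc) (Vf i).
Proof. exact: smooth_const_vf. Qed.

Let vcompV i z : U z -> vcomp (Vf i) tc z = row_mx 0 (delta_mx 0 i).
Proof. exact: vcomp_const_vf. Qed.

Section at_point.
Variables (xi : TM).
Hypothesis cx : cdom tc xi.
Let p := tproj xi.
Let y := tvect xi c.
Let cp : cdom c p. Proof. by case: cx. Qed.
Let Ux : U (tc xi). Proof. by exists xi. Qed.
Let lx : lsubmx (tc xi) = c p. Proof. exact: row_mxKl. Qed.
Let rx : rsubmx (tc xi) = y. Proof. exact: row_mxKr. Qed.

Let gE i : g i (tc xi) = gamma nabla c p (delta_mx 0 i) y.
Proof.
rewrite gamma_deltal /g; apply: eq_bigr => k _.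
by rewrite rx lx /N /vcomp cmapK.
Qed.

Let hcoH i : hco c (Hf i xi) = delta_mx 0 i.
Proof. by rewrite /hco /Hf tvec_comp// row_mxKl. Qed.

Let vcoH i : vco nabla c (Hf i xi) = 0.
Proof. by rewrite /vco hcoH /Hf tvec_comp// row_mxKr gE addNr. Qed.

Let hcoV i : hco c (Vf i xi) = 0.
Proof. by rewrite /hco /Vf /const_vf tvec_comp// row_mxKl. Qed.

Let vcoV i : vco nabla c (Vf i xi) = delta_mx 0 i.
Proof. by rewrite /vco hcoV gamma0l addr0 /Vf /const_vf tvec_comp// row_mxKr. Qed.

Lemma pqK_Hf i : pqK S (Hf i xi) = Hf i xi.
Proof.
apply: (tangent_bundle_eq (nabla := nabla) hc cp).
  by rewrite (pqK_coframe nabla _ hc cp).1.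
by rewrite (pqK_coframe nabla _ hc cp).2 vcoH oppr0.
Qed.

Lemma pqJ_Hf i : pqJ S (Hf i xi) = Vf i xi.
Proof.
apply: (tangent_bundle_eq (nabla := nabla) hc cp).
  by rewrite (pqJ_coframe nabla _ hc cp).1 vcoH hcoV.
by rewrite (pqJ_coframe nabla _ hc cp).2 hcoH vcoV.
Qed.

Lemma bracket_HH i j : bracket (Hf i) (Hf j) xi tc =
  row_mx 0 ('D_(h j (tc xi)) (g i) (tc xi) - 'D_(h i (tc xi)) (g j) (tc xi)).
Proof.
rewrite (bracket_chart (open_cdom htc) cx (sH i) (sH j) htc cx).
rewrite (derive_eq_on oU _ (vcompH j) Ux) (derive_eq_on oU _ (vcompH i) Ux) !Dh//.
rewrite /Hf !tvec_comp// opp_row_mx add_row_mx oppr0 addr0 opprK; congr row_mx.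
exact: addrC.
Qed.

Lemma bracket_VH i j : bracket (Vf i) (Hf j) xi tc = row_mx 0 (- N j i (c p)).
Proof.
rewrite (bracket_chart (open_cdom htc) cx (sV i) (sH j) htc cx).
rewrite (derive_eq_on oU _ (vcompH j) Ux) Dh//.
rewrite (derive_eq_on oU _ (g := cst (row_mx 0 (delta_mx 0 i))) (vcompV i) Ux) derive_cst subr0.
rewrite /Vf /const_vf tvec_comp// Dg// lx rx row_mxKl row_mxKr; congr row_mx; congr (- _).
rewrite (bigD1 i)//= big1 ?addr0 => [|k ki].
  by rewrite mxE !eqxx scale1r derive0 scaler0 addr0.
by rewrite mxE (negbTE ki) andbF scale0r derive0 scaler0 addr0.
Qed.

Lemma bracket_HV i j : bracket (Hf i) (Vf j) xi tc = row_mx 0 (N i j (c p)).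
Proof.
have -> : bracket (Hf i) (Vf j) xi tc = - bracket (Vf j) (Hf i) xi tc.
  rewrite (bracket_chart (open_cdom htc) cx (sH i) (sV j) htc cx).
  by rewrite (bracket_chart (open_cdom htc) cx (sV j) (sH i) htc cx) opprB.
by rewrite bracket_VH opp_row_mx oppr0 opprK.
Qed.

Lemma bracket_VV i j : bracket (Vf i) (Vf j) xi tc = 0.
Proof.
rewrite (bracket_chart (open_cdom htc) cx (sV i) (sV j) htc cx).
rewrite (derive_eq_on oU _ (g := cst (row_mx 0 (delta_mx 0 i))) (vcompV i) Ux) derive_cst.
by rewrite (derive_eq_on oU _ (g := cst (row_mx 0 (delta_mx 0 j))) (vcompV j) Ux) derive_cst subr0.
Qed.

Lemma vco_bracket_HH i j : vco nabla c (bracket (Hf i) (Hf j) xi) =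
  'D_(h j (tc xi)) (g i) (tc xi) - 'D_(h i (tc xi)) (g j) (tc xi).
Proof. by rewrite /vco /hco bracket_HH row_mxKl row_mxKr gamma0l addr0. Qed.

End at_point.

Section at_point.
Variables (xi : TM).
Hypothesis cx : cdom tc xi.
Let p := tproj xi.
Let cp : cdom c p. Proof. by case: cx. Qed.
Let oW : open (cdom tc). Proof. exact: open_cdom. Qed.

(** [K] fixes the fields [Hf], so all brackets in the Nijenhuis tensor are [[H_i, H_j]]. As [K]
    negates vertical parts, the vertical part of the tensor is four times that of this bracket. *)
Lemma integrable_K_curvature i j : integrable_endo (pqK S) ->
  'D_(h j (tc xi)) (g i) (tc xi) = 'D_(h i (tc xi)) (g j) (tc xi).
Proof.
move=> /(_ _ _ _ oW (sH i) (sH j) xi cx); rewrite /nijenhuis.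
have E1 := bracket_eq_on oW cx (sH i) (sH j) (fun q cq => pqK_Hf cq i) (fun q cq => erefl (Hf j q)).
have E2 := bracket_eq_on oW cx (sH i) (sH j) (fun q cq => erefl (Hf i q)) (fun q cq => pqK_Hf cq j).
have E3 := bracket_eq_on oW cx (sH i) (sH j) (fun q cq => pqK_Hf cq i) (fun q cq => pqK_Hf cq j).
rewrite E1 E2 E3 => /(congr1 (vco nabla c)); have := vco_bracket_HH cx i j.
move: (bracket _ _ _) => b Eb.
have KK w := (pqK_coframe nabla w hc cp).2.
rewrite vcoD vcoD vcoN !KK vcoD opprK vco0 Eb.
move: ('D_(h j (tc xi)) (g i) (tc xi)) ('D_(h i (tc xi)) (g j) (tc xi)) => d e /rowP H.
by apply/rowP => k; have := H k; rewrite !mxE; lra.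
Qed.

(** [J] exchanges horizontal and vertical coefficients and sends [H_i] to [V_i]. In the horizontal
    part of the tensor [[H_i, H_j]] and [[V_i, V_j]] contribute 0, and the mixed brackets contribute
    the two connection coefficients with opposite signs. *)
Lemma integrable_J_torsion i j : integrable_endo (pqJ S) -> N i j (c p) = N j i (c p).
Proof.
move=> /(_ _ _ _ oW (sH i) (sH j) xi cx); rewrite /nijenhuis.
have E1 := bracket_eq_on oW cx (sV i) (sH j) (fun q cq => pqJ_Hf cq i) (fun q cq => erefl (Hf j q)).
have E2 := bracket_eq_on oW cx (sH i) (sV j) (fun q cq => erefl (Hf i q)) (fun q cq => pqJ_Hf cq j).
have E3 := bracket_eq_on oW cx (sV i) (sV j) (fun q cq => pqJ_Hf cq i) (fun q cq => pqJ_Hf cq j).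
rewrite E1 E2 E3 => /(congr1 (hco c)).
have J1 w := (pqJ_coframe nabla w hc cp).1; have J2 w := (pqJ_coframe nabla w hc cp).2.
rewrite hcoD hcoD hcoN !J1 J2 vcoD hco0.
have -> : hco c (bracket (Hf i) (Hf j) xi) = 0 by rewrite /hco (bracket_HH cx) row_mxKl.
have -> : hco c (bracket (Vf i) (Vf j) xi) = 0.
  by rewrite /hco (bracket_VV cx); apply/rowP => k; rewrite !mxE.
have -> : vco nabla c (bracket (Vf i) (Hf j) xi) = - N j i (c p).
  by rewrite /vco /hco (bracket_VH cx) row_mxKl row_mxKr gamma0l addr0.
have -> : vco nabla c (bracket (Hf i) (Vf j) xi) = N i j (c p).
  by rewrite /vco /hco (bracket_HV cx) row_mxKl row_mxKr gamma0l addr0.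
move/eqP; rewrite add0r addr0 oppr_eq0 addrC subr_eq0 => /eqP; exact.
Qed.

End at_point.

Lemma individually_integrable_flat_coefficients :
  pq_individually_integrable S -> flat_coefficients nabla c.
Proof.
move=> [_ HJ HK] p cp; split=> [i j|i j k].
  (* The torsion identity involves [p] only, so any point of the fibre serves. *)
  pose xi : total_space M := existT _ p (0 : tangent p).
  have cx : cdom tc (xi : TM) by [].
  exact: (integrable_J_torsion cx i j HJ).
(* The vertical part of [[H_i, H_j]] is linear in the fibre coordinate; the fibre point [d_k]
   extracts the curvature applied to [d_k]. *)
pose xi0 : total_space M := existT _ p (tvec c p (delta_mx 0 k)).
pose xi : TM := xi0; have cx : cdom tc xi by [].
have Ux : U (tc xi) by exists xi.
have lx : lsubmx (tc xi) = c p by exact: row_mxKl.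
have rx : rsubmx (tc xi) = delta_mx 0 k by rewrite [LHS]row_mxKr /= [LHS]tvec_comp.
have gE a : g a (tc xi) = N a k (c p).
  rewrite /g rx lx (bigD1 k)//= big1 ?addr0 => [|l lk]; first by rewrite mxE !eqxx scale1r.
  by rewrite mxE (negbTE lk) andbF scale0r.
(* The base half of [h a] differentiates the coefficients; its fibre half, minus the connection
   term, yields the quadratic term of the curvature. *)
have DE a b : 'D_(h a (tc xi)) (g b) (tc xi) =
    'D_(delta_mx 0 a) (N b k) (c p) - gamma nabla c p (delta_mx 0 b) (N a k (c p)).
  rewrite Dg// lx rx /h row_mxKl row_mxKr gE gamma_deltal big_split /= addrC; congr (_ + _).
    rewrite (bigD1 k)//= big1 ?addr0 => [|l lk]; first by rewrite mxE !eqxx scale1r.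
    by rewrite mxE (negbTE lk) andbF scale0r.
  rewrite -sumrN; apply: eq_bigr => l _.
  by rewrite mxE scaleNr /N !vcomp_cmap.
have := integrable_K_curvature cx j i HK; rewrite !DE => /eqP.
rewrite subr_eq addrAC eq_sym subr_eq => /eqP; rewrite -/(N _ _) -/(N _ _) => E.
by rewrite [RHS]E.
Qed.

End individually_integrable_flat.

(** * Closedness of the two-form *)

Section bilinear_fields.
Context {R : realType} {m : nat} {N : smooth_structure R m}.

Definition bil k l (A : 'M[R]_(k, l)) (u : 'rV[R]_k) (v : 'rV[R]_l) : R := (u *m A *m v^T) 0 0.

Lemma bilE k l (A : 'M[R]_(k, l)) u v : bil A u v = \sum_a \sum_b A a b * (u 0 a * v 0 b).
Proof.
rewrite /bil mxE exchange_big; apply: eq_bigr => b _; rewrite !mxE mulr_suml.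
by apply: eq_bigr => a _; rewrite mulrCA mulrA mulrAC.
Qed.

Lemma bilBl k l (A : 'M[R]_(k, l)) u u' v : bil A (u - u') v = bil A u v - bil A u' v.
Proof. by rewrite /bil !mulmxBl !mxE. Qed.

Lemma bil_tr k l (A : 'M[R]_(k, l)) u v : bil A^T v u = bil A u v.
Proof.
rewrite !bilE exchange_big; apply: eq_bigr => a _; apply: eq_bigr => b _.
by rewrite mxE; congr (_ * _); exact: mulrC.
Qed.

Lemma bilN k l (A : 'M[R]_(k, l)) u v : bil (- A) u v = - bil A u v.
Proof. by rewrite /bil mulmxN mulNmx mxE. Qed.

(** The algebra behind the coordinate formula of [d w]: here [dxy] stands for the derivative of [Y]
    along [X], and antisymmetry cancels all derivatives of fields against the bracket terms. *)
Lemma bil_cancel k (A : 'M[R]_k) (x y z dxy dxz dyx dyz dzx dzy : 'rV[R]_k) (a b d : R) :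
  A^T = - A ->
  a + (bil A dxy z + bil A y dxz) - (b + (bil A dyx z + bil A x dyz))
    + (d + (bil A dzx y + bil A x dzy)) - bil A (dxy - dyx) z + bil A (dxz - dzx) y
    - bil A (dyz - dzy) x = a - b + d.
Proof.
move=> asym; have anti u v : bil A u v = - bil A v u by rewrite -bil_tr asym bilN.
rewrite !bilBl (anti y dxz) (anti x dyz) (anti x dzy); ring.
Qed.

Lemma bil_block k l (B : 'M[R]_(k, l)) (C : 'M[R]_(l, k)) u v :
  bil (block_mx 0 B C 0) u v = bil B (lsubmx u) (rsubmx v) + bil C (rsubmx u) (lsubmx v).
Proof.
rewrite /bil -{1}(hsubmxK u) -{1}(hsubmxK v) mul_row_block !mulmx0 add0r addr0.
by rewrite tr_row_mx mul_row_col mxE addrC.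
Qed.

Lemma bil_delta k l (A : 'M[R]_(k, l)) i j : bil A (delta_mx 0 i) (delta_mx 0 j) = A i j.
Proof. by rewrite /bil -rowE trmx_delta -colE !mxE. Qed.

Definition Dmx k l n (A : 'rV[R]_n -> 'M[R]_(k, l)) x w : 'M[R]_(k, l) :=
  \matrix_(a, b) 'D_w (fun y => A y a b : R^o) x.

Lemma derive_bil n k l (U : set 'rV[R]_n) (A : 'rV[R]_n -> 'M[R]_(k, l)) f g x w :
  open U -> U x -> (forall a b, smooth_on U (fun y => A y a b : R^o)) ->
  smooth_on U f -> smooth_on U g ->
  'D_w (fun y => bil (A y) (f y) (g y) : R^o) x =
  bil (Dmx A x w) (f x) (g x) + (bil (A x) ('D_w f x) (g x) + bil (A x) (f x) ('D_w g x)).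
Proof.
move=> oU Ux sA sf sg.
have sfa a : smooth_on U (fun y => f y 0 a : R^o) by exact: (smooth_on_rVP oU _).1 sf a.
have sgb b : smooth_on U (fun y => g y 0 b : R^o) by exact: (smooth_on_rVP oU _).1 sg b.
have dA a b : derivable (fun y => A y a b : R^o) x w by exact: smooth_on_derivable (sA a b) Ux.
have df a : derivable (fun y => f y 0 a : R^o) x w by exact: smooth_on_derivable (sfa a) Ux.
have dg b : derivable (fun y => g y 0 b : R^o) x w by exact: smooth_on_derivable (sgb b) Ux.
pose F a b := (fun y => A y a b : R^o) * ((fun y => f y 0 a : R^o) * (fun y => g y 0 b : R^o)).
have dF a b : derivable (F a b) x w by apply: derivableM => //; exact: derivableM.
have -> : (fun y => bil (A y) (f y) (g y) : R^o) = \sum_a \sum_b F a b.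
  apply/funext => y; rewrite bilE fct_sumE; apply: eq_bigr => a _.
  by rewrite fct_sumE.
rewrite derive_sum; last by move=> a; exact: derivable_sum.
rewrite !bilE -big_split -big_split; apply: eq_bigr => a _.
rewrite derive_sum // [RHS]/= -big_split -big_split; apply: eq_bigr => b _.
rewrite (deriveM (dA a b) (derivableM (df a) (dg b))) (deriveM (df a) (dg b)) [RHS]/=.
rewrite -(derive_rV w a (smooth_on_diff sf Ux)) -(derive_rV w b (smooth_on_diff sg Ux)).
rewrite [Dmx _ _ _ _ _]mxE /GRing.scale /=.
move: ('D_w _ x) ('D_w f x 0 a) ('D_w g x 0 b) => d e h.
rewrite -[(_ * _ : _ -> _) x]/(f x 0 a * g x 0 b); ring.
Qed.

Lemma smooth_on_bil n k l (U : set 'rV[R]_n) (A : 'rV[R]_n -> 'M[R]_(k, l)) f g :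
  open U -> (forall a b, smooth_on U (fun y => A y a b : R^o)) ->
  smooth_on U f -> smooth_on U g -> smooth_on U (fun y => bil (A y) (f y) (g y) : R^o).
Proof.
move=> oU sA sf sg.
apply: (smooth_on_eq oU (f := fun y => \sum_a \sum_b A y a b * (f y 0 a * g y 0 b))).
  by move=> y _; rewrite bilE.
apply: smooth_on_bigsum => // a _; apply: smooth_on_bigsum => // b _.
apply: smooth_onM => //; apply: smooth_onM => //.
  exact: (smooth_on_rVP oU _).1 sf a.
exact: (smooth_on_rVP oU _).1 sg b.
Qed.

Section in_chart.
Variables (c : chart R m N) (w : bilin_field N) (Om : 'rV[R]_m -> 'M[R]_m).
Hypothesis hc : is_chart c.
Hypothesis sOm : forall a b, smooth_on (c @` cdom c) (fun y => Om y a b : R^o).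
Hypothesis wE : forall q (u v : tangent q), cdom c q -> w u v = bil (Om (c q)) (u c) (v c).

Lemma dfun_bilinear W (Y Z : vfield N) p (x : tangent p) : open W -> W p -> cdom c p ->
  smooth_vfield W Y -> smooth_vfield W Z ->
  dfun (fun q => w (Y q) (Z q)) x =
  bil (Dmx Om (c p) (x c)) (Y p c) (Z p c) +
  (bil (Om (c p)) ('D_(x c) (vcomp Y c) (c p)) (Z p c) +
   bil (Om (c p)) (Y p c) ('D_(x c) (vcomp Z c) (c p))).
Proof.
move=> oW0 Wp0 cp sY0 sZ0; pose W' := W `&` cdom c.
have oW : open W' by apply: openI => //; exact: open_cdom.
have Wp : W' p by [].
have sY : smooth_vfield W' Y by apply: smooth_vfieldS sY0; exact: subIsetl.
have sZ : smooth_vfield W' Z by apply: smooth_vfieldS sZ0; exact: subIsetl.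
have Wc : W' `<=` cdom c by exact: subIsetr.
have WE : c @` (W' `&` cdom c) = c @` W' by congr (_ @` _); exact: setIidl.
have oA : open (c @` W') by rewrite -WE; exact: open_chart_image.
have Ap : (c @` W') (c p) by exists p.
have sYc := sY c hc; have sZc := sZ c hc; rewrite WE in sYc sZc.
have sOA a b : smooth_on (c @` W') (fun y => Om y a b : R^o).
  by apply: smooth_onS (sOm a b); exact: image_subset.
have E y : (c @` W') y -> ((fun q => w (Y q) (Z q)) \o cinv c) y =
    bil (Om y) (vcomp Y c y) (vcomp Z c y).
  by move=> [q [_ cq] <-]; rewrite /= /vcomp cmapK// wE.
have sf : smooth_fun W' (fun q => w (Y q) (Z q)).
  apply: (smooth_fun_chart oW hc Wc).
  apply: (smooth_on_eq oA _ (smooth_on_bil oA sOA sYc sZc)) => y /E; exact: esym.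
rewrite (dfun_chart x oW Wp sf hc cp) (derive_eq_on oA (x c) E Ap).
by rewrite (derive_bil (x c) oA Ap sOA sYc sZc) !vcomp_cmap.
Qed.

Lemma ext_deriv_chart W (X Y Z : vfield N) p : open W -> W p -> cdom c p ->
  (forall y, (Om y)^T = - Om y) ->
  smooth_vfield W X -> smooth_vfield W Y -> smooth_vfield W Z ->
  ext_deriv w X Y Z p = bil (Dmx Om (c p) (X p c)) (Y p c) (Z p c)
    - bil (Dmx Om (c p) (Y p c)) (X p c) (Z p c) + bil (Dmx Om (c p) (Z p c)) (X p c) (Y p c).
Proof.
move=> oW Wp cp asym sX sY sZ; rewrite /ext_deriv.
rewrite (dfun_bilinear _ oW Wp cp sY sZ) (dfun_bilinear _ oW Wp cp sX sZ) (dfun_bilinear _ oW Wp cp sX sY).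
have := bracket_chart oW Wp sY sZ hc cp; have := bracket_chart oW Wp sX sZ hc cp.
have := bracket_chart oW Wp sX sY hc cp.
move: (bracket X Y p) (bracket X Z p) (bracket Y Z p) => B1 B2 B3 E1 E2 E3.
rewrite (wE B1 _ cp) (wE B2 _ cp) (wE B3 _ cp) E1 E2 E3.
exact: bil_cancel (asym (c p)).
Qed.

End in_chart.
End bilinear_fields.

(** Each primed argument occurs in exactly two terms, which have opposite signs and the same
    arguments up to order. *)
Lemma alternating_sum_symmetric (R : realType) (A : Type) (T : A -> A -> A -> R) :
  (forall u v w, T u v w = T v u w) -> (forall u v w, T u v w = T u w v) ->
  forall a b d a' b' d',
  T a b d' - T a b' d - (T b a d' - T b a' d) + (T d a b' - T d a' b) = 0.
Proof.
move=> T12 T23 a b d a' b' d'.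
have -> : T b a d' = T a b d' by exact: T12.
have -> : T a b' d = T d a b' by rewrite T23 T12.
have -> : T b a' d = T d a' b by rewrite T23 T12 T23.
by ring.
Qed.

(** * The metric in charts, the Hessian condition and the induced two-form *)

Section born.
Context {R : realType} {n : nat} {M : smooth_structure R n} (nabla : connection M)
  (g : riemannian_metric M).
Let TM := tangent_bundle M.
Implicit Types (c : chart R n M) (p : M).

Let G c x : 'M[R]_n := \matrix_(i, j) metric_coef g c i j (cinv c x).

Lemma metric_bil c p (u v : tangent p) : is_chart c -> cdom c p ->
  g p u v = bil (G c (c p)) (u c) (v c).
Proof.
move=> hc cp.
have g0 w : g p 0 w = 0.
  by have := metric_linear g 1 0 0 w; rewrite !scale1r addr0 mul1r => /eqP; rewrite -subr_eq subrr => /eqP <-.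
have gD u1 u2 w : g p (u1 + u2) w = g p u1 w + g p u2 w.
  by have := metric_linear g 1 u1 u2 w; rewrite scale1r mul1r.
have gZ a u1 w : g p (a *: u1) w = a * g p u1 w.
  by have := metric_linear g a u1 0 w; rewrite addr0 g0 addr0.
rewrite bilE {1}(tangent_sum_coord u hc cp).
rewrite (big_morph (fun u => g p u v) (id1 := 0) (op1 := +%R)); [|by move=> *; exact: gD|exact: g0].
apply: eq_bigr => i _; rewrite gZ Defs.metric_sym {1}(tangent_sum_coord v hc cp).
rewrite (big_morph (fun u => g p u (coord_vf c i p)) (id1 := 0) (op1 := +%R)); [|by move=> *; exact: gD|exact: g0].
rewrite mulr_sumr; apply: eq_bigr => j _.
by rewrite gZ Defs.metric_sym !mxE /metric_coef cmapK//; ring.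
Qed.

Lemma metric_mx_sym c x : (G c x)^T = G c x.
Proof. by apply/matrixP => i j; rewrite !mxE /metric_coef Defs.metric_sym. Qed.

Lemma smooth_metric_mx c i j : is_chart c -> smooth_on (c @` cdom c) (fun x => G c x i j : R^o).
Proof.
move=> hc; have oU : open (c @` cdom c) by exact: cimg_open.
have := metric_smooth g (open_cdom hc) (smooth_coord_vf i hc) (smooth_coord_vf j hc) hc.
by rewrite setIid => /(smooth_on_eq oU); apply => x _; rewrite mxE.
Qed.

Lemma Dmx_metric_lin c p u : is_chart c -> cdom c p ->
  Dmx (G c) (c p) u = \sum_i u 0 i *: Dmx (G c) (c p) (delta_mx 0 i).
Proof.
move=> hc cp; apply/matrixP => a b; rewrite mxE summxE derive_sum_delta.
  by apply: eq_bigr => i _; rewrite !mxE.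
by apply: smooth_on_diff (smooth_metric_mx a b hc) _; exists p.
Qed.

Lemma Dmx_metric_sym c x u : (Dmx (G c) x u)^T = Dmx (G c) x u.
Proof.
apply/matrixP => a b; rewrite !mxE; congr ('D_u _ x); apply/funext => y.
by rewrite -[in LHS]metric_mx_sym mxE.
Qed.

(* In an affine chart this is the total symmetry of [nabla g]. *)
Definition metric_codazzi c := forall p, cdom c p -> forall u v w,
  bil (Dmx (G c) (c p) u) v w = bil (Dmx (G c) (c p) v) u w.

Lemma metric_codazziP c : is_chart c ->
  (forall p, cdom c p -> forall i j k,
    Dmx (G c) (c p) (delta_mx 0 i) j k = Dmx (G c) (c p) (delta_mx 0 j) i k) ->
  metric_codazzi c.
Proof.
move=> hc H p cp u v w.
have E a b : bil (Dmx (G c) (c p) a) b w =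
    \sum_i \sum_j \sum_k a 0 i * b 0 j * w 0 k * Dmx (G c) (c p) (delta_mx 0 i) j k.
  rewrite bilE; transitivity (\sum_j \sum_k \sum_i a 0 i * b 0 j * w 0 k * Dmx (G c) (c p) (delta_mx 0 i) j k).
    apply: eq_bigr => j _; apply: eq_bigr => k _; rewrite Dmx_metric_lin// summxE mulr_suml.
    by apply: eq_bigr => i _; rewrite mxE; ring.
  rewrite [RHS]exchange_big; apply: eq_bigr => j _; exact: exchange_big.
rewrite !E exchange_big; apply: eq_bigr => i _; apply: eq_bigr => j _.
by apply: eq_bigr => k _; rewrite H// [v 0 i * _]mulrC.
Qed.

(** The covariant derivatives are plain derivatives of components here, so the correction terms
    remove exactly the derivatives of [Y] and [Z] from the product rule. *)
Lemma cov_metric_affine W (X Y Z : vfield M) c p : open W -> W p -> affine_chart nabla c ->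
  cdom c p -> smooth_vfield W X -> smooth_vfield W Y -> smooth_vfield W Z ->
  cov_metric nabla g X Y Z p = bil (Dmx (G c) (c p) (X p c)) (Y p c) (Z p c).
Proof.
move=> oW Wp [hc c0] cp sX sY sZ; rewrite /cov_metric.
have gE q (u v : tangent q) : cdom c q -> g q u v = bil (G c (c q)) (u c) (v c).
  by move=> cq; exact: metric_bil.
have -> := dfun_bilinear hc (fun a b => smooth_metric_mx a b hc) gE (X p) oW Wp cp sY sZ.
have E1 := cov_chart nabla oW Wp sX sY hc cp; have E2 := cov_chart nabla oW Wp sX sZ hc cp.
rewrite c0// addr0 in E1; rewrite c0// addr0 in E2.
rewrite (gE _ (nabla X Y p) _ cp) (gE _ _ (nabla X Z p) cp) E1 E2.
have alg (a b d : R) : a + (b + d) - b - d = a by ring.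
exact: alg.
Qed.

Lemma hessian_codazzi c : hessian nabla g -> affine_chart nabla c -> metric_codazzi c.
Proof.
move=> [_ H] ac; have hc := ac.1; apply: metric_codazziP => // p cp i j k.
have oW := open_cdom hc; have sd l := smooth_coord_vf l hc.
have [+ _] := H _ _ _ _ oW (sd i) (sd j) (sd k) p cp.
rewrite (cov_metric_affine oW cp ac cp (sd i) (sd j) (sd k)).
rewrite (cov_metric_affine oW cp ac cp (sd j) (sd i) (sd k)).
have ck l : coord_vf c l p c = delta_mx 0 l by exact: coord_vf_comp.
move: (coord_vf c i p) (coord_vf c j p) (coord_vf c k p) (ck i) (ck j) (ck k).
by move=> vi vj vk -> -> ->; rewrite 2!bil_delta.
Qed.

Lemma codazzi_hessian : flat nabla ->
  (forall p, exists c, [/\ affine_chart nabla c, cdom c p & metric_codazzi c]) ->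
  hessian nabla g.
Proof.
move=> fl H; split => // W X Y Z oW sX sY sZ p Wp; have [c [ac cp sym]] := H p.
rewrite (cov_metric_affine oW Wp ac cp sX sY sZ) (cov_metric_affine oW Wp ac cp sY sX sZ).
rewrite (cov_metric_affine oW Wp ac cp sX sZ sY); split; first exact: sym.
by rewrite -bil_tr Dmx_metric_sym.
Qed.

Lemma tvec_transport (xi : TM) (F : chart R n M -> 'rV[R]_n) c c' : is_chart c -> cdom c (tproj xi) ->
  is_chart c' -> cdom c' (tproj xi) -> F c' = 'D_(F c) (transition c c') (c (tproj xi)) ->
  tvec c' (tproj xi) (F c') = tvec c (tproj xi) (F c).
Proof.
move=> hc cp hc' c'p E; apply: (tangent_eq hc' c'p); rewrite tvec_comp// E.
by rewrite (tangent_change _ hc cp hc' c'p) tvec_comp.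
Qed.

(** The rows [hco] and [vco] are components of tangent vectors of M, so each term is a value of [g]
    on such vectors. This allows an affine chart to replace the [chart_at] of the definition. *)
Lemma omega_chart (xi : TM) (a b : tangent xi) c : is_chart c -> cdom c (tproj xi) ->
  born_omega (induced_born nabla g) a b =
  bil (G c (c (tproj xi))) (hco c a) (vco nabla c b) -
  bil (G c (c (tproj xi))) (hco c b) (vco nabla c a).
Proof.
move=> hc cp; set p := tproj xi in cp *; pose c0 := chart_at p.
have hc0 : is_chart c0 := atlas_chart (chart_at_atlas p).
have c0p : cdom c0 p := chart_at_dom p.
have inv (u v : tangent xi) : bil (G c0 (c0 p)) (hco c0 u) (vco nabla c0 v) = bil (G c (c p)) (hco c u) (vco nabla c v).
  have := metric_bil (tvec c0 p (hco c0 u)) (tvec c0 p (vco nabla c0 v)) hc0 c0p.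
  rewrite !tvec_comp// => <-.
  rewrite (tvec_transport (F := fun c => hco c u) hc cp hc0 c0p (hco_change u hc cp hc0 c0p)).
  rewrite (tvec_transport (F := fun c => vco nabla c v) hc cp hc0 c0p (vco_change nabla v hc cp hc0 c0p)).
  by rewrite (metric_bil _ _ hc cp) !tvec_comp.
have GE i j : G c0 (c0 p) i j = metric_coef g c0 i j p by rewrite mxE cmapK.
rewrite -!inv /= !bilE -sumrB; apply: eq_bigr => i _; rewrite -sumrB; apply: eq_bigr => j _.
rewrite -/p -/c0 !HcoframeE !VcoframeE GE mulrBr; congr (_ - _ * _); exact: mulrC.
Qed.

Section affine.
Variable c : chart R n M.
Hypothesis ac : affine_chart nabla c.
Let hc : is_chart c := ac.1.
Let tc : chart R (n + n) TM := tchart c.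
Let htc : is_chart tc. Proof. exact: is_chart_tchart. Qed.
Let U : set 'rV[R]_(n + n) := tc @` cdom tc.
Let oU : open U. Proof. exact: cimg_open. Qed.

Let Om (z : 'rV[R]_(n + n)) : 'M[R]_(n + n) := block_mx 0 (G c (lsubmx z)) (- G c (lsubmx z)) 0.

Let Ul z : U z -> (c @` cdom c) (lsubmx z).
Proof. by move=> [xi [_ cx] <-]; exists (tproj xi) => //; rewrite row_mxKl. Qed.

Let sG i j : smooth_on U (fun z => G c (lsubmx z) i j : R^o).
Proof.
exact: (smooth_on_comp_scalar oU Ul (smooth_lsubmx oU) (smooth_metric_mx i j hc)).
Qed.

Let sOm a b : smooth_on U (fun z => Om z a b : R^o).
Proof.
rewrite -(splitK a) -(splitK b); case: (fintype.split a) => i; case: (fintype.split b) => j /=.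
- by apply: (smooth_on_eq oU _ (smooth_on_cst (0 : R^o))) => z _; rewrite block_mxEul mxE.
- by apply: (smooth_on_eq oU _ (sG i j)) => z _; rewrite block_mxEur.
- by apply: (smooth_on_eq oU _ (smooth_onN oU (sG i j))) => z _; rewrite block_mxEdl [RHS]mxE.
- by apply: (smooth_on_eq oU _ (smooth_on_cst (0 : R^o))) => z _; rewrite block_mxEdr mxE.
Qed.

Let Om_asym z : (Om z)^T = - Om z.
Proof.
by rewrite /Om tr_block_mx opp_block_mx !trmx0 !oppr0 opprK linearN /= metric_mx_sym.
Qed.

Let omegaE (xi : TM) (u v : tangent xi) : cdom tc xi ->
  born_omega (induced_born nabla g) u v = bil (Om (tc xi)) (u tc) (v tc).
Proof.
move=> [_ cp]; have cp' : cdom c (tproj xi) by [].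
rewrite (omega_chart _ _ hc cp') bil_block bilN.
have lx : lsubmx (tc xi) = c (tproj xi) by exact: row_mxKl.
rewrite lx -[X in _ = _ - X]bil_tr metric_mx_sym /vco !(ac.2 _ cp') !addr0.
by [].
Qed.

Let DmxOm z w : U z -> Dmx Om z w =
  block_mx 0 (Dmx (G c) (lsubmx z) (lsubmx w)) (- Dmx (G c) (lsubmx z) (lsubmx w)) 0.
Proof.
move=> Uz; have dl := smooth_on_diff (@smooth_lsubmx R n n _ oU) Uz.
have DG i j : 'D_w (fun z => G c (lsubmx z) i j : R^o) z = Dmx (G c) (lsubmx z) (lsubmx w) i j.
  have dG : differentiable (fun x => G c x i j : R^o) (lsubmx z).
    exact: smooth_on_diff (smooth_metric_mx i j hc) (Ul Uz).
  rewrite mxE; apply: (etrans (derive_comp w dl dG)).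
  by rewrite derive_lsubmx.
apply/matrixP => a b; rewrite -(splitK a) -(splitK b) mxE.
case: (fintype.split a) => i; case: (fintype.split b) => j /=.
- rewrite block_mxEul mxE (_ : (fun z => _) = cst (0 : R^o)) ?derive_cst//.
  by apply/funext => y; rewrite block_mxEul mxE.
- rewrite block_mxEur -DG; congr ('D_w _ z); apply/funext => y.
  by rewrite block_mxEur.
- rewrite block_mxEdl mxE -DG -deriveN; last exact: smooth_on_derivable (sG i j) Uz.
  by congr ('D_w _ z); apply/funext => y; rewrite block_mxEdl mxE.
- rewrite block_mxEdr mxE (_ : (fun z => _) = cst (0 : R^o)) ?derive_cst//.
  by apply/funext => y; rewrite block_mxEdr mxE.
Qed.

(** The matrix of omega depends on the base point alone, so a field differentiates it through its
    base half [l]; the fibre halves [r] enter only as arguments. *)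
Lemma ext_deriv_omega W (X Y Z : vfield TM) (xi : TM) : open W -> W xi -> cdom tc xi ->
  smooth_vfield W X -> smooth_vfield W Y -> smooth_vfield W Z ->
  let T u v w := bil (Dmx (G c) (c (tproj xi)) u) v w in
  let l (V : vfield TM) := lsubmx (V xi tc) in let r (V : vfield TM) := rsubmx (V xi tc) in
  ext_deriv (born_omega (induced_born nabla g)) X Y Z xi =
  T (l X) (l Y) (r Z) - T (l X) (r Y) (l Z) - (T (l Y) (l X) (r Z) - T (l Y) (r X) (l Z))
  + (T (l Z) (l X) (r Y) - T (l Z) (r X) (l Y)).
Proof.
move=> oW Wx cx sX sY sZ T l r.
rewrite (ext_deriv_chart htc sOm omegaE oW Wx cx Om_asym sX sY sZ).
have Ux : U (tc xi) by exists xi.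
have lx : lsubmx (tc xi) = c (tproj xi) by exact: row_mxKl.
have E (w u v : 'rV[R]_(n + n)) : bil (Dmx Om (tc xi) w) u v =
    T (lsubmx w) (lsubmx u) (rsubmx v) - T (lsubmx w) (rsubmx u) (lsubmx v).
  by rewrite (DmxOm w Ux) bil_block bilN lx.
have alg (a b d a' b' d' : R) : a = a' -> b = b' -> d = d' -> a - b + d = a' - b' + d'.
  by move=> -> -> ->.
exact: alg (E _ _ _) (E _ _ _) (E _ _ _).
Qed.

Lemma codazzi_closed_at W (X Y Z : vfield TM) (xi : TM) : metric_codazzi c ->
  open W -> W xi -> cdom tc xi ->
  smooth_vfield W X -> smooth_vfield W Y -> smooth_vfield W Z ->
  ext_deriv (born_omega (induced_born nabla g)) X Y Z xi = 0.
Proof.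
move=> sym oW Wx cx sX sY sZ; rewrite (ext_deriv_omega oW Wx cx sX sY sZ).
have cp : cdom c (tproj xi) by case: cx.
have T12 := sym _ cp.
have T23 u v w : bil (Dmx (G c) (c (tproj xi)) u) v w = bil (Dmx (G c) (c (tproj xi)) u) w v.
  by rewrite -bil_tr Dmx_metric_sym.
move: (lsubmx (X xi tc)) (lsubmx (Y xi tc)) (lsubmx (Z xi tc)) => a b d.
move: (rsubmx (X xi tc)) (rsubmx (Y xi tc)) (rsubmx (Z xi tc)) => a' b' d'.
exact: (alternating_sum_symmetric T12 T23).
Qed.

(** Two base directions [i], [j] and one fibre direction [k] leave just two terms of the exterior
    derivative, the derivatives of the metric coefficients to be compared. *)
Lemma closed_codazzi : closed_form (born_omega (induced_born nabla g)) -> metric_codazzi c.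
Proof.
move=> cl; apply: metric_codazziP => // p cp i j k.
pose xi0 : total_space M := existT _ p (0 : tangent p).
pose xi : TM := xi0; have cx : cdom tc xi by [].
have oW := open_cdom htc; have sd l := smooth_coord_vf l htc.
have := cl _ _ _ _ oW (sd (lshift n i)) (sd (lshift n j)) (sd (rshift n k)) xi cx.
rewrite (ext_deriv_omega oW cx cx (sd _) (sd _) (sd _)).
have ck l : coord_vf tc l xi tc = delta_mx 0 l by exact: coord_vf_comp.
move: (coord_vf tc (lshift n i) xi) (coord_vf tc (lshift n j) xi) (coord_vf tc (rshift n k) xi)
  (ck (lshift n i)) (ck (lshift n j)) (ck (rshift n k)) => vi vj vk -> -> ->.
have ll a : lsubmx (delta_mx 0 (lshift n a) : 'rV[R]_(n + n)) = delta_mx 0 a.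
  by apply/rowP => b; rewrite !mxE eq_lshift.
have rl a : rsubmx (delta_mx 0 (lshift n a) : 'rV[R]_(n + n)) = 0 :> 'rV[R]_n.
  by apply/rowP => b; rewrite !mxE eq_rlshift andbF.
have lr a : lsubmx (delta_mx 0 (rshift n a) : 'rV[R]_(n + n)) = 0 :> 'rV[R]_n.
  by apply/rowP => b; rewrite !mxE eq_lrshift andbF.
have rr a : rsubmx (delta_mx 0 (rshift n a) : 'rV[R]_(n + n)) = delta_mx 0 a.
  by apply/rowP => b; rewrite !mxE eq_rshift.
have b0l (A : 'M[R]_n) v : bil A 0 v = 0 by rewrite /bil !mul0mx mxE.
have b0r (A : 'M[R]_n) v : bil A v 0 = 0 by rewrite /bil trmx0 mulmx0 mxE.
rewrite !ll !rl !lr !rr !b0l !b0r !bil_delta !subr0 addr0 => /eqP.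
by rewrite subr_eq0 => /eqP.
Qed.

End affine.
End born.

(** * Assembly of the equivalences through affine charts *)

Section integrability.
Context {R : realType} {n : nat} {M : smooth_structure R n} (nabla : connection M).

Lemma flat_affine_charts p : flat nabla -> exists2 c, affine_chart nabla c & cdom c p.
Proof.
move=> fl; have hc : is_chart (chart_at p) := atlas_chart (chart_at_atlas p).
exact: exists_affine_chart hc (chart_at_dom p) (flat_flat_coefficients fl hc).
Qed.

(** The coefficient identities hold in the chart chosen about each point, which already gives an
    affine chart there; [affine_flat] extends the vanishing to all local fields. *)
Lemma individually_integrable_flat :
  pq_individually_integrable (induced_pq nabla) -> flat nabla.
Proof.
move=> ind; apply: affine_flat => p.
have hc : is_chart (chart_at p) := atlas_chart (chart_at_atlas p).
exact: exists_affine_chart hc (chart_at_dom p) (individually_integrable_flat_coefficients hc ind).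
Qed.

Lemma flat_pq_integrable : flat nabla -> pq_integrable (induced_pq nabla).
Proof. by move=> fl; apply: affine_pq_integrable => p; exact: flat_affine_charts. Qed.

Lemma hessian_closed g : hessian nabla g -> closed_form (born_omega (induced_born nabla g)).
Proof.
move=> hs W X Y Z oW sX sY sZ xi Wx; have [c ac cp] := flat_affine_charts (tproj xi) hs.1.
have cx : cdom (tchart c : chart R (n + n) (tangent_bundle M)) xi by split=> //; exact: ac.1.
exact: (codazzi_closed_at ac (hessian_codazzi hs ac) oW Wx cx sX sY sZ).
Qed.

Lemma closed_hessian g : flat nabla -> closed_form (born_omega (induced_born nabla g)) ->
  hessian nabla g.
Proof.
move=> fl cl; apply: codazzi_hessian => // p; have [c ac cp] := flat_affine_charts p fl.
exists c; exact: And3 ac cp (closed_codazzi ac cl).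
Qed.

End integrability.

Theorem theorem1 (R : realType) (n : nat) (M : smooth_structure R n)
    (M_hausdorff : hausdorff_space M) (M_second_countable : @second_countable M)
    (nabla : connection M) :
  ((flat nabla <-> pq_individually_integrable (induced_pq nabla)) /\
   (pq_individually_integrable (induced_pq nabla) <->
    pq_integrable (induced_pq nabla))) /\
  (forall g : riemannian_metric M,
    (hessian nabla g <-> born_integrable (induced_born nabla g)) /\
    (born_integrable (induced_born nabla g) <->
     born_strongly_integrable (induced_born nabla g))).
Proof.
have ind_flat := @individually_integrable_flat R n M nabla.
have flat_pq := @flat_pq_integrable R n M nabla.
have pq_ind := @pq_integrable_individually R n M nabla.
split=> [|g].
  split; first by split=> [/flat_pq/pq_ind|/ind_flat].
  by split=> [/ind_flat/flat_pq|/pq_ind].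
split; split.
- move=> hs; split; [exact/pq_ind/flat_pq/hs.1|exact: hessian_closed].
- by move=> [/ind_flat fl cl]; exact: closed_hessian.
- by move=> [/ind_flat/flat_pq pq cl].
- by move=> [/pq_ind ind cl].
Qed.
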